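(* Consider the random dimer covering (domino tiling) of the double Aztec diamond of size $n$ and overlap $\rho$, with weight $a>0$ on vertical dominos and $1$ on horizontal dominos. The $\mathbb L$-particles on the successive lines $\{\xi=2s\}$, $1\le s\le 2n-\rho$, form a determinantal point process with correlation kernel $$\mathbb L_{n,\rho}(\xi_1,\eta_1;\xi_2,\eta_2)=(1+a^2)\,\mathbb L^{(0)}_n(\xi_1,\eta_1;\xi_2,\eta_2)-(1+a^2)\big\langle \big((I-K_n)^{-1}_{\ge n-\rho+1}A_{\xi_1,\eta_1}\big)(k),\,B_{\xi_2,\eta_2}(k)\big\rangle_{\ge n-\rho+1}.$$ In particular, given $q$ (distinct) lines $\{\xi=2s_i\}$ and integers $k_i,\ell_i$ with $0\le k_i<\ell_i\le n$, $1\le i\le q$, $$\mathbb P\Big(\bigcap_{i=1}^q\{\text{there is no }\mathbb L\text{-particle on the line }\xi=2s_i\text{ with }\eta\in[k_i,\ell_i]\}\Big)=\det\Big(\mathbb 1-\big[\chi_{[k_i,\ell_i]}(\eta_i)\,\mathbb L_{n,\rho}(2s_i,\eta_i;2s_j,\eta_j)\,\chi_{[k_j,\ell_j]}(\eta_j)\big]_{1\le i,j\le q}\Big),$$ where the $\eta_i$ run over odd integers only.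
   Context: **Model.** $n\ge 1$, $1\le\rho\le n$ are integers with $n-\rho=2m$ even. The double Aztec diamond (two overlapping Aztec diamonds of size $n$ with overlap $\rho$) is described by its dual graph in coordinates $(\xi,\eta)$. White vertices ($x_1$ odd, $x_2$ even): $\mathtt W_{AD}=\{(x_1,x_2): 1\le x_1\le 2(2m+n)+1,\ 0\le x_2\le 2(n-1)\}\cup\{(x_1,2n):1\le x_1\le 2n-1\}$. Black vertices ($x_1$ even, $x_2$ odd): $\mathtt B_{AD}=\{(x_1,x_2):0\le x_1\le 2(2m+n),\ 1\le x_2\le 2n-1\}\cup\{(x_1,-1): 2(2m+1)\le x_1\le 2(2m+n)\}$. With $e_1=(1,1)$, $e_2=(-1,1)$, edges join a black vertex $b$ to the white vertices among $b\pm e_1$ (horizontal dominos, weight $1$) and $b\pm e_2$ (vertical dominos, weight $a$). A domino tiling is a perfect matching (dimer covering) of this graph, and a tiling $T$ has probability proportional to $a^{\#\{\text{vertical dominos in }T\}}$. **$\mathbb L$-particles.** There is an $\mathbb L$-particle at a black vertex $b$ iff the dimer covering $b$ is the edge $(b,b+e_1)$ or $(b,b-e_2)$. **Contours.** $\Gamma_{0,a}$ is a positively oriented simple closed contour enclosing $0$ and $a$ but not $-1/a$. In a double integral with $z\in\Gamma_{0,a}$ and $w\in\Gamma_{0,a,z}$, the $w$-contour encloses $0$, $a$ and the whole $z$-contour, but not $-1/a$ (similarly with the roles of $z,w$ exchanged). **Kernels and functions.** ($\mathrm i=\sqrt{-1}$, $\xi_i$ even, $\eta_i$ odd) $$\mathbb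 L_n^{(0)}(\xi_1,\eta_1;\xi_2,\eta_2)=-\mathbb 1_{\xi_1<\xi_2}\oint_{\Gamma_{0,a}}\frac{dw}{2\pi\mathrm i}\frac{(1+aw)^{(\eta_1-\eta_2)/2-1}}{(w-a)^{(\eta_1-\eta_2)/2+1}}w^{(\xi_1-\xi_2)/2}$$ $$+\oint_{\Gamma_{0,a}}\frac{dz}{(2\pi\mathrm i)^2}\oint_{\Gamma_{0,a,z}}\frac{dw}{w-z}\,\frac{(1+az)^{(\eta_1-1)/2}(z-a)^{n-(\eta_1+1)/2}\,w^{n-\xi_2/2}}{(1+aw)^{(\eta_2+1)/2}(w-a)^{n-(\eta_2-1)/2}\,z^{n-\xi_1/2}},$$ $$K_n(j,k)=\frac{(-1)^{j+k}}{(2\pi\mathrm i)^2}\oint_{\Gamma_{0,a}}dw\oint_{\Gamma_{0,a,w}}\frac{dz}{z-w}\,\frac{z^{n-j}(1+aw)^n(w-a)^{n+1}}{w^{n+1-k}(1+az)^n(z-a)^{n+1}},$$ $$A_{\xi_1,\eta_1}(k)=\frac{(-1)^k}{(2\pi\mathrm i)^2}\oint_{\Gamma_{0,a}}dz\oint_{\Gamma_{0,a,z}}\frac{dw}{w-z}\,\frac{(1+az)^{(\eta_1-1)/2}(z-a)^{n-(\eta_1+1)/2}w^{n-k}}{(1+aw)^n(w-a)^{n+1}z^{n-\xi_1/2}}-\frac{(-1)^k}{2\pi\mathrm i}\oint_{\Gamma_{0,a}}\frac{w^{\xi_1/2-k}\,dw}{(1+aw)^{n-(\eta_1-1)/2}(w-a)^{(\eta_1+3)/2}},$$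 $$B_{\xi_2,\eta_2}(k)=\frac{(-1)^k}{(2\pi\mathrm i)^2}\oint_{\Gamma_{0,a}}dw\oint_{\Gamma_{0,a,w}}\frac{dz}{w-z}\,\frac{(1+aw)^n(w-a)^{n+1}z^{n-\xi_2/2}}{(1+az)^{(\eta_2+1)/2}(z-a)^{n-(\eta_2-1)/2}w^{n+1-k}}+\frac{(-1)^k}{2\pi\mathrm i}\oint_{\Gamma_{0,a}}(1+az)^{n-(\eta_2+1)/2}(z-a)^{(\eta_2+1)/2}z^{k-1-\xi_2/2}\,dz.$$ $\langle f(k),g(k)\rangle_{\ge\alpha}=\sum_{k=\alpha}^\infty f(k)g(k)$, and $(I-K_n)^{-1}_{\ge\alpha}$ is the inverse of $I-K_n$ where the matrix $K_n(j,k)$ is restricted to $j,k\ge\alpha$ and acts by $(K_nf)(j)=\sum_{k\ge\alpha}K_n(j,k)f(k)$. (Since $K_n(j,k)=0$ for $k>n$ and $B_{\xi_2,\eta_2}(k)=0$ for large $k$, only finite sums are involved.) ''Determinantal with kernel $\mathbb L_{n,\rho}$'' means: for distinct black vertices $b_j=(\xi_j,\eta_j)$, $1\le j\le l$, on these lines, $\mathbb P[\mathbb L\text{-particles at }b_1,\dots,b_l]=\det(\mathbb L_{n,\rho}(\xi_i,\eta_i;\xi_j,\eta_j))_{1\le i,j\le l}$. The determinant in the gap formula is over the finite index set of pairs $(i,\eta)$ with $\eta$ odd, $\eta\in[k_i,\ell_i]$. *)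

(* Defs.v *)
From mathcomp Require Import all_boot all_order all_algebra.
From mathcomp Require Import complex.
From mathcomp Require Import all_classical all_reals all_analysis.

Set Implicit Arguments.
Unset Strict Implicit.
Unset Printing Implicit Defensive.

Import Order.TTheory GRing.Theory Num.Theory.
Import numFieldNormedType.Exports.

Local Open Scope classical_set_scope.
Local Open Scope ring_scope.
Local Open Scope complex_scope.

(* A box containing all vertices. The second index is shifted by one because
   the black vertices of the bottom row have second coordinate -1. *)
Definition vertex (n m : nat) : finType :=
  ('I_(2 * (2 * m + n)).+2 * 'I_(2 * n).+2)%type.

Definition pos (n m : nat) (v : vertex n m) : int * int :=
  ((v.1 : nat)%:Z, (v.2 : nat)%:Z - 1).

Definition xi (n m : nat) (v : vertex n m) : int := (pos v).1.
Definition eta (n m : nat) (v : vertex n m) : int := (pos v).2.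

Definition white (n m : nat) (v : vertex n m) : bool :=
  [&& ~~ (2 %| xi v)%Z, (2 %| eta v)%Z &
    (1 <= xi v <= 2 * (2 * m%:Z + n%:Z) + 1) &&
      (0 <= eta v <= 2 * (n%:Z - 1))
    || (1 <= xi v <= 2 * n%:Z - 1) && (eta v == 2 * n%:Z)].

Definition black (n m : nat) (v : vertex n m) : bool :=
  [&& (2 %| xi v)%Z, ~~ (2 %| eta v)%Z &
    (0 <= xi v <= 2 * (2 * m%:Z + n%:Z)) &&
      (1 <= eta v <= 2 * n%:Z - 1)
    || (2 * (2 * m%:Z + 1) <= xi v <= 2 * (2 * m%:Z + n%:Z)) &&
      (eta v == -1)].

Definition e1 : int * int := (1, 1).
Definition e2 : int * int := (-1, 1).

(* Edges are oriented: the first component is the black vertex. *)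
Definition edge (n m : nat) : finType := (vertex n m * vertex n m)%type.

Definition horizontal (n m : nat) (e : edge n m) : bool :=
  (pos e.2 == pos e.1 + e1) || (pos e.2 == pos e.1 - e1).

Definition vertical (n m : nat) (e : edge n m) : bool :=
  (pos e.2 == pos e.1 + e2) || (pos e.2 == pos e.1 - e2).

Definition is_edge (n m : nat) (e : edge n m) : bool :=
  [&& black e.1, white e.2 & horizontal e || vertical e].

Definition dimer_covering (n m : nat) (T : {set edge n m}) : bool :=
  [&& [forall e in T, is_edge e],
      [forall b : vertex n m, black b ==> (#|[set e in T | e.1 == b]| == 1%N)]
    & [forall w : vertex n m, white w ==> (#|[set e in T | e.2 == w]| == 1%N)]].

Definition weight (R : realType) (a : R) (n m : nat) (T : {set edge n m}) : R :=
  a ^+ #|[set e in T | vertical e]|.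

Definition prob (R : realType) (a : R) (n m : nat)
    (E : pred {set edge n m}) : R :=
  (\sum_(T | dimer_covering T && E T) weight a T) /
  (\sum_(T : {set edge n m} | dimer_covering T) weight a T).

Definition Lparticle (n m : nat) (T : {set edge n m}) (b : vertex n m) : bool :=
  [exists e in T, (e.1 == b) &&
    ((pos e.2 == pos b + e1) || (pos e.2 == pos b - e2))].

Definition C1_real (R : realType) (f : R -> R) : Prop :=
  (forall t : R, derivable f t 1) /\ continuous (derive1 f).

Definition C1 (R : realType) (g : R -> R[i]) : Prop :=
  C1_real (@complex.Re R \o g) /\ C1_real (@complex.Im R \o g).

(* The list 0 :: ts is a subdivision of [0, 1]. Continuity on [0, 1] is
   automatic since consecutive pieces share an endpoint. *)
Definition piecewise_C1 (R : realType) (G : R -> R[i]) : Prop :=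
  exists ts : seq R, [/\ path <%R 0 ts, last 0 ts = 1 &
    forall i, (i < size ts)%N -> exists2 g : R -> R[i], C1 g &
      {in `[nth 0 (0 :: ts) i, nth 0 (0 :: ts) i.+1], G =1 g}].

Definition trace (R : realType) (G : R -> R[i]) : set R[i] :=
  G @` `[0, 1]%classic.

Definition simple_closed (R : realType) (G : R -> R[i]) : Prop :=
  [/\ piecewise_C1 G, G 0 = G 1 & {in `[0, 1[ &, injective G}].

Definition velocity (R : realType) (G : R -> R[i]) (t : R) : R[i] :=
  derive1 (@complex.Re R \o G) t +i* derive1 (@complex.Im R \o G) t.

Definition cintegral (R : realType) (f : R -> R[i]) : R[i] :=
  (\int[lebesgue_measure]_(t in `[0, 1]%classic) complex.Re (f t)) +i*
  (\int[lebesgue_measure]_(t in `[0, 1]%classic) complex.Im (f t)).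

Definition oint (R : realType) (G : R -> R[i]) (f : R[i] -> R[i]) : R[i] :=
  cintegral (fun t => f (G t) * velocity G t).

Definition twopii (R : realType) : R[i] := (2 * pi)%:C * 'i%C.
Arguments twopii {R}.

Definition winding (R : realType) (G : R -> R[i]) (p : R[i]) : R[i] :=
  oint G (fun z => (z - p)^-1) / twopii.

(* For a simple closed curve the winding number about a point off the curve is
   0 outside and 1 or -1 inside, the sign being the orientation. *)
Definition encloses (R : realType) (G : R -> R[i]) (p : R[i]) : Prop :=
  ~ trace G p /\ winding G p = 1.

Definition leaves_out (R : realType) (G : R -> R[i]) (p : R[i]) : Prop :=
  ~ trace G p /\ winding G p = 0.

(* Positively oriented contours enclosing 0, a and S, but not -1/a. *)
Definition contour0a (R : realType) (a : R) (S : set R[i]) (G : R -> R[i]) :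
    Prop :=
  [/\ simple_closed G, encloses G 0, encloses G a%:C,
      (forall z, S z -> encloses G z) & leaves_out G (- a^-1)%:C].

(* In each double integral the outermost integral sign runs over [Gin] and the
   second one over [Gout], where [Gout] is meant to enclose the trace of [Gin].
   The kernels are only meant for even xi and odd eta, so that every argument
   of [half] is even. *)

Definition half (x : int) : int := (x %/ 2)%Z.

Definition L0 (R : realType) (a : R) (n : nat) (Gin Gout : R -> R[i])
    (xi1 eta1 xi2 eta2 : int) : R[i] :=
  - (xi1 < xi2)%R%:R *
    (oint Gin (fun w =>
       (1 + a%:C * w) ^ (half (eta1 - eta2) - 1) /
       (w - a%:C) ^ (half (eta1 - eta2) + 1) *
       w ^ half (xi1 - xi2)) / twopii)
  + oint Gin (fun z => oint Gout (fun w =>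
       (w - z)^-1 *
       (((1 + a%:C * z) ^ half (eta1 - 1) *
         (z - a%:C) ^ (n%:Z - half (eta1 + 1)) *
         w ^ (n%:Z - half xi2)) /
        ((1 + a%:C * w) ^ half (eta2 + 1) *
         (w - a%:C) ^ (n%:Z - half (eta2 - 1)) *
         z ^ (n%:Z - half xi1))))) / twopii ^+ 2.

Definition Kn (R : realType) (a : R) (n : nat) (Gin Gout : R -> R[i])
    (j k : nat) : R[i] :=
  (-1) ^+ (j + k) / twopii ^+ 2 *
  oint Gin (fun w => oint Gout (fun z =>
    (z - w)^-1 *
    ((z ^ (n%:Z - j%:Z) * (1 + a%:C * w) ^+ n * (w - a%:C) ^+ n.+1) /
     (w ^ (n%:Z + 1 - k%:Z) * (1 + a%:C * z) ^+ n * (z - a%:C) ^+ n.+1)))).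

Definition Afun (R : realType) (a : R) (n : nat) (Gin Gout : R -> R[i])
    (xi1 eta1 : int) (k : nat) : R[i] :=
  (-1) ^+ k / twopii ^+ 2 *
  oint Gin (fun z => oint Gout (fun w =>
    (w - z)^-1 *
    (((1 + a%:C * z) ^ half (eta1 - 1) *
      (z - a%:C) ^ (n%:Z - half (eta1 + 1)) *
      w ^ (n%:Z - k%:Z)) /
     ((1 + a%:C * w) ^+ n * (w - a%:C) ^+ n.+1 * z ^ (n%:Z - half xi1)))))
  - (-1) ^+ k / twopii *
    oint Gin (fun w =>
      w ^ (half xi1 - k%:Z) /
      ((1 + a%:C * w) ^ (n%:Z - half (eta1 - 1)) *
       (w - a%:C) ^ half (eta1 + 3))).

Definition Bfun (R : realType) (a : R) (n : nat) (Gin Gout : R -> R[i])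
    (xi2 eta2 : int) (k : nat) : R[i] :=
  (-1) ^+ k / twopii ^+ 2 *
  oint Gin (fun w => oint Gout (fun z =>
    (w - z)^-1 *
    (((1 + a%:C * w) ^+ n * (w - a%:C) ^+ n.+1 * z ^ (n%:Z - half xi2)) /
     ((1 + a%:C * z) ^ half (eta2 + 1) *
      (z - a%:C) ^ (n%:Z - half (eta2 - 1)) *
      w ^ (n%:Z + 1 - k%:Z)))))
  + (-1) ^+ k / twopii *
    oint Gin (fun z =>
      (1 + a%:C * z) ^ (n%:Z - half (eta2 + 1)) *
      (z - a%:C) ^ half (eta2 + 1) *
      z ^ (k%:Z - 1 - half xi2)).

Definition pairing (R : realType) (alpha : nat) (f g : nat -> R[i]) : R[i] :=
  limn (fun N => \sum_(alpha <= k < N) f k * g k : R[i]^o).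

(* Functions on {k >= alpha} are represented by functions on nat vanishing
   below alpha. *)
Definition funs_ge (R : realType) (alpha : nat) : set (nat -> R[i]) :=
  [set f | forall k, (k < alpha)%N -> f k = 0].
Arguments funs_ge : clear implicits.

Definition restr_ge (R : realType) (alpha : nat) (f : nat -> R[i]) :
    nat -> R[i] :=
  fun k => if (alpha <= k)%N then f k else 0.

Definition I_minus_K (R : realType) (a : R) (n : nat) (Gin Gout : R -> R[i])
    (alpha : nat) (f : nat -> R[i]) : nat -> R[i] :=
  restr_ge alpha (fun j => f j - pairing alpha (Kn a n Gin Gout j) f).

Definition I_minus_K_inv (R : realType) (a : R) (n : nat)
    (Gin Gout : R -> R[i]) (alpha : nat) : (nat -> R[i]) -> (nat -> R[i]) :=
  'pinv_(fun=> fun=> 0) (funs_ge R alpha) (I_minus_K a n Gin Gout alpha).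

Definition Lkernel (R : realType) (a : R) (n rho : nat) (Gin Gout : R -> R[i])
    (xi1 eta1 xi2 eta2 : int) : R[i] :=
  let alpha := (n - rho + 1)%N in
  (1 + a ^+ 2)%:C * L0 a n Gin Gout xi1 eta1 xi2 eta2 -
  (1 + a ^+ 2)%:C *
    pairing alpha
      (I_minus_K_inv a n Gin Gout alpha
         (restr_ge alpha (Afun a n Gin Gout xi1 eta1)))
      (Bfun a n Gin Gout xi2 eta2).

(* Pairs (i, eta) with eta odd in [k i, l i]; a natural number eta <= n suffices
   because 0 <= k i and l i <= n. *)
Definition gap_index (n q : nat) (k l : 'I_q -> nat) :
    {set 'I_q * 'I_n.+1} :=
  [set p : 'I_q * 'I_n.+1 | odd p.2 && (k p.1 <= p.2 <= l p.1)%N].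

(* Main.v *)
Require Import Defs.
From mathcomp Require Import all_boot all_order all_algebra fingroup perm.
From mathcomp Require Import complex.
From mathcomp Require Import all_classical all_reals all_analysis.
From mathcomp Require Import measurable_realfun ring lra zify.

Set Implicit Arguments.
Unset Strict Implicit.
Unset Printing Implicit Defensive.

Import Order.TTheory GRing.Theory Num.Theory.
Import numFieldNormedType.Exports.

Local Open Scope classical_set_scope.
Local Open Scope ring_scope.
Local Open Scope complex_scope.

(** The black vertices [(2 s, 2 j - 1)] with a fixed [s] form a column, and so
    do the white vertices [(2 s + 1, 2 i)].  A black vertex of column [s] has
    its white neighbours in the white columns [s] and [s - 1], and it carries an
    L-particle exactly when it is matched to the right.  Let [K = K_R - K_L] be
    the matrix with entries [1] and [- a] on the two edges to the right and
    [- 1] and [- a] on the two edges to the left.  With these signs all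
    coverings contribute to [\det K] with the same sign ([good_sign]).  If the
    rows of the black vertices [b_1, ..., b_l] are modified by a factor [x] on
    the right edges and [y] on the left edges, the determinant is therefore
    proportional to the expectation of the product over [j] of [x] or [y],
    according to whether [b_j] carries a particle.  After multiplication by the
    inverse of [K] all other rows are those of the identity, so
    ([det_principal], [prob_family]) this expectation is the determinant of
    [y + (x - y) K_R K^-1] on the rows and columns [b_1, ..., b_l].  The choice
    [x = 1], [y = 0] gives the correlation functions and [x = 0], [y = 1] the
    gap probabilities.  What remains is to identify [K_R K^-1] with the kernel.

    To solve [K x = delta] at the black vertex [(s', j')], let [x (s, i)] be the
    sum of the residues at [0] and [a] of [f_s(z) ((1 + a z) / (z - a))^(i + 1)].
    The two identities
    [(1 + a z) / (z - a) - a = (1 + a^2) / (z - a)] and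
    [1 + a (1 + a z) / (z - a) = (1 + a^2) z / (z - a)]
    show that [K x = 0] in the bulk as soon as [f_(s+1)(z) = z f_s(z)], and the
    right-hand side is created by adding [(z - a)^j' / (1 + a z)^(j' + 1)] at the
    column [s'] ([white_value_right], [white_value_left]).  The boundary of the
    diamond asks in addition that some of the residues vanish; all these
    conditions follow from one relation between polynomials,
    [N = X^(T - s') D^(n - j') E^j' + P X^n D^n + V X^(2 m) E^(n + 1)]
    with [D = 1 + a X], [E = X - a], [T = 2 m + n] and small [N] and [P].

    On the other side, the factor [1 / (w - z)] in the double integrals projects
    a rational function to its part with a pole at [- 1 / a] ([nested_integral]);
    this part is found by a Bezout relation ([pole_split]).  All ingredients of
    the kernel thus become residues of products of two explicit functions, and
    the product of a row vector with [1 - K_n] is a list of coefficients of a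
    polynomial ([row_mul_1K]).  Hence solving the linear system for [1 - K_n] is
    the same as finding the relation above, and the resulting [K_R x] is the
    kernel ([Lkernel_kastR]).  The same dictionary turns a vector in the kernel of
    [1 - K_n] into a solution of [K x = 0]; since [\det K] is a sum of positive
    weights up to a sign, and a covering exists, both are invertible ([unit_1K],
    [det_kast_mx_neq0]).

    The contours are only known to be piecewise C1 with prescribed winding
    numbers.  All integrands are rational, and for these the residue calculus
    follows from partial fractions and the fundamental theorem of calculus
    ([oint_rat_eq0]). *)

(** * Integration along piecewise C1 curves *)

Lemma integrable_cup d (T : measurableType d) (R : realType)
    (mu : {measure set T -> \bar R}) (A B : set T) (f : T -> \bar R) :
  measurable A -> measurable B -> [disjoint A & B] ->
  mu.-integrable A f -> mu.-integrable B f -> mu.-integrable (A `|` B) f.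
Proof.
move=> mA mB AB /integrableP[mfA iA] /integrableP[mfB iB].
have mf : measurable_fun (A `|` B) f by apply/measurable_funU.
apply/integrableP; split=> //.
rewrite ge0_integral_setU//; first by rewrite lte_add_pinfty.
exact: measurableT_comp.
Qed.

Section PieceIntegrals.
Variable R : realType.
Notation mu := (@lebesgue_measure R).

(** The velocity of a piecewise curve is that of the smooth piece only in the
    interior of the segment; the end points are negligible. *)
Lemma integrable_open_segment (phi psi : R -> R) (s t : R) :
  s < t -> {within `[s, t], continuous psi} -> {in `]s, t[, phi =1 psi} ->
  mu.-integrable `[s, t] (EFin \o phi) /\
  \int[mu]_(u in `[s, t]) phi u = \int[mu]_(u in `[s, t]) psi u.
Proof.
move=> st cpsi e.
have ipsi : mu.-integrable `[s, t] (EFin \o psi).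
  by apply: continuous_compact_integrable => //; exact: segment_compact.
have ipsio : mu.-integrable `]s, t[ (EFin \o psi).
  by apply: integrableS ipsi => //; exact: subset_itv_oo_cc.
have iphio : mu.-integrable `]s, t[ (EFin \o phi).
  apply: eq_integrable ipsio => // x; rewrite inE /= => xst.
  by rewrite e.
have iphi : mu.-integrable `[s, t] (EFin \o phi).
  rewrite (@negligible_integrable _ _ _ mu _ [set s; t])//.
  - suff -> : `[s, t]%classic `\` [set s; t] = `]s, t[%classic by [].
    apply/seteqP; split=> x /=; rewrite !in_itv/=.
      move=> [/andP[sx xt] /not_orP[/eqP xs /eqP x1]].
      by rewrite !lt_neqAle eq_sym xs sx x1 xt.
    move=> /andP[sx xt]; split; first by rewrite !ltW.
    by move=> [] xx; move: sx xt; rewrite xx ltxx.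
  - by apply: measurableU; exact: measurable_set1.
  - exact: emeasurable_fun_itv_cc (measurable_int mu iphio).
  - by apply: countable_lebesgue_measure0; exact: finite_set_countable.
split=> //; rewrite /Rintegral; congr fine.
apply: eq_integral_itv_bounded => //.
  by have /measurable_EFinP := measurable_int mu iphio.
by have /measurable_EFinP := measurable_int mu ipsio.
Qed.

End PieceIntegrals.

Section ComplexDerivative.
Variable R : realType.
Notation C := R[i].
Notation Re := (@complex.Re R).
Notation Im := (@complex.Im R).
Implicit Types (g h : R -> C) (t : R) (d v : C).

Lemma complex_ext (x y : C) : Re x = Re y -> Im x = Im y -> x = y.
Proof. by case: x y => [a b] [c e] /= -> ->. Qed.

Lemma Re_mulc (x y : C) : Re (x * y) = Re x * Re y - Im x * Im y.
Proof. by case: x; case: y. Qed.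

Lemma Im_mulc (x y : C) : Im (x * y) = Re x * Im y + Im x * Re y.
Proof. by case: x; case: y. Qed.

Lemma Re_oppc (x : C) : Re (- x) = - Re x. Proof. by case: x. Qed.

Lemma Im_oppc (x : C) : Im (- x) = - Im x. Proof. by case: x. Qed.

Definition has_cderiv g t d : Prop :=
  is_derive t 1 (Re \o g) (Re d) /\ is_derive t 1 (Im \o g) (Im d).

Lemma has_cderiv_cst (c : C) t : has_cderiv (fun=> c) t 0.
Proof. by split; apply: is_derive_cst. Qed.

Lemma has_cderivD g h t d v :
  has_cderiv g t d -> has_cderiv h t v ->
  has_cderiv (fun u => g u + h u) t (d + v).
Proof.
move=> [gr gi] [hr hi]; split.
  rewrite (_ : _ \o _ = (Re \o g) + (Re \o h)); last first.
    by apply/funext => u /=; rewrite fctE raddfD.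
  by rewrite raddfD; apply: is_deriveD.
rewrite (_ : _ \o _ = (Im \o g) + (Im \o h)); last first.
  by apply/funext => u /=; rewrite fctE raddfD.
by rewrite raddfD; apply: is_deriveD.
Qed.

Lemma has_cderivM g h t d v :
  has_cderiv g t d -> has_cderiv h t v ->
  has_cderiv (fun u => g u * h u) t (g t * v + h t * d).
Proof.
move=> [gr gi] [hr hi]; split.
  rewrite (_ : _ \o _ = (Re \o g) * (Re \o h) - (Im \o g) * (Im \o h)).
    apply: (is_derive_eq (is_deriveB (is_deriveM gr hr) (is_deriveM gi hi))).
    rewrite [in RHS]raddfD [in RHS]/= !Re_mulc /GRing.scale /=; ring.
  by apply/funext => u /=; rewrite Re_mulc.
rewrite (_ : _ \o _ = (Re \o g) * (Im \o h) + (Im \o g) * (Re \o h)).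
  apply: (is_derive_eq (is_deriveD (is_deriveM gr hi) (is_deriveM gi hr))).
  rewrite [in RHS]raddfD [in RHS]/= !Im_mulc /GRing.scale /=; ring.
by apply/funext => u /=; rewrite Im_mulc.
Qed.

Lemma has_cderivV g t d :
  g t != 0 -> has_cderiv g t d ->
  has_cderiv (fun u => (g u)^-1) t (- d / g t ^+ 2).
Proof.
move=> g0 [gr gi].
have n0 : Re (g t) ^+ 2 + Im (g t) ^+ 2 != 0.
  apply: contra g0; rewrite paddr_eq0 ?sqr_ge0// !sqrf_eq0.
  by case: (g t) => x y /=; rewrite eq_complex.
pose N := (Re \o g) ^+ 2 + (Im \o g) ^+ 2.
have dN : is_derive t 1 N (2 * Re (g t) * Re d + 2 * Im (g t) * Im d).
  rewrite /N !expr2.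
  apply: (is_derive_eq (is_deriveD (is_deriveM gr gr) (is_deriveM gi gi))).
  by rewrite /GRing.scale /=; ring.
have dVN := @is_deriveV _ N _ _ _ n0 dN.
have REV (x : C) : Re x^-1 = Re x / (Re x ^+ 2 + Im x ^+ 2) by case: x.
have IMV (x : C) : Im x^-1 = - Im x / (Re x ^+ 2 + Im x ^+ 2).
  by case: x => ? ? /=; rewrite mulNr.
have Ew : - d / g t ^+ 2 = - (d * ((g t)^-1 * (g t)^-1)).
  by rewrite expr2 invfM mulNr.
have NE u : N u = Re (g u) ^+ 2 + Im (g u) ^+ 2 by [].
split.
  rewrite (_ : _ \o _ = (Re \o g) * (fun y => (N y)^-1)).
    apply: (is_derive_eq (is_deriveM gr dVN)).
    rewrite Ew Re_oppc !Re_mulc !Im_mulc !REV !IMV NE /GRing.scale /comp.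
    by move: (Re (g t)) (Im (g t)) (Re d) (Im d) n0 => x y u v n0 /=; field.
  by apply/funext => u; rewrite /comp REV fctE NE.
rewrite (_ : _ \o _ = - (Im \o g) * (fun y => (N y)^-1)).
  apply: (is_derive_eq (is_deriveM (is_deriveN gi) dVN)).
  rewrite Ew Im_oppc !Im_mulc !Re_mulc !REV !IMV NE /GRing.scale /comp.
  rewrite !fctE.
  by move: (Re (g t)) (Im (g t)) (Re d) (Im d) n0 => x y u v n0 /=; field.
by apply/funext => u; rewrite /comp IMV !fctE NE.
Qed.

(** Complex differentiability tested along curves only: this is what the
    fundamental theorem of calculus needs on a path, and it contains the chain
    rule by definition. *)
Definition has_hderiv (f : C -> C) (p d : C) : Prop :=
  forall g t v, g t = p -> has_cderiv g t v -> has_cderiv (f \o g) t (d * v).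

Lemma has_hderiv_id p : has_hderiv id p 1.
Proof. by move=> g t v _; rewrite mul1r. Qed.

Lemma has_hderiv_cst c p : has_hderiv (fun=> c) p 0.
Proof. by move=> g t v _ _; rewrite mul0r; apply: has_cderiv_cst. Qed.

Lemma has_hderivD f1 f2 p d1 d2 :
  has_hderiv f1 p d1 -> has_hderiv f2 p d2 ->
  has_hderiv (fun z => f1 z + f2 z) p (d1 + d2).
Proof.
move=> h1 h2 g t v gt gv; rewrite mulrDl.
by apply: has_cderivD; [apply: h1|apply: h2].
Qed.

Lemma has_hderivM f1 f2 p d1 d2 :
  has_hderiv f1 p d1 -> has_hderiv f2 p d2 ->
  has_hderiv (fun z => f1 z * f2 z) p (f1 p * d2 + f2 p * d1).
Proof.
move=> h1 h2 g t v gt gv; rewrite mulrDl -!mulrA -gt.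
by apply: has_cderivM; [apply: h1|apply: h2].
Qed.

Lemma has_hderivV f p d :
  f p != 0 -> has_hderiv f p d ->
  has_hderiv (fun z => (f z)^-1) p (- d / f p ^+ 2).
Proof.
move=> f0 h g t v gt gv; rewrite -gt mulrAC mulNr.
by apply: has_cderivV; [rewrite /= gt|apply: h].
Qed.

Lemma has_hderivX f p d n :
  has_hderiv f p d ->
  has_hderiv (fun z => f z ^+ n) p (n%:R * f p ^+ n.-1 * d).
Proof.
move=> h; elim: n => [|n IHn].
  by rewrite !mul0r; apply: has_hderiv_cst.
rewrite (_ : (fun z => _) = (fun z => f z * f z ^+ n)); last first.
  by apply/funext => z; rewrite exprS.
have := has_hderivM h IHn; congr has_hderiv.
case: n {IHn} => [|n] /=; first by rewrite !mul0r mulr0 add0r expr0 !mul1r.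
by rewrite -[in RHS]natr1 !exprS; ring.
Qed.

End ComplexDerivative.
Arguments has_hderiv_cst {R} c p.
Arguments has_hderiv_id {R} p.

Section ContourIntegrals.
Variable R : realType.
Notation C := R[i].
Notation Re := (@complex.Re R).
Notation Im := (@complex.Im R).
Notation mu := (@lebesgue_measure R).
Implicit Types (G : R -> C) (f F : C -> C).

Lemma path_lt_last (s : R) ts : path <%R s ts -> s <= last s ts.
Proof.
elim: ts s => [|t ts IHts] s //= /andP[st /IHts].
by apply: le_trans; exact: ltW.
Qed.

Lemma path_lt_nth (s : R) ts i : path <%R s ts -> (i < size ts)%N ->
  [/\ s <= nth 0 (s :: ts) i, nth 0 (s :: ts) i < nth 0 (s :: ts) i.+1 &
      nth 0 (s :: ts) i.+1 <= last s ts].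
Proof.
elim: ts s i => [|t ts IHts] s [|i] //= /andP[st pts].
  by move=> _; split=> //; exact: path_lt_last.
move=> /(IHts t i pts)[H1 H2 H3]; split=> //.
by apply: le_trans H1; exact: ltW.
Qed.

Lemma glue_integrable (phi : R -> R) (s : R) ts : path <%R s ts ->
  (forall i, (i < size ts)%N ->
    mu.-integrable `[nth 0 (s :: ts) i, nth 0 (s :: ts) i.+1] (EFin \o phi)) ->
  mu.-integrable `[s, last s ts] (EFin \o phi).
Proof.
elim: ts s => [|t ts IHts] s /=.
  move=> _ _; rewrite set_itv1; apply: null_set_integrable => //.
    exact: measurable_fun_set1.
  exact: lebesgue_measure_set1.
move=> /andP[st pts] H.
have -> : `[s, last t ts]%classic = `[s, t]%classic `|` `]t, last t ts]%classic.
  by apply: itv_bndbnd_setU; rewrite bnd_simp; [exact: ltW|exact: path_lt_last].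
apply: integrable_cup => //.
- apply/disj_setPS => x /= []; rewrite !in_itv /= => /andP[_ xt] /andP[tx _].
  by rewrite ltNge xt in tx.
- exact: (H 0%N).
- have it : mu.-integrable `[t, last t ts] (EFin \o phi).
    by apply: IHts => // i its; exact: (H i.+1).
  by apply: integrableS it => //; exact: subset_itv_oc_cc.
Qed.

(** [Phi] need not be differentiable at the break points of the subdivision, so
    the increments are summed over the pieces. *)
Lemma glue_integral (phi Phi : R -> R) (s : R) ts : path <%R s ts ->
  (forall i, (i < size ts)%N ->
    mu.-integrable `[nth 0 (s :: ts) i, nth 0 (s :: ts) i.+1] (EFin \o phi)) ->
  (forall i, (i < size ts)%N ->
    \int[mu]_(u in `[nth 0 (s :: ts) i, nth 0 (s :: ts) i.+1]) phi u =
    Phi (nth 0 (s :: ts) i.+1) - Phi (nth 0 (s :: ts) i)) ->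
  \int[mu]_(u in `[s, last s ts]) phi u = Phi (last s ts) - Phi s.
Proof.
elim: ts s => [|t ts IHts] s /=.
  by move=> _ _; rewrite set_itv1 Rintegral_set1 subrr.
move=> /andP[st pts] Hi HI.
have Hi' i : (i < size ts)%N ->
    mu.-integrable `[nth 0 (t :: ts) i, nth 0 (t :: ts) i.+1] (EFin \o phi).
  by move=> its; exact: (Hi i.+1).
have it := glue_integrable pts Hi'.
have its := @glue_integrable phi s (t :: ts).
rewrite /= st in its; move: its => /(_ pts Hi) its.
have := @Rintegral_itvB R phi (BLeft s) (BRight (last t ts)) t its.
rewrite !bnd_simp ltW// path_lt_last// => /(_ erefl erefl).
rewrite Rintegral_itv_obnd_cbnd; last first.
  by apply: integrableS it => //; exact: subset_itv_oc_cc.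
rewrite (IHts t pts Hi'); last by move=> i its'; exact: (HI i.+1).
have /= -> := HI 0%N isT.
by move/eqP; rewrite subr_eq => /eqP ->; ring.
Qed.

Lemma C1_has_cderiv (g : R -> C) t : C1 g -> has_cderiv g t (velocity g t).
Proof.
by move=> [[dr _] [di _]]; split; rewrite /velocity /= derive1E;
   [exact: derivableP (dr t)|exact: derivableP (di t)].
Qed.

Lemma velocity_eq G (g : R -> C) (s t u : R) :
  {in `[s, t], G =1 g} -> u \in `]s, t[ -> velocity G u = velocity g u.
Proof.
move=> Gg ust.
have near : \near u, G u = g u.
  have : nbhs u `]s, t[%classic by apply: near_in_itvoo.
  by apply: filterS => x xst; apply: Gg; exact: subset_itv_oo_cc.
rewrite /velocity !derive1E; congr (_ +i* _); apply: near_eq_derive;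
  by apply: filterS near => x /= ->.
Qed.

Definition hol_on G f : Prop :=
  forall p, trace G p -> exists d, has_hderiv f p d.

(** On [s, t] the curve is the restriction of a C1 curve [g] defined everywhere.
    Up to the end points the integrand is continuous, and it is the derivative
    of [F \o g] when [F] is a primitive of [f]. *)
Lemma piece_integral G (g : R -> C) f (s t : R) :
  s < t -> `[s, t] `<=` `[0, 1]%classic ->
  C1 g -> {in `[s, t], G =1 g} -> hol_on G f ->
  [/\ mu.-integrable `[s, t] (EFin \o (fun u => Re (f (G u) * velocity G u))),
      mu.-integrable `[s, t] (EFin \o (fun u => Im (f (G u) * velocity G u))) &
  forall F, (forall p, trace G p -> has_hderiv F p (f p)) ->
  \int[mu]_(u in `[s, t]) Re (f (G u) * velocity G u) =
    Re (F (G t)) - Re (F (G s)) /\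
  \int[mu]_(u in `[s, t]) Im (f (G u) * velocity G u) =
    Im (F (G t)) - Im (F (G s))].
Proof.
move=> st sub01 g1 Gg hf.
have tr u : u \in `[s, t] -> trace G (g u).
  by move=> ust; exists u; [exact: sub01|exact: Gg].
have [c1 c2] : {within `[s, t], continuous (Re \o (f \o g))} /\
               {within `[s, t], continuous (Im \o (f \o g))}.
  split; apply: derivable_within_continuous => u ust;
    have [d fd] := hf _ (tr u ust);
    by have [[? _] [? _]] := fd g u _ erefl (C1_has_cderiv u g1).
have [c3 c4] : {within `[s, t], continuous (Re \o velocity g)} /\
               {within `[s, t], continuous (Im \o velocity g)}.
  by case: g1 => -[_ cr] [_ ci]; split; apply: continuous_subspaceT.
have Evel u : u \in `]s, t[ ->
    f (G u) * velocity G u = f (g u) * velocity g u.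
  move=> ust; rewrite (velocity_eq Gg ust) Gg//.
  exact: subset_itv_oo_cc.
have cRe : {within `[s, t], continuous (fun u => Re (f (g u) * velocity g u))}.
  rewrite (_ : (fun u => _) = (Re \o (f \o g)) * (Re \o velocity g)
                             - (Im \o (f \o g)) * (Im \o velocity g)).
    by move=> x; apply: cvgB; apply: cvgM;
        [exact: c1|exact: c3|exact: c2|exact: c4].
  by apply/funext => u; rewrite Re_mulc.
have cIm : {within `[s, t], continuous (fun u => Im (f (g u) * velocity g u))}.
  rewrite (_ : (fun u => _) = (Re \o (f \o g)) * (Im \o velocity g)
                             + (Im \o (f \o g)) * (Re \o velocity g)).
    by move=> x; apply: cvgD; apply: cvgM;
        [exact: c1|exact: c4|exact: c2|exact: c3].
  by apply/funext => u; rewrite Im_mulc.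
have [i1 e1] := @integrable_open_segment _ (fun u => Re (f (G u) * velocity G u))
  _ _ _ st cRe (fun u ust => congr1 Re (Evel u ust)).
have [i2 e2] := @integrable_open_segment _ (fun u => Im (f (G u) * velocity G u))
  _ _ _ st cIm (fun u ust => congr1 Im (Evel u ust)).
split; [exact: i1|exact: i2|move=> F dF; rewrite e1 e2].
have dFg u : u \in `[s, t] -> has_cderiv (F \o g) u (f (g u) * velocity g u).
  by move=> ust; exact: (dF _ (tr u ust) g u _ erefl (C1_has_cderiv u g1)).
have sst : s \in `[s, t] by rewrite in_itv /= lexx ltW.
have tst : t \in `[s, t] by rewrite in_itv /= lexx ltW.
rewrite (Gg _ sst) (Gg _ tst).
clear e1 e2 i1 i2.
have bnd (P : C -> R) (dP : R -> R) :
    (forall u, u \in `[s, t] -> is_derive u (1 : R) (P \o (F \o g)) (dP u)) ->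
    derivable_oo_LRcontinuous (P \o (F \o g)) s t /\
    {in `]s, t[, derive1 (P \o (F \o g)) =1 dP}.
  move=> H.
  have cH u : u \in `[s, t] -> {for u, continuous (P \o (F \o g))}.
    move=> ust; apply/differentiable_continuous/derivable1_diffP.
    by have [] := H u ust.
  split; first split.
  - by move=> x xst; have [] := H x (subset_itv_oo_cc xst).
  - exact: cvg_at_right_filter (cH s sst).
  - exact: cvg_at_left_filter (cH t tst).
  - by move=> x xst; rewrite derive1E; have [_ ->] := H x (subset_itv_oo_cc xst).
have [b1 b2] := bnd Re _ (fun u ust => (dFg u ust).1).
have [b3 b4] := bnd Im _ (fun u ust => (dFg u ust).2).
by split; rewrite /Rintegral;
   [rewrite (continuous_FTC2 st cRe b1 b2)|rewrite (continuous_FTC2 st cIm b3 b4)].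
Qed.

(** Integrability is recorded with the fundamental theorem because the
    linearity of [oint] rests on it. *)
Lemma contour_integral G f : piecewise_C1 G -> hol_on G f ->
  [/\ mu.-integrable `[0, 1] (EFin \o (fun u => Re (f (G u) * velocity G u))),
      mu.-integrable `[0, 1] (EFin \o (fun u => Im (f (G u) * velocity G u))) &
  forall F, (forall p, trace G p -> has_hderiv F p (f p)) ->
    oint G f = F (G 1) - F (G 0)].
Proof.
move=> [ts [pts tsl pieces]] hf.
have P i : (i < size ts)%N ->
    let s := nth 0 (0 :: ts) i in let t := nth 0 (0 :: ts) i.+1 in
    [/\ mu.-integrable `[s, t] (EFin \o (fun u => Re (f (G u) * velocity G u))),
        mu.-integrable `[s, t] (EFin \o (fun u => Im (f (G u) * velocity G u))) &
    forall F, (forall p, trace G p -> has_hderiv F p (f p)) ->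
    \int[mu]_(u in `[s, t]) Re (f (G u) * velocity G u) =
      Re (F (G t)) - Re (F (G s)) /\
    \int[mu]_(u in `[s, t]) Im (f (G u) * velocity G u) =
      Im (F (G t)) - Im (F (G s))].
  move=> its; have [g g1 Gg] := pieces i its.
  have [p1 p2 p3] := path_lt_nth pts its; rewrite tsl in p3.
  apply: (piece_integral p2 _ g1 Gg hf) => x /=; rewrite !in_itv/=.
  by move=> /andP[sx xt]; rewrite (le_trans p1 sx) (le_trans xt p3).
have I1 : mu.-integrable `[0, 1] (EFin \o (fun u => Re (f (G u) * velocity G u))).
  by rewrite -[X in `[_, X]]tsl; apply: glue_integrable => // i /P[].
have I2 : mu.-integrable `[0, 1] (EFin \o (fun u => Im (f (G u) * velocity G u))).
  by rewrite -[X in `[_, X]]tsl; apply: glue_integrable => // i /P[].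
split; [exact: I1|exact: I2|move=> F dF; rewrite /oint /cintegral].
have := @glue_integral (fun u => Re (f (G u) * velocity G u)) (Re \o (F \o G)) 0
    ts pts.
rewrite tsl => ->; last 2 first.
- by move=> i /P[].
- by move=> i /P[_ _ /(_ F dF)[]].
have := @glue_integral (fun u => Im (f (G u) * velocity G u)) (Im \o (F \o G)) 0
    ts pts.
rewrite tsl => ->; last 2 first.
- by move=> i /P[].
- by move=> i /P[_ _ /(_ F dF)[]].
by rewrite /comp; case: (F (G 1)); case: (F (G 0)).
Qed.

Lemma oint_primitive G f F : piecewise_C1 G -> G 0 = G 1 -> hol_on G f ->
  (forall p, trace G p -> has_hderiv F p (f p)) -> oint G f = 0.
Proof.
by move=> pG G01 hf dF; have [_ _ /(_ F dF) ->] := contour_integral pG hf;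
  rewrite G01 subrr.
Qed.

Lemma eq_oint G f1 f2 : (forall p, trace G p -> f1 p = f2 p) ->
  oint G f1 = oint G f2.
Proof.
move=> e; rewrite /oint /cintegral; congr (_ +i* _);
  by apply: eq_Rintegral => u; rewrite inE /= => u01; rewrite e//; exists u.
Qed.

Lemma ointD G f1 f2 : piecewise_C1 G -> hol_on G f1 -> hol_on G f2 ->
  oint G (fun z => f1 z + f2 z) = oint G f1 + oint G f2.
Proof.
move=> pG h1 h2.
have [r1 i1 _] := contour_integral pG h1; have [r2 i2 _] := contour_integral pG h2.
apply: complex_ext; rewrite /oint /cintegral /=.
  rewrite -RintegralD//; apply: eq_Rintegral => u _.
  by rewrite mulrDl raddfD.
rewrite -RintegralD//; apply: eq_Rintegral => u _.
by rewrite mulrDl raddfD.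
Qed.

Lemma ointZ G f c : piecewise_C1 G -> hol_on G f ->
  oint G (fun z => c * f z) = c * oint G f.
Proof.
move=> pG h; have [r i _] := contour_integral pG h.
apply: complex_ext; rewrite ?Re_mulc ?Im_mulc /oint /cintegral /=.
  rewrite -!RintegralZl// -RintegralB//.
  - by apply: eq_Rintegral => u _; rewrite -mulrA Re_mulc.
  - exact: (integrableZl _ (Re c) r).
  - exact: (integrableZl _ (Im c) i).
rewrite -!RintegralZl// -RintegralD//.
- by apply: eq_Rintegral => u _; rewrite -mulrA Im_mulc.
- exact: (integrableZl _ (Re c) i).
- exact: (integrableZl _ (Im c) r).
Qed.

End ContourIntegrals.

(** * Rational functions on closed curves *)

Section RationalResidues.
Variable R : realType.
Notation C := R[i].
Implicit Types (G : R -> C) (f : C -> C) (P Q : {poly C}) (ps : seq C).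

Lemma hol_on_cst G c : hol_on G (fun=> c).
Proof. by move=> p _; exists 0; exact: has_hderiv_cst. Qed.

Lemma hol_on_id G : hol_on G id.
Proof. by move=> p _; exists 1; exact: has_hderiv_id. Qed.

Lemma hol_onD G f1 f2 : hol_on G f1 -> hol_on G f2 ->
  hol_on G (fun z => f1 z + f2 z).
Proof.
by move=> h1 h2 p Gp; have [d1 e1] := h1 p Gp; have [d2 e2] := h2 p Gp;
  eexists; exact: has_hderivD e1 e2.
Qed.

Lemma hol_onM G f1 f2 : hol_on G f1 -> hol_on G f2 ->
  hol_on G (fun z => f1 z * f2 z).
Proof.
by move=> h1 h2 p Gp; have [d1 e1] := h1 p Gp; have [d2 e2] := h2 p Gp;
  eexists; exact: has_hderivM e1 e2.
Qed.

Lemma hol_onV G f : (forall p, trace G p -> f p != 0) -> hol_on G f ->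
  hol_on G (fun z => (f z)^-1).
Proof.
by move=> n0 h p Gp; have [d e] := h p Gp; eexists; apply: has_hderivV e; exact: n0.
Qed.

Lemma hol_onX G f n : hol_on G f -> hol_on G (fun z => f z ^+ n).
Proof. by move=> h p Gp; have [d e] := h p Gp; eexists; exact: has_hderivX e. Qed.

Lemma has_hderiv_horner P p : has_hderiv (fun z => P.[z]) p (deriv P).[p].
Proof.
elim/poly_ind: P => [|P c IHP].
  rewrite deriv0 horner0 (_ : (fun z => _) = fun=> 0); first exact: has_hderiv_cst.
  by apply/funext => z; rewrite horner0.
rewrite (_ : (fun z => _) = fun z => P.[z] * z + c); last first.
  by apply/funext => z; rewrite !hornerE.
rewrite derivD derivM derivX derivC !hornerE.
have := has_hderivD (has_hderivM IHP (has_hderiv_id p)) (has_hderiv_cst c p).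
by congr has_hderiv; ring.
Qed.

Lemma hol_on_horner G P : hol_on G (fun z => P.[z]).
Proof. by move=> p _; eexists; exact: has_hderiv_horner. Qed.

Lemma hol_on_prod G ps : hol_on G (fun z => \prod_(p <- ps) (z - p)).
Proof.
rewrite (_ : (fun z => _) = fun z => (\prod_(p <- ps) ('X - p%:P)).[z]).
  exact: hol_on_horner.
apply/funext => z; rewrite horner_prod; apply: eq_bigr => p _.
by rewrite hornerXsubC.
Qed.

Definition rat P ps (z : C) : C := P.[z] / \prod_(p <- ps) (z - p).

Lemma prod_sub_neq0 ps z : z \notin ps -> \prod_(p <- ps) (z - p) != 0.
Proof.
move=> zps; rewrite prodf_seq_neq0; apply/allP => p pps /=.
by rewrite subr_eq0; apply: contraNneq zps => ->.
Qed.

Lemma hol_on_rat G P ps : (forall p, p \in ps -> ~ trace G p) ->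
  hol_on G (rat P ps).
Proof.
move=> H; apply: hol_onM; first exact: hol_on_horner.
apply: hol_onV; last exact: hol_on_prod.
by move=> p Gp; apply: prod_sub_neq0; apply/negP => /H.
Qed.

Lemma oint_horner G P : piecewise_C1 G -> G 0 = G 1 ->
  oint G (fun z => P.[z]) = 0.
Proof.
move=> pG G01.
pose Q := \poly_(i < (size P).+1) (P`_i.-1 / i%:R).
apply: (oint_primitive (F := fun z => Q.[z])) => //; first exact: hol_on_horner.
move=> p _; suff <- : deriv Q = P by exact: has_hderiv_horner.
apply/polyP => i; rewrite coef_deriv coef_poly ltnS /=.
case: ltnP => iP; last by rewrite mul0rn nth_default.
by rewrite -[LHS]mulr_natr divfK// pnatr_eq0.
Qed.

(** A pole of order at least two has a rational primitive. *)
Lemma oint_pole G p n : piecewise_C1 G -> G 0 = G 1 -> ~ trace G p ->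
  oint G (fun z => (z - p) ^- n.+2) = 0.
Proof.
move=> pG G01 Gp.
have n0 q : trace G q -> q - p != 0.
  by move=> Gq; rewrite subr_eq0; apply/eqP => qp; rewrite qp in Gq.
have hsub : hol_on G (fun z => z - p).
  by apply: hol_onD; [exact: hol_on_id|exact: hol_on_cst].
apply: (oint_primitive (F := fun z => - n.+1%:R^-1 * (z - p) ^- n.+1)) => //.
  by apply: (@hol_onV _ (fun z => (z - p) ^+ n.+2)) (hol_onX _ hsub) =>
      q Gq; apply: expf_neq0; exact: n0.
move=> q Gq; have q0 := n0 q Gq.
have h1 : has_hderiv (fun z => z - p) q (1 + 0).
  by apply: has_hderivD; [exact: has_hderiv_id|exact: has_hderiv_cst].
have h2 := @has_hderivV _ (fun z => (z - p) ^+ n.+1) q _ (expf_neq0 n.+1 q0)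
  (has_hderivX n.+1 h1).
have := has_hderivM (has_hderiv_cst (- n.+1%:R^-1) q) h2.
congr has_hderiv; rewrite /= mulr0 addr0 addr0 mulr1.
have n1 : n.+1%:R != 0 :> C by rewrite pnatr_eq0.
move: (q - p) q0 => w w0; rewrite !exprS.
have wn : w ^+ n != 0 by rewrite expf_neq0.
move: (w ^+ n) wn (n.+1%:R) n1 => W W0 N N0.
by field; rewrite W0 w0 N0.
Qed.

(** Two distinct poles are separated by
    [1 / ((z - p) (z - q)) = (1 / (z - p) - 1 / (z - q)) / (p - q)].  The
    induction ends with a multiple pole, which has a primitive, or with two
    simple poles, whose residues cancel as the winding numbers agree. *)
Lemma oint_rat1_eq0 G c ps : piecewise_C1 G -> G 0 = G 1 ->
  (forall p, p \in ps -> ~ trace G p /\ oint G (fun z => (z - p)^-1) = c) ->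
  (1 < size ps)%N -> oint G (rat 1 ps) = 0.
Proof.
move=> pG G01; have [k] := ubnP (size ps); elim: k ps => // k IHk ps.
move=> psk H ps1.
case: ps ps1 psk H => // p [//|p' ps'] _; set ps := p' :: ps' => psk H.
have Gp : ~ trace G p by have [] := H p (mem_head _ _).
have [allp|/allPn[q qps qp]] := boolP (all (pred1 p) ps).
  rewrite (@eq_oint _ _ _ (fun z => (z - p) ^- (size ps').+2)).
    exact: oint_pole.
  move=> z _; rewrite /rat hornerC mul1r; congr (_^-1).
  rewrite big_cons exprS; congr (_ * _).
  have -> : ps = nseq (size ps) p by exact/all_pred1P.
  by rewrite big_nseq iter_mulr_1.
have Hq := H q; rewrite inE qps orbT in Hq; have [Gq cq] := Hq isT.
set rest := rem q ps.
have prest : perm_eq (p :: ps) (p :: q :: rest) by rewrite perm_cons perm_to_rem.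
have Hrest r : r \in rest -> ~ trace G r /\ oint G (fun z => (z - r)^-1) = c.
  by move=> rr; apply: H; rewrite (perm_mem prest) !inE rr !orbT.
have pq0 : p - q != 0 by rewrite subr_eq0 eq_sym.
have sz : (size (p :: ps)) = (size rest).+2 by rewrite (perm_size prest).
rewrite (@eq_oint _ _ _ (fun z => (p - q)^-1 * (rat 1 (p :: rest) z
    + (-1) * rat 1 (q :: rest) z))); last first.
  move=> z Gz; rewrite /rat (perm_big _ prest) !big_cons /= !hornerC.
  have zp : z - p != 0 by rewrite subr_eq0; apply/eqP => e; rewrite e in Gz.
  have zq : z - q != 0 by rewrite subr_eq0; apply/eqP => e; rewrite e in Gz.
  have : \prod_(r <- rest) (z - r) != 0.
    by apply: prod_sub_neq0; apply/negP => /Hrest[].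
  by move: (\prod_(r <- rest) _) => W W0; field; rewrite pq0 W0 zq zp.
have Hp : forall r, r \in p :: rest -> ~ trace G r /\ oint G (fun z =>
    (z - r)^-1) = c.
  by move=> r; rewrite inE => /orP[/eqP->|/Hrest//]; exact/H/mem_head.
have Hq' : forall r, r \in q :: rest -> ~ trace G r /\ oint G (fun z =>
    (z - r)^-1) = c.
  by move=> r; rewrite inE => /orP[/eqP->//|/Hrest].
have h1 : hol_on G (rat 1 (p :: rest)) by apply: hol_on_rat => r /Hp[].
have h2 : hol_on G (rat 1 (q :: rest)) by apply: hol_on_rat => r /Hq'[].
have h3 : hol_on G (fun z => -1 * rat 1 (q :: rest) z).
  by apply: hol_onM => //; exact: hol_on_cst.
rewrite ointZ//; last exact: hol_onD.
rewrite ointD// ointZ//.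
have [rest0|rest0] := posnP (size rest).
  have {}rest0 : rest = [::] by apply: size0nil.
  have E r : oint G (rat 1 [:: r]) = oint G (fun z => (z - r)^-1).
    by apply: eq_oint => z _; rewrite /rat big_seq1 hornerC mul1r.
  rewrite rest0 !E cq (H p (mem_head _ _)).2; ring.
by rewrite !IHk//= ?mulr0 ?addr0 ?mulr0//; rewrite sz in psk.
Qed.

(** The residue theorem in two cases: no pole is enclosed, or all poles are
    enclosed equally often and the function decays like [z^-2] at infinity.
    The induction removes one pole at a time by [P = Q (X - p) + P(p)]. *)
Theorem oint_rat_eq0 G c P ps : piecewise_C1 G -> G 0 = G 1 ->
  (forall p, p \in ps -> ~ trace G p /\ oint G (fun z => (z - p)^-1) = c) ->
  c = 0 \/ (size P < size ps)%N -> oint G (rat P ps) = 0.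
Proof.
move=> pG G01; elim: ps P => [|p ps IHps] P H.
  case=> // _; rewrite (@eq_oint _ _ _ (fun z => P.[z])); first exact: oint_horner.
  by move=> z _; rewrite /rat big_nil divr1.
move=> cP.
have [->|P0] := eqVneq P 0.
  rewrite (@eq_oint _ _ _ (fun z => (0 : {poly C}).[z])); first exact: oint_horner.
  by move=> z _; rewrite /rat horner0 mul0r.
have [Q PQ] : exists Q, P - P.[p]%:P = Q * ('X - p%:P).
  by apply/factor_theorem/rootP; rewrite !hornerE subrr.
have {}PQ : P = Q * ('X - p%:P) + P.[p]%:P by rewrite -PQ subrK.
have Hps q : q \in ps -> ~ trace G q /\ oint G (fun z => (z - q)^-1) = c.
  by move=> qps; apply: H; rewrite inE qps orbT.
have h1 : hol_on G (rat Q ps) by apply: hol_on_rat => r /Hps[].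
have h2 : hol_on G (rat 1 (p :: ps)) by apply: hol_on_rat => r /H[].
rewrite (@eq_oint _ _ _ (fun z => rat Q ps z + P.[p] * rat 1 (p :: ps) z)).
  rewrite ointD//; last by apply: hol_onM => //; exact: hol_on_cst.
  rewrite ointZ// IHps//; last first.
    case: cP => [->|sP]; [by left|right].
    have [->|Q0] := eqVneq Q 0.
      rewrite size_poly0; case: ps sP {IHps H Hps h1 h2} => //=.
      by rewrite ltnS leqn0 size_poly_eq0 (negbTE P0).
    rewrite -ltnS; apply: leq_ltn_trans sP.
    rewrite PQ size_polyDl size_Mmonic ?monicXsubC// size_XsubC addn2//=.
    by rewrite ltnS (leq_trans (size_polyC_leq1 _))// size_poly_gt0.
  have [ps1|ps1] := ltnP 0 (size ps).
    by rewrite (oint_rat1_eq0 pG G01 H)// mulr0 addr0.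
  have ps0 : ps = [::] by apply: size0nil; apply/eqP; rewrite -leqn0.
  have c0 : c = 0.
    case: cP => // sP; move: sP; rewrite ps0 /= ltnS leqn0 size_poly_eq0.
    by rewrite (negbTE P0).
  rewrite ps0 (@eq_oint _ _ _ (fun z => (z - p)^-1)).
    by rewrite (H p (mem_head _ _)).2 c0 mulr0 addr0.
  by move=> z _; rewrite /rat big_seq1 hornerC mul1r.
move=> z Gz; rewrite /rat {1}PQ !big_cons !hornerE.
have zp : z - p != 0.
  by rewrite subr_eq0; apply/eqP => e; have [] := H p (mem_head _ _); rewrite -e.
have : \prod_(r <- ps) (z - r) != 0.
  by apply: prod_sub_neq0; apply/negP => /Hps[].
by move: (\prod_(r <- ps) _) => W W0 /=; field; rewrite W0 zp.
Qed.

End RationalResidues.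

Lemma size_mul_bound (S : nzRingType) (p q : {poly S}) (d1 d2 : nat) :
  (size p <= d1.+1)%N -> (size q <= d2.+1)%N -> (size (p * q)%R <= (d1 + d2).+1)%N.
Proof.
move=> h1 h2; apply: leq_trans (size_polyMleq _ _) _.
by have := leq_add h1 h2; lia.
Qed.

(** * Residues inside a contour around 0 and a *)

Section ContourFunctional.
Variables (R : realType) (a : R).
Hypothesis a_gt0 : 0 < a.
Notation C := R[i].
Notation ac := (a%:C).

Lemma ac_neq0 : ac != 0 :> C.
Proof. by rewrite eq_complex /= (gt_eqF a_gt0). Qed.

Lemma sqr1_neq0 : 1 + ac ^+ 2 != 0 :> C.
Proof.
rewrite -rmorphXn -[1]/(1%:C) -rmorphD eq_complex /= eqxx andbT.
by rewrite gt_eqF// addr_gt0// exprn_gt0.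
Qed.

Lemma twopii_neq0 : twopii != 0 :> C.
Proof.
rewrite /twopii mulf_neq0//; last first.
  by rewrite eq_complex /= oner_eq0 andbF.
by rewrite eq_complex /= gt_eqF// mulr_gt0// pi_gt0.
Qed.

(** The two linear factors of all integrands besides [z].  As polynomials they
    give access to degrees, coefficients and divisibility. *)
Definition Dp : {poly C} := 1 + ac *: 'X.
Definition Ep : {poly C} := 'X - ac%:P.

Lemma horner_Dp z : Dp.[z] = 1 + ac * z.
Proof. by rewrite /Dp !hornerE. Qed.

Lemma horner_Ep z : Ep.[z] = z - ac.
Proof. by rewrite /Ep !hornerE. Qed.

Lemma DpE : Dp = ac *: ('X - (- ac^-1)%:P).
Proof.
rewrite /Dp polyCN opprK scalerDr addrC; congr (_ + _).
by rewrite -[RHS]mul_polyC -polyCM divff ?ac_neq0.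
Qed.

Lemma size_Dp : size Dp = 2.
Proof. by rewrite DpE size_scale ?ac_neq0// size_XsubC. Qed.

Lemma size_Ep : size Ep = 2. Proof. exact: size_XsubC. Qed.

Lemma size_exp_bound (p : {poly C}) k : size p = 2 -> size (p ^+ k) = k.+1.
Proof.
move=> p2; rewrite -[LHS]prednK ?size_exp ?p2 ?mul1n//.
by rewrite size_poly_gt0 expf_neq0// -size_poly_eq0 p2.
Qed.

Lemma size_DpX k : size (Dp ^+ k) = k.+1.
Proof. exact: size_exp_bound size_Dp. Qed.

Lemma size_EpX k : size (Ep ^+ k) = k.+1.
Proof. exact: size_exp_bound size_Ep. Qed.

(** The sum of the residues of [f] inside [G]. *)
Definition residue (G : R -> C) (f : C -> C) : C := oint G f / twopii.

(** The residue calculus sees a contour only through its winding numbers. *)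
Record good_contour (G : R -> C) : Prop := GoodContour {
  gc_C1 : piecewise_C1 G;
  gc_closed : G 0 = G 1;
  gc_0 : encloses G 0;
  gc_a : encloses G ac;
  gc_out : leaves_out G (- a^-1)%:C }.

Lemma contour0a_good S G : contour0a a S G -> good_contour G.
Proof. by move=> [[? ? _] ? ? _ ?]. Qed.

Section OneContour.
Variable G : R -> C.
Hypothesis hG : good_contour G.

Lemma encloses_oint p : encloses G p ->
  ~ trace G p /\ oint G (fun z => (z - p)^-1) = twopii.
Proof.
move=> [Gp w1]; split=> //.
by rewrite -[LHS](divfK twopii_neq0) [X in X * _]w1 mul1r.
Qed.

Lemma leaves_out_oint p : leaves_out G p ->
  ~ trace G p /\ oint G (fun z => (z - p)^-1) = 0.
Proof.
move=> [Gp w1]; split=> //.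
by rewrite -[LHS](divfK twopii_neq0) [X in X * _]w1 mul0r.
Qed.

Lemma trace_neq0 z : trace G z -> z != 0.
Proof. by move=> Gz; apply/eqP => e; case: (gc_0 hG) => + _; rewrite -e. Qed.

Lemma trace_E z : trace G z -> z - ac != 0.
Proof.
by move=> Gz; rewrite subr_eq0; apply/eqP => e; case: (gc_a hG) => + _; rewrite -e.
Qed.

Lemma trace_D z : trace G z -> 1 + ac * z != 0.
Proof.
move=> Gz; apply/eqP => e; case: (gc_out hG) => + _.
suff -> : (- a^-1)%:C = z by [].
rewrite rmorphN /= fmorphV /=; apply: (mulfI ac_neq0).
rewrite mulrN divff ?ac_neq0//; apply/esym/eqP.
by rewrite -addr_eq0 addrC; exact/eqP.
Qed.

Lemma eq_residue f1 f2 : (forall z, trace G z -> f1 z = f2 z) ->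
    residue G f1 = residue G f2.
Proof. by move=> e; rewrite /residue (eq_oint e). Qed.

Lemma residueD f1 f2 : hol_on G f1 -> hol_on G f2 ->
  residue G (fun z => f1 z + f2 z) = residue G f1 + residue G f2.
Proof. by move=> h1 h2; rewrite /residue (ointD (gc_C1 hG))// mulrDl. Qed.

Lemma residueZ c f : hol_on G f -> residue G (fun z => c * f z) = c * residue G f.
Proof. by move=> h; rewrite /residue (ointZ _ (gc_C1 hG))// mulrA. Qed.

Lemma residue0 : residue G (fun=> 0) = 0.
Proof.
have -> : (fun=> 0 : C) = (fun z : C => 0 * 0 : C) by rewrite mulr0.
by rewrite residueZ ?mul0r//; exact: hol_on_cst.
Qed.

Lemma prod_seq_two (x y : nat) (p q z : C) :
  \prod_(r <- nseq x p ++ nseq y q) (z - r) = (z - p) ^+ x * (z - q) ^+ y.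
Proof. by rewrite big_cat /= !big_nseq !iter_mulr_1. Qed.

(** The only pole is [- 1 / a], which the contour leaves out. *)
Lemma residue_analytic (P : {poly C}) k :
  residue G (fun z => P.[z] / (1 + ac * z) ^+ k) = 0.
Proof.
rewrite /residue (@eq_oint _ _ _ (rat ((ac ^+ k)^-1 *: P) (nseq k (- a^-1)%:C))).
  rewrite (oint_rat_eq0 (c := 0) (gc_C1 hG) (gc_closed hG)) ?mul0r//; last by left.
  by move=> p /nseqP[-> _]; apply: leaves_out_oint; exact: gc_out hG.
move=> z Gz; rewrite /rat big_nseq iter_mulr_1 hornerZ.
rewrite rmorphN /= opprK fmorphV /= (_ : 1 + ac * z = ac * (z + ac^-1)).
  by rewrite exprMn invfM mulrCA mulrA.
by rewrite mulrDr divff ?ac_neq0// addrC.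
Qed.

(** All poles are enclosed, and the function decays like [z^-2] at infinity. *)
Lemma residue_decay (P : {poly C}) x y : (size P < x + y)%N ->
  residue G (fun z => P.[z] / (z ^+ x * (z - ac) ^+ y)) = 0.
Proof.
move=> sP; rewrite /residue (@eq_oint _ _ _ (rat P (nseq x 0 ++ nseq y ac))).
  rewrite (oint_rat_eq0 (c := twopii) (gc_C1 hG) (gc_closed hG)) ?mul0r//.
    move=> p; rewrite mem_cat => /orP[] /nseqP[-> _]; apply: encloses_oint.
      exact: gc_0 hG.
    exact: gc_a hG.
  by right; rewrite size_cat !size_nseq.
by move=> z _; rewrite /rat prod_seq_two subr0.
Qed.

Lemma hol_inv_D k : hol_on G (fun z => ((1 + ac * z) ^+ k)^-1).
Proof.
apply: (@hol_onV _ _ (fun z => (1 + ac * z) ^+ k)).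
  by move=> p Gp; apply: expf_neq0; exact: trace_D.
apply: hol_onX; apply: hol_onD; first exact: hol_on_cst.
by apply: hol_onM; [exact: hol_on_cst|exact: hol_on_id].
Qed.

Lemma hol_inv_E k : hol_on G (fun z => ((z - ac) ^+ k)^-1).
Proof.
apply: (@hol_onV _ _ (fun z => (z - ac) ^+ k)).
  by move=> p Gp; apply: expf_neq0; exact: trace_E.
by apply: hol_onX; apply: hol_onD; [exact: hol_on_id|exact: hol_on_cst].
Qed.

Lemma hol_inv_z k : hol_on G (fun z => (z ^+ k)^-1).
Proof.
apply: (@hol_onV _ _ (fun z => z ^+ k)).
  by move=> p Gp; apply: expf_neq0; exact: trace_neq0.
by apply: hol_onX; exact: hol_on_id.
Qed.

Lemma hol_poles (P : {poly C}) x y k :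
  hol_on G (fun z => P.[z] / (z ^+ x * (z - ac) ^+ y * (1 + ac * z) ^+ k)).
Proof.
rewrite (_ : (fun z => _) = fun z => P.[z] * ((z ^+ x)^-1 * ((z - ac) ^+ y)^-1
  * ((1 + ac * z) ^+ k)^-1)); last by apply/funext => z; rewrite !invfM.
apply: hol_onM; first exact: hol_on_horner.
apply: hol_onM; last exact: hol_inv_D.
by apply: hol_onM; [exact: hol_inv_z|exact: hol_inv_E].
Qed.

(** The two ways in which a residue vanishes, in one statement. *)
Lemma residue_eq0 f (P Q : {poly C}) k x y : (size Q < x + y)%N ->
  (forall z, trace G z -> f z = P.[z] / (1 + ac * z) ^+ k
                             + Q.[z] / (z ^+ x * (z - ac) ^+ y)) ->
  residue G f = 0.
Proof.
move=> sQ e; rewrite (eq_residue e) residueD ?residue_analytic ?residue_decay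
    ?addr0//.
  apply: hol_onM; [exact: hol_on_horner|exact: hol_inv_D].
have := hol_poles Q x y 0; congr hol_on; apply/funext => z.
by rewrite expr0 mulr1.
Qed.

Lemma residue_inv p : encloses G p -> residue G (fun z => (z - p)^-1) = 1.
Proof. by move=> /encloses_oint[_ e]; rewrite /residue e divff// twopii_neq0. Qed.

Lemma hol_inv_sub p : ~ trace G p -> hol_on G (fun z => (z - p)^-1).
Proof.
move=> Gp; apply: (@hol_onV _ _ (fun z => z - p)).
  by move=> q Gq; rewrite subr_eq0; apply/eqP => qp; rewrite qp in Gq.
by apply: hol_onD; [exact: hol_on_id|exact: hol_on_cst].
Qed.

(** Subtracting the multiple of [1 / (z - p)] with the same residue leaves a
    function whose only pole is [- 1 / a]. *)
Lemma residue_simple_pole (P : {poly C}) k p : encloses G p -> 1 + ac * p != 0 ->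
  residue G (fun z => P.[z] / ((1 + ac * z) ^+ k * (z - p)))
  = P.[p] / (1 + ac * p) ^+ k.
Proof.
move=> Gp Dp0; set c := RHS.
have [Q PQ] : exists Q, P - c *: Dp ^+ k = Q * ('X - p%:P).
  apply/factor_theorem/rootP; rewrite !hornerE ?horner_Dp divfK ?subrr//.
  by rewrite expf_neq0.
have hp := hol_inv_sub Gp.1.
rewrite (@eq_residue _ (fun z => Q.[z] / (1 + ac * z) ^+ k + c * (z - p)^-1)).
  rewrite residueD ?residue_analytic.
  - by rewrite residueZ ?(residue_inv Gp) ?mulr1 ?add0r.
  - by apply: hol_onM; [exact: hol_on_horner|exact: hol_inv_D].
  - by apply: hol_onM; [exact: hol_on_cst|].
move=> z Gz; have zD := expf_neq0 k (trace_D Gz).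
have zE : z - p != 0.
  by rewrite subr_eq0; apply/eqP => zp; case: Gp => + _; rewrite -zp.
have -> : P = Q * ('X - p%:P) + c *: Dp ^+ k by rewrite -PQ subrK.
rewrite !hornerE ?horner_Dp.
by move: (_ ^+ k) zD => W W0; field; rewrite W0 zE.
Qed.

Lemma residue_inv0 : residue G (fun z => z^-1) = 1.
Proof.
rewrite -(residue_inv (gc_0 hG)); apply: eq_residue => z _; by rewrite subr0.
Qed.

(** The coefficients of [P] above [r] give a polynomial, those below [r] give
    terms decaying like [z^-2]; only the multiple of [1 / z] contributes. *)
Lemma residue_coef (P : {poly C}) r : residue G (fun z => P.[z] / z ^+ r.+1) = P`_r.
Proof.
pose Q := P - P`_r *: 'X^r.
pose Q1 := drop_poly r.+1 Q; pose Q2 := take_poly r Q.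
have QE : Q = Q2 + Q1 * 'X^(r.+1).
  rewrite -[LHS](poly_take_drop r.+1 Q); congr (_ + _).
  apply/polyP => i; rewrite !coef_take_poly ltnS leq_eqVlt.
  case: eqP => [->|//] /=; rewrite ltnn /Q coefB coefZ coefXn eqxx mulr1 subrr//.
rewrite (@eq_residue _ (fun z =>
    (Q1.[z] / (1 + ac * z) ^+ 0 + Q2.[z] / (z ^+ r.+1 * (z - ac) ^+ 0)) + P`_r
        * z^-1)).
  rewrite residueD; last 2 first.
  - apply: hol_onD.
      by apply: hol_onM; [exact: hol_on_horner|exact: hol_inv_D].
    by have := hol_poles Q2 r.+1 0 0; congr hol_on; apply/funext => z;
      rewrite expr0 !mulr1.
  - apply: hol_onM; first exact: hol_on_cst.
    by have := hol_inv_z 1; under [X in hol_on _ X]eq_fun do rewrite expr1.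
  rewrite (residue_eq0 (P := Q1) (Q := Q2) (k := 0) (x := r.+1) (y := 0))//;
      last first.
    by rewrite addn0 ltnS size_take_poly.
  rewrite residueZ ?residue_inv0 ?mulr1 ?add0r//.
  by have := hol_inv_z 1; under [X in hol_on _ X]eq_fun do rewrite expr1.
move=> z Gz; have z0 := trace_neq0 Gz.
have PQ : P = Q + P`_r *: 'X^r by rewrite subrK.
rewrite {1}PQ QE; move: (P`_r) => c; rewrite !hornerE !expr0 exprS.
have : z ^+ r != 0 by rewrite expf_neq0.
by move: (z ^+ r) => W W0; field; rewrite W0 z0.
Qed.

End OneContour.

End ContourFunctional.

(** [field] asks for the nonvanishing of products of powers, whose bases are
    assumed to be nonzero in the context. *)
Ltac fieldnz := field; repeat (apply/andP; split); try apply: expf_neq0; assumption.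

Section NestedContours.
Variables (R : realType) (a : R).
Hypothesis a_gt0 : 0 < a.
Notation C := R[i].
Notation ac := (a%:C).

(** The Cauchy kernel on the outer contour keeps the part of [f] with a pole at
    [- 1 / a]: the part with poles at [0] and [a] decays once it is divided by
    [w - z], and all its poles are enclosed. *)
Lemma residue_outer (G : R -> C) z f c (U V : {poly C}) M y k :
  good_contour a G -> encloses G z -> 1 + ac * z != 0 ->
  (size U <= M + y)%N ->
  (forall w, trace G w -> f w = c * (U.[w] / (w ^+ M * (w - ac) ^+ y)
                                + V.[w] / (1 + ac * w) ^+ k)) ->
  residue G (fun w => (w - z)^-1 * f w) = c * (V.[z] / (1 + ac * z) ^+ k).
Proof.
move=> hG Gz Dz sU fE.
have hp := hol_inv_sub Gz.1.
pose f1 w := rat U (z :: nseq M 0 ++ nseq y ac) w.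
pose f2 w := V.[w] / ((1 + ac * w) ^+ k * (w - z)).
have ps_ok p : p \in z :: nseq M 0 ++ nseq y ac ->
    ~ trace G p /\ oint G (fun z => (z - p)^-1) = twopii.
  rewrite inE mem_cat => /predU1P[->|/orP[] /nseqP[-> _]];
    apply: encloses_oint => //; [exact: gc_0 hG|exact: gc_a hG].
rewrite (@eq_residue _ _ _ (fun w => c * (f1 w + f2 w))); last first.
  move=> w Gw; rewrite (fE _ Gw) /f1 /f2 /rat big_cons prod_seq_two subr0 !invfM.
  by rewrite mulrCA; congr (_ * _); rewrite mulrDr; congr (_ + _); ring.
have h1 : hol_on G f1 by apply: hol_on_rat => p /ps_ok[].
have h2 : hol_on G f2.
  rewrite (_ : f2 = fun w => V.[w] * (((1 + ac * w) ^+ k)^-1 * (w - z)^-1)).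
    apply: hol_onM; first exact: hol_on_horner.
    by apply: hol_onM => //; exact: hol_inv_D.
  by apply/funext => w; rewrite /f2 invfM.
rewrite (residueZ hG) ?(residueD hG)//; last exact: hol_onD.
rewrite (residue_simple_pole a_gt0 hG)// /residue.
rewrite (oint_rat_eq0 (gc_C1 hG) (gc_closed hG) ps_ok) ?mul0r ?add0r//.
by right; rewrite /= size_cat !size_nseq ltnS.
Qed.

End NestedContours.

(** * Transfer from one column to the next *)

Section ColumnTransfer.
Variables (R : realType) (a : R).
Hypothesis a_gt0 : 0 < a.
Notation C := R[i].
Notation ac := (a%:C).
Variable G : R -> C.
Hypothesis hG : good_contour a G.
Variables (n m s' j' : nat) (e : C) (P : {poly C}).
Implicit Types (s j r : nat) (z : C).

(** The function created at the black vertex [(s', j')]; it is multiplied by [z]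
    from each column to the next. *)
Definition source s z : C :=
  if (s' <= s)%N then e * (z ^+ (s - s') * (z - ac) ^+ j' / (1 + ac * z) ^+ j'.+1)
  else 0.

(** [P] parametrizes a solution of the transfer without source, which is used to
    satisfy the boundary conditions. *)
Definition amplitude s z : C :=
  source s z + P.[z] * z ^+ s / (z ^+ (2 * m) * (1 + ac * z)).

(** The value at the white vertex of height [r - 1].  The shift makes room for
    the row [r = 0] below the domain, where the value vanishes from the column
    [2 m] on. *)
Definition white_value s r : C :=
  residue G (fun z => amplitude s z * ((1 + ac * z) ^+ r / (z - ac) ^+ r)).

(** What the right edges collect at the black vertex [(s, j)]; the left edges
    collect the same up to the source. *)
Definition black_value s j : C :=
  (1 + ac ^+ 2) *
  residue G (fun z => amplitude s z * ((1 + ac * z) ^+ j / (z - ac) ^+ j.+1)).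

Lemma hol_pow_D r : hol_on G (fun z => (1 + ac * z) ^+ r).
Proof.
apply: hol_onX; apply: hol_onD; first exact: hol_on_cst.
by apply: hol_onM; [exact: hol_on_cst|exact: hol_on_id].
Qed.

Lemma hol_pow_E r : hol_on G (fun z => (z - ac) ^+ r).
Proof. by apply: hol_onX; apply: hol_onD; [exact: hol_on_id|exact: hol_on_cst]. Qed.

Lemma hol_pow_z r : hol_on G (fun z => z ^+ r).
Proof. by apply: hol_onX; exact: hol_on_id. Qed.

Lemma hol_source s : hol_on G (source s).
Proof.
rewrite /source; case: (s' <= s)%N; last exact: hol_on_cst.
apply: hol_onM; first exact: hol_on_cst.
apply: hol_onM; last exact: (hol_inv_D a_gt0 hG).
by apply: hol_onM; [exact: hol_pow_z|exact: hol_pow_E].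
Qed.

Lemma hol_amplitude s : hol_on G (amplitude s).
Proof.
apply: hol_onD; first exact: hol_source.
rewrite (_ : (fun z => _) = fun z => (P.[z] * z ^+ s) *
    ((z ^+ (2 * m))^-1 * ((1 + ac * z) ^+ 1)^-1)); last first.
  by apply/funext => z; rewrite expr1 invfM.
apply: hol_onM; first by apply: hol_onM; [exact: hol_on_horner|exact: hol_pow_z].
by apply: hol_onM; [exact: hol_inv_z hG _|exact: (hol_inv_D a_gt0 hG)].
Qed.

Lemma hol_amplitude_DE s r k :
  hol_on G (fun z => amplitude s z * ((1 + ac * z) ^+ r / (z - ac) ^+ k)).
Proof.
apply: hol_onM; first exact: hol_amplitude.
by apply: hol_onM; [exact: hol_pow_D|exact: (hol_inv_E hG)].
Qed.

(** [(1 + a z) / (z - a) - a = (1 + a^2) / (z - a)] *)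
Lemma white_value_right s j : white_value s j.+1 - ac * white_value s j
    = black_value s j.
Proof.
rewrite /white_value /black_value -mulNr -!(residueZ hG);
    try exact: hol_amplitude_DE.
rewrite -(residueD hG); last 2 first.
- exact: hol_amplitude_DE.
- by apply: hol_onM; [exact: hol_on_cst|exact: hol_amplitude_DE].
apply: eq_residue => z Gz; have zE := trace_E hG Gz.
have zD := trace_D a_gt0 hG Gz.
move: (amplitude s z) => A; rewrite !exprS.
fieldnz.
Qed.

(** Biorthogonality of [(1 + a z)^j / (z - a)^(j + 1)] and
    [(z - a)^i / (1 + a z)^(i + 1)]: for [j < i] the pole at [a] disappears, for
    [i < j] the pole at [- 1 / a] does and the product decays, and for [i = j]
    two simple poles are left, one of them enclosed. *)
Lemma residue_DE j i :
  (1 + ac ^+ 2) * residue G (fun z => (1 + ac * z) ^+ j * (z - ac) ^+ i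
                   / ((1 + ac * z) ^+ i.+1 * (z - ac) ^+ j.+1)) = (j == i)%:R.
Proof.
case: (ltngtP j i) => [ji|ij|->].
- rewrite (@residue_eq0 _ a a_gt0 G hG _ (Ep a ^+ (i - j).-1) 0 (i - j).+1 0 1)
    ?mulr0//.
    by rewrite size_poly0.
  move=> z Gz; have zE := trace_E hG Gz; have zD := trace_D a_gt0 hG Gz.
  rewrite horner_exp horner_Ep horner0 mul0r addr0.
  have -> : i = (j + (i - j).-1.+1)%N by lia.
  rewrite addKn /= !(exprS, exprD).
  fieldnz.
- rewrite (@residue_eq0 _ a a_gt0 G hG _ 0 (Dp a ^+ (j - i).-1) 0 0 (j - i).+1)
    ?mulr0//.
    by rewrite size_DpX// add0n; lia.
  move=> z Gz; have zE := trace_E hG Gz; have zD := trace_D a_gt0 hG Gz.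
  rewrite horner_exp horner_Dp horner0 mul0r add0r.
  have -> : j = (i + (j - i).-1.+1)%N by lia.
  rewrite addKn /= expr0 !(exprS, exprD).
  fieldnz.
- rewrite (@eq_residue _ _ _ (fun z =>
    (1 : {poly C}).[z] / ((1 + ac * z) ^+ 1 * (z - ac)))).
    rewrite (residue_simple_pole a_gt0 hG _ 1 (gc_a hG)) -expr2 ?sqr1_neq0//.
    by rewrite hornerC expr1 mulrA mulr1 divff ?sqr1_neq0.
  move=> z Gz; have zE := trace_E hG Gz; have zD := trace_D a_gt0 hG Gz.
  rewrite hornerC expr1 !exprS;  fieldnz.
Qed.

Lemma amplitude_succ s z : z != 0 ->
  amplitude s.+1 z = z * amplitude s z +
    (s.+1 == s')%:R * e * ((z - ac) ^+ j' / (1 + ac * z) ^+ j'.+1).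
Proof.
move=> z0; rewrite /amplitude /source leq_eqVlt ltnS [(s' == _)%N]eq_sym.
case: (altP eqP) => [<-|ne] /=.
  by rewrite ltnn subnn expr0 (exprS z) /=; ring.
case: ifP => ss; last by rewrite (exprS z) /=; ring.
by rewrite subSn// !(exprS z) /=; ring.
Qed.

(** [1 + a (1 + a z) / (z - a) = (1 + a^2) z / (z - a)], and the factor [z]
    leads to the amplitude of the next column, where the source contributes a
    delta by [residue_DE]. *)
Lemma white_value_left s j :
  white_value s j + ac * white_value s j.+1 = black_value s.+1 j
      - ((s.+1 == s') && (j == j'))%:R * e.
Proof.
have hs : hol_on G (fun z => (1 + ac * z) ^+ j * (z - ac) ^+ j'
                   / ((1 + ac * z) ^+ j'.+1 * (z - ac) ^+ j.+1)).
  apply: hol_onM; first by apply: hol_onM; [exact: hol_pow_D|exact: hol_pow_E].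
  under [X in hol_on _ X]eq_fun do rewrite invfM.
  by apply: hol_onM; [exact: (hol_inv_D a_gt0 hG)|exact: (hol_inv_E hG)].
have -> : ((s.+1 == s') && (j == j'))%:R * e = (1 + ac ^+ 2) *
    ((s.+1 == s')%:R * e * residue G (fun z => (1 + ac * z) ^+ j * (z - ac) ^+ j'
                   / ((1 + ac * z) ^+ j'.+1 * (z - ac) ^+ j.+1))).
  by rewrite mulrCA residue_DE; case: eqP => _; case: eqP =>
      _ /=; rewrite ?(mul0r, mul1r, mulr1, mulr0).
rewrite /black_value -mulrBr -mulNr.
have hc1 : hol_on G (fun z =>
    ac * (amplitude s z * ((1 + ac * z) ^+ j.+1 / (z - ac) ^+ j.+1))).
  by apply: hol_onM; [exact: hol_on_cst|exact: hol_amplitude_DE].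
have hc2 c : hol_on G (fun z => c * ((1 + ac * z) ^+ j * (z - ac) ^+ j'
                   / ((1 + ac * z) ^+ j'.+1 * (z - ac) ^+ j.+1))).
  by apply: hol_onM => //; exact: hol_on_cst.
rewrite -(residueZ hG _ (hol_amplitude_DE s j.+1 j.+1))
    -(residueD hG (hol_amplitude_DE s j j) hc1).
rewrite -(residueZ hG _ hs) -(residueD hG (hol_amplitude_DE s.+1 j j.+1)
    (hc2 _)) -(residueZ hG); last first.
  by apply: hol_onD; [exact: hol_amplitude_DE|exact: hc2].
apply: eq_residue => z Gz; have zE := trace_E hG Gz; have zD := trace_D a_gt0 hG Gz.
rewrite amplitude_succ ?(trace_neq0 hG Gz)//;
    move: (amplitude s z) ((_ == _)%:R) => A B.
rewrite !exprS.
fieldnz.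
Qed.

(** In the first column no left edge exists, so the right edges alone have to
    produce the delta.  The contribution of [P] decays because of the bound on
    its degree. *)
Lemma black_value_first j : (0 < j)%N -> (size P <= (2 * m).+1)%N ->
  black_value 0 j = ((0 == s')%N && (j == j'))%:R * e.
Proof.
move=> j0 sP.
have hs : hol_on G (fun z => (1 + ac * z) ^+ j * (z - ac) ^+ j'
                   / ((1 + ac * z) ^+ j'.+1 * (z - ac) ^+ j.+1)).
  apply: hol_onM; first by apply: hol_onM; [exact: hol_pow_D|exact: hol_pow_E].
  under [X in hol_on _ X]eq_fun do rewrite invfM.
  by apply: hol_onM; [exact: (hol_inv_D a_gt0 hG)|exact: (hol_inv_E hG)].
pose Q := P * Dp a ^+ j.-1.
have sQ : (size Q < 2 * m + j.+1)%N.
  apply: leq_ltn_trans (size_mul_bound sP (eq_leq (size_DpX a_gt0 j.-1))) _.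
  by lia.
rewrite /black_value (@eq_residue _ _ _ (fun z =>
    (0 == s')%:R * e * ((1 + ac * z) ^+ j * (z - ac) ^+ j'
                   / ((1 + ac * z) ^+ j'.+1 * (z - ac) ^+ j.+1)) +
     Q.[z] / (z ^+ (2 * m) * (z - ac) ^+ j.+1))).
  rewrite (residueD hG) ?(residueZ hG) ?(residue_decay hG)//; last 2 first.
  - by apply: hol_onM; first exact: hol_on_cst.
  - have := hol_poles a_gt0 hG Q (2 * m) j.+1 0; congr hol_on; apply/funext => z.
    by rewrite expr0 mulr1.
  by rewrite addr0 mulrCA residue_DE; case: eqP => _; case: eqP =>
      _ /=; rewrite ?(mul0r, mul1r, mulr1, mulr0).
move=> z Gz; have zE := trace_E hG Gz; have zD := trace_D a_gt0 hG Gz.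
have z0 := trace_neq0 hG Gz.
rewrite /amplitude /source leqn0 sub0n expr0 hornerM horner_exp horner_Dp
    [(0 == s')%N]eq_sym.
have -> : j = j.-1.+1 by lia.
rewrite /= !exprS ?expr0.
by case: (s' == 0)%N; rewrite /= ?mul0r ?mulr1n; fieldnz.
Qed.

(** From the column [2 m] on, the power of [z] cancels the denominator
    [z ^+ (2 * m)], and [- 1 / a] is the only pole left. *)
Lemma white_value_bottom s : (2 * m <= s)%N -> white_value s 0 = 0.
Proof.
move=> ms.
pose P1 := (s' <= s)%N%:R * e *: ('X^(s - s') * Ep a ^+ j') + P * 'X^(s - 2 * m)
    * Dp a ^+ j'.
apply: (@residue_eq0 _ a a_gt0 G hG _ P1 0 j'.+1 0 1); first by rewrite size_poly0.
move=> z Gz; have zE := trace_E hG Gz; have zD := trace_D a_gt0 hG Gz.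
have z0 := trace_neq0 hG Gz.
rewrite horner0 mul0r addr0 /P1 hornerD hornerZ !hornerM !horner_exp hornerX.
have Es : z ^+ s = z ^+ (s - 2 * m) * z ^+ (2 * m) by rewrite -exprD subnK.
rewrite horner_Dp horner_Ep /amplitude /source Es !exprS !expr0.
by case: (s' <= s)%N; rewrite /= ?mul0r ?mulr1n; fieldnz.
Qed.

Section Relation.
Variables N V : {poly C}.
Hypothesis s'_le : (s' <= 2 * m + n)%N.
Hypothesis j'_le : (j' <= n)%N.
Hypothesis sN : (size N <= n)%N.
Hypothesis NE : N = e *: ('X^(2 * m + n - s') * Dp a ^+ (n - j') * Ep a ^+ j')
  + P * 'X^n * Dp a ^+ n + V * ('X^(2 * m) * Ep a ^+ n.+1).

(** For [s' <= s] the relation [NE] splits the integrand into a polynomial and a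
    fraction with numerator [N X^(s - n)], which decays.  For [s < s'] the source
    is absent and has to be subtracted from [N]; its degree [2 m + 2 n - s'] is
    then small enough. *)
Lemma white_value_top s : (n <= s <= 2 * m + n)%N -> white_value s n.+1 = 0.
Proof.
move=> /andP[ns sT].
pose beta_b := 'X^(2 * m + n - s') * Dp a ^+ (n - j') * Ep a ^+ j'.
pose Q := (N - (s < s')%N%:R * e *: beta_b) * 'X^(s - n).
apply: (@residue_eq0 _ a a_gt0 G hG _ (- V * 'X^(s - n)) Q 0 (2 * m) n.+1).
  have sbe : (size beta_b <= (2 * m + n - s' + (n - j') + j').+1)%N.
    apply: size_mul_bound; last by rewrite size_EpX.
    by apply: size_mul_bound; [rewrite size_polyXn|rewrite size_DpX].
  have [Q0|Q0] := eqVneq (N - (s < s')%N%:R * e *: beta_b) 0.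
    by rewrite /Q Q0 mul0r size_poly0; lia.
  rewrite /Q size_mulXn//.
  have : (size (N - ((s < s')%N%:R * e) *: beta_b)%R <= 2 * m + n - (s - n))%N.
    apply: leq_trans (size_polyD _ _) _; rewrite geq_max size_polyN.
    apply/andP; split; first by lia.
    case: ltnP => ss; last by rewrite mul0r scale0r size_poly0.
    by apply: leq_trans (leq_trans (size_scale_leq _ _) sbe) _; lia.
  by lia.
move=> z Gz; have zE := trace_E hG Gz; have zD := trace_D a_gt0 hG Gz.
have z0 := trace_neq0 hG Gz.
have NEz : N.[z] = e * (z ^+ (2 * m + n - s') * (1 + ac * z) ^+ (n - j')
    * (z - ac) ^+ j')
  + P.[z] * z ^+ n * (1 + ac * z) ^+ n + V.[z] * (z ^+ (2 * m) * (z - ac) ^+ n.+1).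
  rewrite {1}NE !(horner_Dp, horner_Ep, hornerD, hornerZ, hornerM, horner_exp,
      hornerX).
  by [].
rewrite /Q /beta_b !(horner_Dp, horner_Ep, hornerD, hornerN, hornerZ, hornerM,
    horner_exp, hornerX).
rewrite NEz expr0 divr1 /amplitude /source.
have Ds : z ^+ s = z ^+ (s - n) * z ^+ n by rewrite -exprD subnK.
have Dn : (1 + ac * z) ^+ n = (1 + ac * z) ^+ (n - j') * (1 + ac * z) ^+ j'.
  by rewrite -exprD subnK.
rewrite Ds !(exprS (1 + ac * z)) !Dn !(exprS (z - ac)).
case: leqP => ss; last by rewrite mul1r; fieldnz.
have -> : z ^+ (s - s') = z ^+ (s - n) * z ^+ (2 * m + n - s') / z ^+ (2 * m).
  rewrite -exprD (_ : (s - n + (2 * m + n - s'))%N = (s - s' + 2 * m)%N);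
      last by lia.
  by rewrite exprD mulfK// expf_neq0.
rewrite mul0r mul0r subr0; fieldnz.
Qed.

(** Without source, the vanishing of the last column makes [N] divisible by
    [z - a] once for every row, which exceeds its degree. *)
Lemma relation_trivial : e = 0 ->
  (forall i, (i < n)%N -> white_value (2 * m + n) i.+1 = 0) -> N = 0.
Proof.
move=> e0 X0.
have dv i : (i <= n)%N -> exists Q, N = Q * Ep a ^+ i.
  elim: i => [|i IHi] iN; first by exists N; rewrite expr0 mulr1.
  have [Q NQ] := IHi (ltnW iN).
  have := X0 i iN.
  have Da : 1 + ac * ac != 0 by rewrite -expr2 sqr1_neq0.
  (* [NE] leaves a simple pole at [a] with residue proportional to [Q.[a]]. *)
  pose W := - V * 'X^(2 * m) * Ep a ^+ (n - i).
  rewrite /white_value (@eq_residue _ _ _ (fun z =>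
      Q.[z] / ((1 + ac * z) ^+ (n - i) * (z - ac))
                     + W.[z] / (1 + ac * z) ^+ (n - i))).
    rewrite (residueD hG); last 2 first.
    - rewrite (_ : (fun z => _) = fun z =>
        Q.[z] / (z ^+ 0 * (z - ac) ^+ 1 * (1 + ac * z) ^+ (n - i))).
        exact: (hol_poles a_gt0 hG).
      by apply/funext => z; rewrite mul1r expr1 [X in _ / X]mulrC.
    - by apply: hol_onM; [exact: hol_on_horner|exact: (hol_inv_D a_gt0 hG)].
    rewrite (residue_analytic a_gt0 hG) addr0
        (residue_simple_pole a_gt0 hG _ _ (gc_a hG))//.
    move/eqP; rewrite mulf_eq0 invr_eq0 (negPf (expf_neq0 _ Da)) orbF =>
        /factor_theorem[Q1 Q1E].
    by exists Q1; rewrite NQ Q1E -mulrA -exprS.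
  move=> z Gz; have zE := trace_E hG Gz; have zD := trace_D a_gt0 hG Gz.
  have z0 := trace_neq0 hG Gz.
  have NEz : Q.[z] * (z - ac) ^+ i = P.[z] * z ^+ n * (1 + ac * z) ^+ n
      + V.[z] * (z ^+ (2 * m) * (z - ac) ^+ n.+1).
    rewrite -horner_Ep -horner_exp -hornerM -NQ NE e0 scale0r add0r.
    by rewrite !(horner_Dp, horner_Ep, hornerD, hornerM, horner_exp, hornerX).
  have {NEz} -> : Q.[z] = (P.[z] * z ^+ n * (1 + ac * z) ^+ n
      + V.[z] * (z ^+ (2 * m) * (z - ac) ^+ n.+1)) / (z - ac) ^+ i.
    by rewrite -NEz mulfK// expf_neq0.
  rewrite /W !(horner_Dp, horner_Ep, hornerN, hornerM, horner_exp, hornerX)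
      /amplitude /source e0 mul0r if_same add0r.
  have Dn : (1 + ac * z) ^+ n = (1 + ac * z) ^+ (n - i) * (1 + ac * z) ^+ i.
    by rewrite -exprD subnK// ltnW.
  have En : (z - ac) ^+ n = (z - ac) ^+ (n - i) * (z - ac) ^+ i.
    by rewrite -exprD subnK// ltnW.
  rewrite !exprS Dn En exprD; fieldnz.
have [Q NQ] := dv n (leqnn n).
have [//|N0] := eqVneq N 0.
have Q0 : Q != 0 by apply: contraNneq N0 => Q0; rewrite NQ Q0 mul0r.
have E0 : Ep a ^+ n != 0 by rewrite expf_neq0// polyXsubC_eq0.
have := sN; rewrite NQ size_mul// size_EpX.
by rewrite addnS /= -[X in (_ <= X)%N]add0n leq_add2r leqn0 size_poly_eq0
    (negPf Q0).
Qed.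

End Relation.

End ColumnTransfer.

(** * The Kasteleyn operator *)

Section KasteleynOperator.
Variables (R : realType) (a : R).
Notation C := R[i].
Notation ac := (a%:C).
Variables (n m : nat).
Implicit Types (x : nat -> nat -> C) (s j i : nat).

(** [white_at n s i] and [black_at m s j] describe the vertices
    [(2 s + 1, 2 i)] and [(2 s, 2 j - 1)] with [s <= 2 m + n] and
    [i, j <= n]. *)
Definition white_at s i : bool := (i < n)%N || (s < n)%N.
Definition black_at s j : bool := (0 < j)%N || (2 * m < s)%N.

(** The signs [1], [- a] on the right edges and [- 1], [- a] on the left edges
    are those for which all coverings have the same sign. *)
Definition kastR x s j : C :=
  (if white_at s j then x s j else 0) - ac * (if (0 < j)%N then x s j.-1 else 0).

Definition kastL x s j : C :=
  if (0 < s)%N then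
    (if (0 < j)%N then x s.-1 j.-1 else 0) +
    ac * (if white_at s.-1 j then x s.-1 j else 0)
  else 0.

Definition kast x s j : C := kastR x s j - kastL x s j.

Hypothesis a_gt0 : 0 < a.
Variable G : R -> C.
Hypothesis hG : good_contour a G.

Section Relation.
Variables (s' j' : nat) (e : C) (P N V : {poly C}).
Hypothesis s'_le : (s' <= 2 * m + n)%N.
Hypothesis j'_le : (j' <= n)%N.
Hypothesis sP : (size P <= (2 * m).+1)%N.
Hypothesis sN : (size N <= n)%N.
Hypothesis NE : N = e *: ('X^(2 * m + n - s') * Dp a ^+ (n - j') * Ep a ^+ j')
  + P * 'X^n * Dp a ^+ n + V * ('X^(2 * m) * Ep a ^+ n.+1).

Let x s i : C := white_value a G m s' j' e P s i.+1.

Lemma white_amplitude s i : (s <= 2 * m + n)%N -> (i <= n)%N ->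
  (if white_at s i then x s i else 0) = x s i.
Proof.
move=> sT iN; rewrite /white_at; case: ifP => // /negbT.
rewrite negb_or -!leqNgt => /andP[ni ns].
have -> : i = n by apply/eqP; rewrite eqn_leq iN.
by rewrite /x (white_value_top a_gt0 hG s'_le j'_le sN NE)// ns.
Qed.

Lemma kastR_amplitude s j : (s <= 2 * m + n)%N -> (j <= n)%N -> black_at s j ->
  kastR x s j = black_value a G m s' j' e P s j.
Proof.
move=> sT jn b; rewrite /kastR white_amplitude// -(white_value_right a_gt0 hG);
    congr (_ - _ * _).
case: j b jn => [|j] //=; rewrite /black_at /= => ms _.
by rewrite (white_value_bottom a_gt0 hG)// ltnW.
Qed.

Lemma kastL_amplitude s j : (s <= 2 * m + n)%N -> (j <= n)%N -> black_at s j ->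
  kastL x s j = black_value a G m s' j' e P s j - ((s == s') && (j == j'))%:R * e.
Proof.
move=> sT jn b; rewrite /kastL; case: s sT b => [|s] sT b /=.
  rewrite (black_value_first a_gt0 hG) ?subrr//.
  by move: b; rewrite /black_at ltn0 orbF.
rewrite white_amplitude ?(ltnW sT)// -(white_value_left a_gt0 hG);
    congr (_ + _ * _).
case: j b jn => [|j] //=; rewrite /black_at /= ltnS => ms _.
by rewrite (white_value_bottom a_gt0 hG).
Qed.

Lemma kast_amplitude s j : (s <= 2 * m + n)%N -> (j <= n)%N -> black_at s j ->
  kast x s j = ((s == s') && (j == j'))%:R * e.
Proof. by move=> *; rewrite /kast kastR_amplitude// kastL_amplitude// opprB
    addrC subrK. Qed.

End Relation.
End KasteleynOperator.

Section Exponents.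
Variable F : fieldType.

Lemma expz_sub (x : F) (p q : nat) : x != 0 ->
  x ^ (p%:Z - q%:Z) = x ^+ p / x ^+ q.
Proof. by move=> x0; rewrite expfzDr// exprnN. Qed.

End Exponents.

Section Splitting.
Variables (R : realType) (a : R).
Hypothesis a_gt0 : 0 < a.
Notation C := R[i].
Notation ac := (a%:C).

(** A fraction with denominator [X^M E^(n + 1) D^n] is the sum of a decaying
    part with poles at [0] and [a], and of a part with a pole at [- 1 / a].  The
    two denominators are coprime as [D] takes the values [1] at [0] and
    [1 + a^2] at [a]. *)
Lemma pole_split (M n : nat) (N : {poly C}) :
  exists UV : {poly C} * {poly C},
    (size UV.1 <= M + n.+1)%N /\
    N = UV.1 * Dp a ^+ n + UV.2 * ('X^M * Ep a ^+ n.+1).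
Proof.
pose Z : {poly C} := 'X^M * Ep a ^+ n.+1.
have Z0 : Z != 0.
  by rewrite mulf_neq0 ?expf_neq0 ?polyX_eq0 ?polyXsubC_eq0.
have cop : coprimep (Dp a ^+ n) Z.
  have nr x : 1 + ac * x != 0 -> coprimep (Dp a) ('X - x%:P).
    by move=> h; rewrite coprimep_XsubC rootE horner_Dp.
  apply: coprimep_expl; rewrite coprimepMr; apply/andP; split.
    have -> : 'X = 'X - 0%:P :> {poly C} by rewrite subr0.
    by apply/coprimep_expr/nr; rewrite mulr0 addr0 oner_eq0.
  by apply/coprimep_expr/nr; rewrite -expr2 sqr1_neq0.
have [[u v] /= uv] := Bezout_eq1_coprimepP _ _ cop.
pose U := (N * u) %% Z.
exists (U, N * v + (N * u) %/ Z * Dp a ^+ n) => /=; split.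
  rewrite -ltnS; apply: leq_trans (_ : (size Z <= _)%N).
    by rewrite ltn_modp.
  apply: leq_trans (size_polyMleq _ _) _.
  by rewrite size_polyXn size_EpX; lia.
have e : N = N * u * Dp a ^+ n + N * v * Z.
  by rewrite -mulrA -mulrA -mulrDr uv mulr1.
rewrite -/Z /U {1}e; move: (divp_eq (N * u) Z).
by move: (_ %/ _) (_ %% _) => q U' ->; ring.
Qed.

End Splitting.

(** * The integrals of the kernel as residues *)

Section KernelIntegrals.
Variables (R : realType) (a : R).
Hypothesis a_gt0 : 0 < a.
Notation C := R[i].
Notation ac := (a%:C).
Variables (n m : nat) (Gin Gout : R -> C).
Hypothesis hin : good_contour a Gin.
Hypothesis hout : good_contour a Gout.
Hypothesis henc : forall z, trace Gin z -> encloses Gout z.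

(** A double integral against [1 / (w - z)] is the pairing of [c] with the
    projection of [f] to its part with a pole at [- 1 / a]. *)
Lemma nested_integral (g : C -> C -> C) (c f : C -> C) (U V : {poly C}) M y k :
  hol_on Gin c -> (size U <= M + y)%N ->
  (forall w, trace Gout w ->
     f w = U.[w] / (w ^+ M * (w - ac) ^+ y) + V.[w] / (1 + ac * w) ^+ k) ->
  (forall z w, trace Gin z -> trace Gout w -> g z w = (w - z)^-1 * (c z * f w)) ->
  oint Gin (fun z => oint Gout (fun w => g z w)) / twopii ^+ 2 =
  residue Gin (fun z => c z * (V.[z] / (1 + ac * z) ^+ k)).
Proof.
move=> hc sU fE gE.
have t0 := twopii_neq0 R.
rewrite (@eq_oint _ _ _ (fun z => twopii * (c z * (V.[z] / (1 + ac * z) ^+ k)))).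
  rewrite (ointZ _ (gc_C1 hin)); last first.
    apply: hol_onM => //; apply: hol_onM; first exact: hol_on_horner.
    exact: (hol_inv_D a_gt0 hin).
  by rewrite /residue expr2; move: (oint _ _) twopii t0 => o t t0; field.
move=> z Gz; rewrite (eq_oint (fun w Gw => gE z w Gz Gw)).
have := @residue_outer R a a_gt0 Gout z (fun w => c z * f w) (c z) U V M y k
    hout (henc Gz)
  (trace_D a_gt0 hin Gz) sU.
rewrite /residue => <-; last by move=> w Gw; rewrite fE.
by rewrite [RHS]mulrC divfK.
Qed.

Lemma expz_subE (x : C) (k : int) (p q : nat) : x != 0 -> k = p%:Z - q%:Z ->
  x ^ k = x ^+ p / x ^+ q.
Proof. by move=> x0 ->; exact: expz_sub. Qed.

Lemma expz_natE (x : C) (k : int) (p : nat) : k = p%:Z -> x ^ k = x ^+ p.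
Proof. by move=> ->. Qed.

(** With [xi = 2 s] and [eta = 2 j - 1], the integrands of [L0], [Afun], [Bfun]
    and [Kn] are products of one function of the first vertex or column index,
    and one of the second: [alpha_b] and [beta_b] for [L0], [alpha_b] and [pfun]
    for [Afun], [qfun] and [beta_b] for [Bfun], [qfun] and [pfun] for [Kn]. *)
Definition alpha_b s j z : C :=
  (1 + ac * z) ^+ j * (z - ac) ^+ n * z ^+ s
      / ((1 + ac * z) * (z - ac) ^+ j * z ^+ n).
Definition beta_b s j z : C :=
  z ^+ n * (z - ac) ^+ j / (z ^+ s * (1 + ac * z) ^+ j * (z - ac) ^+ n.+1).
Definition pfun k z : C := z ^+ n / (z ^+ k * (1 + ac * z) ^+ n * (z - ac) ^+ n.+1).
Definition qfun k z : C := z ^+ k * (1 + ac * z) ^+ n * (z - ac) ^+ n.+1 / z ^+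
    n.+1.

(** The part with poles inside the contour. *)
Definition minus_part (U : {poly C}) z : C :=
    U.[z] / (z ^+ (2 * m) * (z - ac) ^+ n.+1).

Lemma hol_mono (P : {poly C}) x y k :
  hol_on Gin (fun z => P.[z] / ((1 + ac * z) ^+ k * (z - ac) ^+ y * z ^+ x)).
Proof.
have := hol_poles a_gt0 hin P x y k; congr hol_on; apply/funext => z.
by congr (_ / _); ring.
Qed.

Lemma hol_alpha_b s j : hol_on Gin (alpha_b s j).
Proof.
have := hol_mono (Dp a ^+ j * Ep a ^+ n * 'X^s) n j 1; congr hol_on.
apply/funext => z; rewrite /alpha_b !(hornerM, horner_exp, horner_Dp, horner_Ep,
    hornerX).
by rewrite expr1.
Qed.

Lemma hol_beta_b s j : hol_on Gin (beta_b s j).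
Proof.
have := hol_mono ('X^n * Ep a ^+ j) s n.+1 j; congr hol_on.
apply/funext => z; rewrite /beta_b !(hornerM, horner_exp, horner_Dp, horner_Ep,
    hornerX).
by congr (_ / _); ring.
Qed.

Lemma hol_pfun k : hol_on Gin (pfun k).
Proof.
have := hol_mono ('X^n) k n.+1 n; congr hol_on.
apply/funext => z; rewrite /pfun !(hornerM, horner_exp, horner_Dp, horner_Ep,
    hornerX).
by congr (_ / _); ring.
Qed.

Lemma hol_qfun k : hol_on Gin (qfun k).
Proof.
have := hol_mono ('X^k * Dp a ^+ n * Ep a ^+ n.+1) n.+1 0 0; congr hol_on.
apply/funext => z; rewrite /qfun !(hornerM, horner_exp, horner_Dp, horner_Ep,
    hornerX).
by rewrite !expr0 !mul1r.
Qed.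

Lemma hol_minus_part U : hol_on Gin (minus_part U).
Proof.
have := hol_mono U (2 * m) n.+1 0; congr hol_on.
by apply/funext => z; rewrite /minus_part expr0 mul1r mulrC [X in _ / X]mulrC mulrC.
Qed.

Lemma alpha_b_beta_b s j s' j' z : trace Gin z -> alpha_b s j z * beta_b s' j' z =
  (1 + ac * z) ^ (Defs.half ((2 * j%:Z - 1) - (2 * j'%:Z - 1))%R - 1)%R /
  (z - ac) ^ (Defs.half ((2 * j%:Z - 1) - (2 * j'%:Z - 1))%R + 1)%R *
  z ^ Defs.half (2 * s%:Z - 2 * s'%:Z)%R.
Proof.
move=> Gz; have z0 := trace_neq0 hin Gz; have zE := trace_E hin Gz.
have zD := trace_D a_gt0 hin Gz.
rewrite (@expz_subE _ _ j j'.+1 zD); last by rewrite /Defs.half; lia.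
rewrite (@expz_subE _ _ j.+1 j' zE); last by rewrite /Defs.half; lia.
rewrite (@expz_subE _ _ s s' z0); last by rewrite /Defs.half; lia.
rewrite /alpha_b /beta_b !exprS; fieldnz.
Qed.

Lemma frac_split (M : nat) (N U V : {poly C}) w :
  w != 0 -> w - ac != 0 -> 1 + ac * w != 0 ->
  N = U * Dp a ^+ n + V * ('X^M * Ep a ^+ n.+1) ->
  N.[w] / (w ^+ M * (w - ac) ^+ n.+1 * (1 + ac * w) ^+ n) =
  U.[w] / (w ^+ M * (w - ac) ^+ n.+1) + V.[w] / (1 + ac * w) ^+ n.
Proof.
move=> w0 wE wD ->.
rewrite !(horner_Dp, horner_Ep, hornerD, hornerM, horner_exp, hornerX).
fieldnz.
Qed.

Lemma beta_b_split s j (U V : {poly C}) w : (s <= 2 * m + n)%N -> (j <= n)%N ->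
  w != 0 -> w - ac != 0 -> 1 + ac * w != 0 ->
  'X^(2 * m + n - s) * Dp a ^+ (n - j) * Ep a ^+ j =
    U * Dp a ^+ n + V * ('X^(2 * m) * Ep a ^+ n.+1) ->
  beta_b s j w = minus_part U w + V.[w] / (1 + ac * w) ^+ n.
Proof.
move=> sT jn w0 wE wD /(frac_split w0 wE wD) <-.
rewrite !(horner_Dp, horner_Ep, hornerM, horner_exp, hornerX) /beta_b.
have -> : w ^+ n = w ^+ s * w ^+ (2 * m + n - s) / w ^+ (2 * m).
  by rewrite -exprD subnKC// addnC exprD mulfK// expf_neq0.
have -> : (1 + ac * w) ^+ n = (1 + ac * w) ^+ j * (1 + ac * w) ^+ (n - j).
  by rewrite -exprD subnKC.
fieldnz.
Qed.

Lemma pfun_split k (U V : {poly C}) w : (k <= 2 * m + n)%N ->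
  w != 0 -> w - ac != 0 -> 1 + ac * w != 0 ->
  'X^(2 * m + n - k) = U * Dp a ^+ n + V * ('X^(2 * m) * Ep a ^+ n.+1) ->
  pfun k w = minus_part U w + V.[w] / (1 + ac * w) ^+ n.
Proof.
move=> kT w0 wE wD /(frac_split w0 wE wD) <-.
rewrite horner_exp hornerX /pfun.
have -> : w ^+ n = w ^+ k * w ^+ (2 * m + n - k) / w ^+ (2 * m).
  by rewrite -exprD subnKC// addnC exprD mulfK// expf_neq0.
fieldnz.
Qed.

(** The double integral contains [beta_b] minus its part with inner poles, and
    the single integral removes [beta_b] when [s1 < s2]. *)
Lemma L0_residue s1 j1 s2 j2 (U V : {poly C}) :
  (s2 <= 2 * m + n)%N -> (j2 <= n)%N ->
  (size U <= 2 * m + n.+1)%N ->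
  'X^(2 * m + n - s2) * Dp a ^+ (n - j2) * Ep a ^+ j2 =
    U * Dp a ^+ n + V * ('X^(2 * m) * Ep a ^+ n.+1) ->
  L0 a n Gin Gout (2 * s1%:Z) (2 * j1%:Z - 1) (2 * s2%:Z) (2 * j2%:Z - 1) =
  residue Gin (fun z => alpha_b s1 j1 z
      * ((s2 <= s1)%N%:R * beta_b s2 j2 z - minus_part U z)).
Proof.
move=> s2T j2n sU NE.
rewrite /L0 (@nested_integral _ (alpha_b s1 j1) (beta_b s2 j2) U V (2 * m) n.+1
    n); last 4 first.
- exact: hol_alpha_b.
- exact: sU.
- move=> w Gw; apply: (beta_b_split s2T j2n _ _ _ NE).
  + exact: trace_neq0 hout _ Gw.
  + exact: trace_E hout _ Gw.
  + exact: (trace_D a_gt0 hout Gw).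
- move=> z w Gz Gw; congr (_ * _).
  have z0 := trace_neq0 hin Gz; have zE := trace_E hin Gz.
  have zD := trace_D a_gt0 hin Gz.
  have w0 := trace_neq0 hout Gw; have wE := trace_E hout Gw.
  have wD := trace_D a_gt0 hout Gw.
  rewrite (@expz_subE (1 + ac * z) _ j1 1 zD); last by rewrite /Defs.half; lia.
  rewrite (@expz_subE (z - ac) _ n j1 zE); last by rewrite /Defs.half; lia.
  rewrite (@expz_subE w _ n s2 w0); last by rewrite /Defs.half; lia.
  rewrite (@expz_natE (1 + ac * w) _ j2); last by rewrite /Defs.half; lia.
  rewrite (@expz_subE (w - ac) _ n.+1 j2 wE); last by rewrite /Defs.half; lia.
  rewrite (@expz_subE z _ n s1 z0); last by rewrite /Defs.half; lia.
  rewrite /alpha_b /beta_b !exprS expr0; fieldnz.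
have -> : (2 * s1%:Z < 2 * s2%:Z)%R = (s1 < s2)%N by lia.
pose g z := alpha_b s1 j1 z * beta_b s2 j2 z.
rewrite -[X in _ * X + _]/(residue Gin _).
rewrite (@eq_residue _ Gin _ g); last by move=> z Gz; rewrite -alpha_b_beta_b.
have hg : hol_on Gin g by apply: hol_onM; [exact: hol_alpha_b|exact: hol_beta_b].
have hmU : hol_on Gin (fun z => alpha_b s1 j1 z * (V.[z] / (1 + ac * z) ^+ n)).
  apply: hol_onM; first exact: hol_alpha_b.
  by apply: hol_onM; [exact: hol_on_horner|exact: (hol_inv_D a_gt0 hin)].
rewrite -(residueZ hin _ hg) -(residueD hin)//; last by apply: hol_onM =>
    //; exact: hol_on_cst.
apply: eq_residue => z Gz; rewrite /g.
have z0 := trace_neq0 hin Gz; have zE := trace_E hin Gz.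
have zD := trace_D a_gt0 hin Gz.
have -> : V.[z] / (1 + ac * z) ^+ n = beta_b s2 j2 z - minus_part U z by rewrite
    (beta_b_split s2T j2n z0 zE zD NE) [RHS]addrC addKr.
by case: ltnP => _ /=; ring.
Qed.

Lemma hol_plus_part (V : {poly C}) k : hol_on Gin (fun z =>
    V.[z] / (1 + ac * z) ^+ k).
Proof. by apply: hol_onM; [exact: hol_on_horner|exact: (hol_inv_D a_gt0 hin)]. Qed.

(** The single integral subtracts the whole function [pfun k] from its part with
    a pole at [- 1 / a]. *)
Lemma Afun_residue s j k (U V : {poly C}) : (k <= 2 * m + n)%N ->
  (size U <= 2 * m + n.+1)%N ->
  'X^(2 * m + n - k) = U * Dp a ^+ n + V * ('X^(2 * m) * Ep a ^+ n.+1) ->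
  Afun a n Gin Gout (2 * s%:Z) (2 * j%:Z - 1) k =
  - (-1) ^+ k * residue Gin (fun z => alpha_b s j z * minus_part U z).
Proof.
move=> kT sU NE.
rewrite /Afun [X in X - _]mulrAC -[X in X - _]mulrA.
rewrite (@nested_integral _ (alpha_b s j) (pfun k) U V (2 * m) n.+1 n);
    last 4 first.
- exact: hol_alpha_b.
- exact: sU.
- move=> w Gw; apply: (pfun_split kT _ _ _ NE).
  + exact: trace_neq0 hout _ Gw.
  + exact: trace_E hout _ Gw.
  + exact: (trace_D a_gt0 hout Gw).
- move=> z w Gz Gw; congr (_ * _).
  have z0 := trace_neq0 hin Gz; have zE := trace_E hin Gz.
  have zD := trace_D a_gt0 hin Gz.
  have w0 := trace_neq0 hout Gw; have wE := trace_E hout Gw.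
  have wD := trace_D a_gt0 hout Gw.
  rewrite (@expz_subE (1 + ac * z) _ j 1 zD); last by rewrite /Defs.half; lia.
  rewrite (@expz_subE (z - ac) _ n j zE); last by rewrite /Defs.half; lia.
  rewrite (@expz_subE w _ n k w0); last by rewrite /Defs.half; lia.
  rewrite (@expz_subE z _ n s z0); last by rewrite /Defs.half; lia.
  rewrite /alpha_b /pfun !exprS expr0; fieldnz.
rewrite [X in _ - X]mulrAC -[X in _ - X]mulrA -[X in _ - _ * X]/(residue Gin _).
rewrite [X in _ - _ * X](@eq_residue _ Gin _ (fun z =>
    alpha_b s j z * pfun k z)); last first.
  move=> z Gz; have z0 := trace_neq0 hin Gz; have zE := trace_E hin Gz.
  have zD := trace_D a_gt0 hin Gz.
  rewrite (@expz_subE z _ s k z0); last by rewrite /Defs.half; lia.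
  rewrite (@expz_subE (1 + ac * z) _ n.+1 j zD); last by rewrite /Defs.half; lia.
  rewrite (@expz_natE (z - ac) _ j.+1); last by rewrite /Defs.half; lia.
  rewrite /alpha_b /pfun !exprS; fieldnz.
have h1 := hol_onM (hol_alpha_b s j) (hol_plus_part V n).
have h2 := hol_onM (hol_alpha_b s j) (hol_minus_part U).
rewrite (@eq_residue _ Gin (fun z => alpha_b s j z * pfun k z)
  (fun z => alpha_b s j z * (V.[z] / (1 + ac * z) ^+ n) + alpha_b s j z
      * minus_part U z)); last first.
  move=> z Gz; rewrite (pfun_split kT (trace_neq0 hin Gz) (trace_E hin Gz)
      (trace_D a_gt0 hin Gz) NE).
  by rewrite mulrDr addrC.
by rewrite (residueD hin h1 h2); ring.
Qed.

(** Here the Cauchy kernel has the opposite orientation, so the double integral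
    subtracts the part with a pole at [- 1 / a] from the single integral. *)
Lemma Bfun_residue s j k (U V : {poly C}) : (s <= 2 * m + n)%N -> (j <= n)%N ->
  (size U <= 2 * m + n.+1)%N ->
  'X^(2 * m + n - s) * Dp a ^+ (n - j) * Ep a ^+ j =
    U * Dp a ^+ n + V * ('X^(2 * m) * Ep a ^+ n.+1) ->
  Bfun a n Gin Gout (2 * s%:Z) (2 * j%:Z - 1) k =
  (-1) ^+ k * residue Gin (fun z => qfun k z * minus_part U z).
Proof.
move=> sT jn sU NE.
rewrite /Bfun [X in X + _]mulrAC -[X in X + _]mulrA.
have hq := hol_qfun k.
have hNq : hol_on Gin (fun z => - 1 * qfun k z) by apply: hol_onM =>
    //; exact: hol_on_cst.
rewrite (@nested_integral _ (fun z => - 1 * qfun k z) (beta_b s j) U V (2 * m)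
    n.+1 n); last 4 first.
- exact: hNq.
- exact: sU.
- move=> w Gw; apply: (beta_b_split sT jn _ _ _ NE).
  + exact: trace_neq0 hout _ Gw.
  + exact: trace_E hout _ Gw.
  + exact: (trace_D a_gt0 hout Gw).
- move=> z w Gz Gw; have -> : (z - w)^-1 = - (w - z)^-1 by rewrite -invrN opprB.
  rewrite [RHS](_ : _ = - ((w - z)^-1 * (qfun k z * beta_b s j w))); last by ring.
  rewrite mulNr; congr (- (_ * _)).
  have z0 := trace_neq0 hin Gz; have zE := trace_E hin Gz.
  have zD := trace_D a_gt0 hin Gz.
  have w0 := trace_neq0 hout Gw; have wE := trace_E hout Gw.
  have wD := trace_D a_gt0 hout Gw.
  rewrite (@expz_subE w _ n s w0); last by rewrite /Defs.half; lia.
  rewrite (@expz_natE (1 + ac * w) _ j); last by rewrite /Defs.half; lia.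
  rewrite (@expz_subE (w - ac) _ n.+1 j wE); last by rewrite /Defs.half; lia.
  rewrite (@expz_subE z _ n.+1 k z0); last by rewrite /Defs.half; lia.
  rewrite /qfun /beta_b !exprS; fieldnz.
rewrite [X in _ + X]mulrAC -[X in _ + X]mulrA -[X in _ + _ * X]/(residue Gin _).
rewrite [X in _ + _ * X](@eq_residue _ Gin _ (fun z =>
    qfun k z * beta_b s j z)); last first.
  move=> z Gz; have z0 := trace_neq0 hin Gz; have zE := trace_E hin Gz.
  have zD := trace_D a_gt0 hin Gz.
  rewrite (@expz_subE z _ k s.+1 z0); last by rewrite /Defs.half; lia.
  rewrite (@expz_subE (1 + ac * z) _ n j zD); last by rewrite /Defs.half; lia.
  rewrite (@expz_natE (z - ac) _ j); last by rewrite /Defs.half; lia.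
  rewrite /qfun /beta_b !exprS; fieldnz.
have h1 := hol_onM hq (hol_plus_part V n).
have h2 := hol_onM hq (hol_minus_part U).
rewrite (@eq_residue _ Gin (fun z => qfun k z * beta_b s j z)
  (fun z => qfun k z * (V.[z] / (1 + ac * z) ^+ n) + qfun k z
      * minus_part U z)); last first.
  move=> z Gz; rewrite (beta_b_split sT jn (trace_neq0 hin Gz) (trace_E hin Gz)
      (trace_D a_gt0 hin Gz) NE).
  by rewrite mulrDr addrC.
rewrite (@eq_residue _ Gin (fun z => - 1 * qfun k z * (V.[z] / (1 + ac * z) ^+ n))
  (fun z => - 1 * (qfun k z * (V.[z] / (1 + ac * z) ^+ n)))); last first.
  by move=> z _; ring.
by rewrite (residueZ hin _ h1) (residueD hin h1 h2); ring.
Qed.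

Lemma Kn_residue j k M (U V : {poly C}) : (size U <= M + n.+1)%N ->
  (forall w, w != 0 -> w - ac != 0 -> 1 + ac * w != 0 ->
     pfun j w = U.[w] / (w ^+ M * (w - ac) ^+ n.+1) + V.[w] / (1 + ac * w) ^+ n) ->
  Kn a n Gin Gout j k =
  (-1) ^+ (j + k) * residue Gin (fun z => qfun k z * (V.[z] / (1 + ac * z) ^+ n)).
Proof.
move=> sU fE.
rewrite /Kn mulrAC -mulrA.
rewrite (@nested_integral _ (qfun k) (pfun j) U V M n.+1 n) //.
- exact: hol_qfun.
- move=> w Gw; apply: fE.
  + exact: trace_neq0 hout _ Gw.
  + exact: trace_E hout _ Gw.
  + exact: (trace_D a_gt0 hout Gw).
- move=> z w Gz Gw; congr (_ * _).
  have z0 := trace_neq0 hin Gz; have zE := trace_E hin Gz.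
  have zD := trace_D a_gt0 hin Gz.
  have w0 := trace_neq0 hout Gw; have wE := trace_E hout Gw.
  have wD := trace_D a_gt0 hout Gw.
  rewrite (@expz_subE w _ n j w0); last by lia.
  rewrite (@expz_subE z _ n.+1 k z0); last by lia.
  rewrite /qfun /pfun !exprS; fieldnz.
Qed.

(** [qfun] cancels all denominators except a power of [z], so that pairing with
    it reads off a coefficient. *)
Lemma residue_qfun_minus_part (i : nat) (U : {poly C}) : (i < n)%N ->
  residue Gin (fun z => qfun (2 * m + 1 + i) z * minus_part U z)
      = (Dp a ^+ n * U)`_(n - i.+1).
Proof.
move=> iN; rewrite -(residue_coef a_gt0 hin); apply: eq_residue => z Gz.
have z0 := trace_neq0 hin Gz; have zE := trace_E hin Gz.
rewrite /qfun /minus_part !(horner_Dp, hornerM, horner_exp).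
have En : z ^+ n = z ^+ i * z ^+ (n - i.+1) * z.
  by rewrite -mulrA -exprSr -exprD; congr (_ ^+ _); lia.
have -> : z ^+ (2 * m + 1 + i) = z ^+ (2 * m) * z * z ^+ i.
  by rewrite -exprSr -exprD; congr (_ ^+ _); lia.
by rewrite !(exprS z) En; fieldnz.
Qed.

Lemma residue_qfun_minus_part_large k (U : {poly C}) : (2 * m + n < k)%N ->
  residue Gin (fun z => qfun k z * minus_part U z) = 0.
Proof.
move=> kn.
rewrite (@residue_eq0 _ a a_gt0 Gin hin _ ('X^(k - (2 * m + n.+1)) * Dp a ^+ n
    * U) 0 0 0 1)//.
  by rewrite size_poly0.
move=> z Gz; have z0 := trace_neq0 hin Gz; have zE := trace_E hin Gz.
rewrite horner0 mul0r addr0 expr0 divr1 !(horner_Dp, hornerM, horner_exp, hornerX).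
rewrite /qfun /minus_part.
have -> : z ^+ k = z ^+ (k - (2 * m + n.+1)) * z ^+ (2 * m) * z ^+ n.+1.
  by rewrite -!exprD; congr (_ ^+ _); lia.
fieldnz.
Qed.

Lemma residue_qfun_plus_part_large k (V : {poly C}) : (n < k)%N ->
  residue Gin (fun z => qfun k z * (V.[z] / (1 + ac * z) ^+ n)) = 0.
Proof.
move=> kn.
rewrite (@residue_eq0 _ a a_gt0 Gin hin _ ('X^(k - n.+1) * Ep a ^+ n.+1 * V) 0 0
    0 1)//.
  by rewrite size_poly0.
move=> z Gz; have z0 := trace_neq0 hin Gz; have zE := trace_E hin Gz.
have zD := trace_D a_gt0 hin Gz.
rewrite horner0 mul0r addr0 expr0 divr1 !(horner_Ep, hornerM, horner_exp, hornerX).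
rewrite /qfun.
have -> : z ^+ k = z ^+ (k - n.+1) * z ^+ n.+1.
  by rewrite -!exprD; congr (_ ^+ _); lia.
fieldnz.
Qed.

Lemma residue_qfun_pfun j k : residue Gin (fun z => qfun k z * pfun j z)
    = (j == k)%:R.
Proof.
have -> : (j == k)%:R = ('X^k : {poly C})`_j by rewrite coefXn.
rewrite -(residue_coef a_gt0 hin); apply: eq_residue => z Gz.
have z0 := trace_neq0 hin Gz; have zE := trace_E hin Gz.
have zD := trace_D a_gt0 hin Gz.
rewrite /qfun /pfun horner_exp hornerX !(exprS z); fieldnz.
Qed.

Lemma Kn_large j k : (n < k)%N -> Kn a n Gin Gout j k = 0.
Proof.
move=> kn; have [[U V] /= [sU NE]] := pole_split a_gt0 j n 'X^n.
rewrite (@Kn_residue j k j U V sU) ?residue_qfun_plus_part_large ?mulr0//.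
move=> w w0 wE wD; rewrite -(frac_split w0 wE wD NE) horner_exp hornerX /pfun;
    fieldnz.
Qed.

(** Since [qfun] and [pfun] are dual to each other, the projection in [Kn]
    becomes the identity minus a coefficient of the complementary part. *)
Lemma Kn_coef j i (U V : {poly C}) : (j <= 2 * m + n)%N -> (i < n)%N ->
  (size U <= 2 * m + n.+1)%N ->
  'X^(2 * m + n - j) = U * Dp a ^+ n + V * ('X^(2 * m) * Ep a ^+ n.+1) ->
  Kn a n Gin Gout j (2 * m + 1 + i) = (-1) ^+ (j + (2 * m + 1 + i)) *
   ((j == 2 * m + 1 + i)%N%:R - (Dp a ^+ n * U)`_(n - i.+1)).
Proof.
move=> jT iN sU NE; rewrite (@Kn_residue j _ (2 * m) U V sU); last first.
  by move=> w w0 wE wD; exact: (pfun_split jT w0 wE wD NE).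
congr (_ * _); rewrite -residue_qfun_minus_part// -residue_qfun_pfun -mulN1r.
have hq := hol_qfun (2 * m + 1 + i).
have h1 := hol_onM hq (hol_pfun j).
have h2 := hol_onM hq (hol_minus_part U).
rewrite -(residueZ hin _ h2) -(residueD hin h1); last by apply: hol_onM =>
    //; exact: hol_on_cst.
apply: eq_residue => z Gz.
by rewrite (pfun_split jT (trace_neq0 hin Gz) (trace_E hin Gz)
    (trace_D a_gt0 hin Gz) NE); ring.
Qed.

End KernelIntegrals.

(** * Inverting the truncated operator *)

Section TruncatedOperator.
Variables (R : realType) (a : R).
Hypothesis a_gt0 : 0 < a.
Notation C := R[i].
Notation ac := (a%:C).
Variables (n m : nat) (Gin Gout : R -> C).
Hypothesis hin : good_contour a Gin.
Hypothesis hout : good_contour a Gout.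
Hypothesis henc : forall z, trace Gin z -> encloses Gout z.

Lemma pairing_finite (alpha N : nat) (f g : nat -> C) :
  (forall k, (alpha + N <= k)%N -> f k * g k = 0) ->
  pairing alpha f g = \sum_(i < N) f (alpha + i)%N * g (alpha + i)%N.
Proof.
move=> fg0; rewrite /pairing.
apply: (@lim_near_cst (R[i]^o) (@norm_hausdorff _ (R[i]^o))).
near=> M.
have NM : (alpha + N <= M)%N by near: M; exact: nbhs_infty_ge.
rewrite (big_cat_nat _ (n := alpha + N)) //=; last exact: leq_addr.
rewrite [X in _ + X](_ : _ = 0) ?addr0.
  by rewrite -{1}[alpha]add0n big_addn addKn big_mkord; apply: eq_bigr =>
      i _; rewrite addnC.
rewrite big_nat; apply: big1 => k /andP[ak _]; exact: fg0.
Unshelve. all: by end_near. Qed.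

Let idx i : nat := (2 * m + 1 + i)%N.

(** The entries [Kn j k] vanish for [k > n], so the indices from [2 m + 1] to
    [2 m + n] decide about invertibility. *)
Definition Kn_mx : 'M[C]_n := \matrix_(i, i') Kn a n Gin Gout (idx i) (idx i').

Lemma pairing_Kn j f : pairing (2 * m + 1) (Kn a n Gin Gout j) f =
  \sum_(i < n) Kn a n Gin Gout j (idx i) * f (idx i).
Proof.
apply: pairing_finite => k nk; rewrite (Kn_large a_gt0 hin hout henc) ?mul0r//.
by lia.
Qed.

Definition entries (f : nat -> C) : 'cV[C]_n := \col_i f (idx i).

Lemma entries_I_minus_K f :
  entries (I_minus_K a n Gin Gout (2 * m + 1) f) = (1%:M - Kn_mx) *m entries f.
Proof.
apply/colP => i; rewrite mulmxBl mul1mx !mxE /I_minus_K /restr_ge /idx leq_addr.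
by rewrite pairing_Kn; congr (_ - _); apply: eq_bigr => i' _; rewrite !mxE.
Qed.

(** The values beyond the window of [Kn_mx] are determined by those inside. *)
Lemma I_minus_K_bij : 1%:M - Kn_mx \in unitmx ->
  set_bij (funs_ge R (2 * m + 1)) (funs_ge R (2 * m + 1))
    (I_minus_K a n Gin Gout (2 * m + 1)).
Proof.
move=> uK; split.
- by move=> f _ k kl; rewrite /I_minus_K /restr_ge leqNgt kl.
- move=> f g /set_mem Ff /set_mem Fg e.
  have vfg : entries f = entries g.
    by rewrite -[entries f](mulKmx uK) -entries_I_minus_K e entries_I_minus_K
        mulKmx.
  apply/funext => k; have [kl|kl] := ltnP k (2 * m + 1); first by rewrite Ff// Fg.
  have := congr1 (fun F => F k) e; rewrite /I_minus_K /restr_ge kl !pairing_Kn.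
  rewrite (eq_bigr (fun i : 'I_n => Kn a n Gin Gout k (idx i) * g (idx i))).
    by move/addIr.
  by move=> i _; congr (_ * _); have := congr1 (fun v : 'cV_n => v i 0) vfg;
      rewrite !mxE.
- move=> y Fy.
  have [F e] : exists F, (1%:M - Kn_mx) *m F = entries y.
    by exists (invmx (1%:M - Kn_mx) *m entries y); rewrite mulKVmx.
  (* Beyond the window the equation itself gives the values of the preimage. *)
  pose f k := if (2 * m + 1 <= k)%N then
     y k + \sum_(i < n) Kn a n Gin Gout k (idx i) * F i 0 else 0.
  have vf : entries f = F.
    rewrite mulmxBl mul1mx in e; apply/colP => i.
    have e1 : F i 0 = entries y i 0 + (Kn_mx *m F) i 0 by rewrite -e mxE
        [X in _ = _ + X + _]mxE subrK.
    rewrite e1 !mxE /f /idx leq_addr; congr (_ + _).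
    by apply: eq_bigr => i' _; rewrite mxE.
  exists f; first by move=> k kl; rewrite /f leqNgt kl.
  apply/funext => k; rewrite /I_minus_K /restr_ge; case: leqP =>
      kl; last by rewrite Fy.
  have -> : f k = y k + \sum_(i < n) Kn a n Gin Gout k (idx i) * F i 0.
    by rewrite /f kl.
  rewrite pairing_Kn -vf [X in _ + X - _](eq_bigr (fun i : 'I_n =>
    Kn a n Gin Gout k (idx i) * f (idx i))) ?addrK//.
  by move=> i _; rewrite mxE.
Qed.

End TruncatedOperator.

(** * The kernel inverts the Kasteleyn operator *)

Section KernelIsInverse.
Variables (R : realType) (a : R).
Hypothesis a_gt0 : 0 < a.
Notation C := R[i].
Notation ac := (a%:C).
Variables (n m : nat) (Gin Gout : R -> C).
Hypothesis hin : good_contour a Gin.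
Hypothesis hout : good_contour a Gout.
Hypothesis henc : forall z, trace Gin z -> encloses Gout z.
Hypothesis kast_inj : forall x : nat -> nat -> C,
  (forall s j, (s <= 2 * m + n)%N -> (j <= n)%N -> black_at m s j ->
     kast a n x s j = 0) ->
  forall s i, (s <= 2 * m + n)%N -> (i <= n)%N -> white_at n s i -> x s i = 0.

Notation idx i := (2 * m + 1 + i)%N.
Notation K := (Kn_mx a n m Gin Gout).

(** partial fractions as in [pole_split], one for each [k] *)
Variables (U V : nat -> {poly C}).
Hypothesis sU : forall k, (size (U k) <= 2 * m + n.+1)%N.
Hypothesis UV : forall k,
  'X^(2 * m + n - k) = U k * Dp a ^+ n + V k * ('X^(2 * m) * Ep a ^+ n.+1).

(** A row vector becomes a combination of the functions [pfun]; the signs absorb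
    those of [Kn].  [Npol] is its numerator, [Upol] and [Vpol] are its partial
    fractions. *)
Definition sgn_row (v : 'rV[C]_n) (i : 'I_n) : C := (-1) ^+ idx i * v 0 i.

Definition Npol v : {poly C} := \sum_i sgn_row v i *: 'X^(n - i.+1).
Definition Upol v : {poly C} := \sum_i sgn_row v i *: U (idx i).
Definition Vpol v : {poly C} := \sum_i sgn_row v i *: V (idx i).

Lemma size_Upol v : (size (Upol v) <= 2 * m + n.+1)%N.
Proof.
apply: leq_trans (size_sum _ _ _) _; apply/bigmax_leqP => i _.
exact: leq_trans (size_scale_leq _ _) (sU _).
Qed.

Lemma size_Npol v : (size (Npol v) <= n)%N.
Proof.
apply: leq_trans (size_sum _ _ _) _; apply/bigmax_leqP => i _.
apply: leq_trans (size_scale_leq _ _) _.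
by rewrite size_polyXn; have := ltn_ord i; lia.
Qed.

Lemma Npol_split v : Npol v = Upol v * Dp a ^+ n + Vpol v
    * ('X^(2 * m) * Ep a ^+ n.+1).
Proof.
rewrite /Npol /Upol /Vpol !mulr_suml -big_split /=; apply: eq_bigr => i _.
rewrite -!scalerAl -scalerDr -UV; congr (_ *: 'X^_).
by lia.
Qed.

Lemma Npol_eq0 v : Npol v = 0 -> v = 0.
Proof.
move=> N0; apply/rowP => i; rewrite mxE.
have := congr1 (fun p : {poly C} => p`_(n - i.+1)) N0; rewrite coef0 coef_sum.
rewrite (bigD1 i) //= coefZ coefXn eqxx mulr1 big1 ?addr0; last first.
  move=> j ji; rewrite coefZ coefXn; case: eqP => [e|]; last by rewrite mulr0.
  suff : j = i by move/eqP: ji.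
  by apply/val_inj => /=; have := ltn_ord i; have := ltn_ord j; lia.
by rewrite /sgn_row => /eqP; rewrite mulf_eq0 expf_eq0 oppr_eq0 oner_eq0 andbF
    => /eqP.
Qed.

(** The identity matrix cancels the one in [Kn_coef]. *)
Lemma row_mul_1K v (i : 'I_n) :
  (-1) ^+ idx i * (v *m (1%:M - K)) 0 i = (Dp a ^+ n * Upol v)`_(n - i.+1).
Proof.
rewrite mulmxBr mulmx1 mxE [X in _ + X]mxE mxE mulrBr.
rewrite (eq_bigr (fun i' : 'I_n => (-1) ^+ idx i * (sgn_row v i' *
   ((i' == i)%:R - (Dp a ^+ n * U (idx i'))`_(n - i.+1))))); last first.
  move=> i' _; rewrite mxE (Kn_coef a_gt0 hin hout henc _ (ltn_ord i) (sU _)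
      (UV _)).
    rewrite /sgn_row eqn_add2l exprD; ring.
  by have := ltn_ord i'; lia.
rewrite -mulr_sumr mulrA -expr2 sqrr_sign mul1r.
rewrite (eq_bigr (fun i' => sgn_row v i' * (i' == i)%:R
   - sgn_row v i' * (Dp a ^+ n * U (idx i'))`_(n - i.+1))); last first.
  by move=> i' _; rewrite mulrBr.
rewrite sumrB (bigD1 i) //= eqxx mulr1 big1 ?addr0; last first.
  by move=> j /negPf ->; rewrite mulr0.
rewrite -/(sgn_row v i) opprB addrC subrK /Upol mulr_sumr coef_sum.
by apply: eq_bigr => i' _; rewrite -scalerAr coefZ.
Qed.

(** Vanishing of the low coefficients of [Dp ^+ n * W] means divisibility of
    [W] by ['X^n], as [Dp] does not vanish at [0]. *)
Lemma low_coef_div (W : {poly C}) : (size W <= 2 * m + n.+1)%N ->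
  (forall i : 'I_n, (Dp a ^+ n * W)`_(n - i.+1) = 0) ->
  exists2 P : {poly C}, W = P * 'X^n & (size P <= (2 * m).+1)%N.
Proof.
move=> sW W0.
have dv : 'X^n %| Dp a ^+ n * W.
  suff -> : Dp a ^+ n * W = drop_poly n (Dp a ^+ n * W) * 'X^n by rewrite dvdp_mull.
  rewrite -[LHS](poly_take_drop n) [X in X + _](_ : _ = 0) ?add0r//.
  apply/polyP => k; rewrite coef_take_poly coef0; case: ltnP => // kn.
  have kk : (n - k.+1 < n)%N by lia.
  have := W0 (Ordinal kk) => /=.
  by rewrite (_ : (n - (n - k.+1).+1)%N = k); last lia.
have cop : coprimep 'X^n (Dp a ^+ n).
  apply: coprimep_expl; rewrite coprimep_sym; apply: coprimep_expl.
  have -> : 'X = 'X - 0%:P :> {poly C} by rewrite subr0.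
  by rewrite coprimep_XsubC rootE horner_Dp mulr0 addr0 oner_eq0.
rewrite Gauss_dvdpr// in dv.
have WE := divpK dv; exists (W %/ 'X^n) => //.
have [P0|P0] := eqVneq (W %/ 'X^n) 0; first by rewrite P0 size_poly0.
move: sW; rewrite -{1}WE size_mulXn//.
by rewrite (_ : (2 * m + n.+1 = n + (2 * m).+1)%N) ?leq_add2l//; lia.
Qed.

(** By [row_mul_1K] a linear equation for [v] is a congruence modulo ['X^n] for
    [Upol v], and the quotient is the polynomial [P] that solves the boundary
    conditions of the transfer. *)
Lemma relation_of_row v (e : C) (Nb Ub Vb : {poly C}) :
  (size Ub <= 2 * m + n.+1)%N ->
  Nb = Ub * Dp a ^+ n + Vb * ('X^(2 * m) * Ep a ^+ n.+1) ->
  (forall i : 'I_n, (-1) ^+ idx i * (v *m (1%:M - K)) 0 i =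
     e * (Dp a ^+ n * Ub)`_(n - i.+1)) ->
  exists P : {poly C}, [/\ (size P <= (2 * m).+1)%N, Upol v = e *: Ub + P * 'X^n &
    Npol v = e *: Nb + P * 'X^n * Dp a ^+ n +
      (Vpol v - e *: Vb) * ('X^(2 * m) * Ep a ^+ n.+1)].
Proof.
move=> sUb NbE vK.
have [|i|P PE sP] := @low_coef_div (Upol v - e *: Ub).
- apply: leq_trans (size_polyD _ _) _; rewrite geq_max size_Upol size_polyN.
  exact: leq_trans (size_scale_leq _ _) sUb.
- by rewrite mulrBr coefB -row_mul_1K vK -scalerAr coefZ subrr.
have {}PE : Upol v = e *: Ub + P * 'X^n by rewrite -PE addrC subrK.
exists P; split=> //.
by rewrite Npol_split NbE PE -!mul_polyC; ring.
Qed.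

(** A row vector killed by [1 - K] yields a solution of the homogeneous Kasteleyn
    equations; it vanishes, hence so does its numerator. *)
Lemma unit_1K : 1%:M - K \in unitmx.
Proof.
rewrite -row_free_unit -kermx_eq0; apply/rowV0P => v /sub_kermxP vK.
have [||i|P [sP UE NE]] := @relation_of_row v 0 0 0 0.
- by rewrite size_poly0.
- by rewrite !mul0r addr0.
- by rewrite vK mxE mulr0 mul0r.
rewrite scale0r subr0 in NE.
have NE' : Npol v = 0 *: ('X^(2 * m + n - 0) * Dp a ^+ (n - 0) * Ep a ^+ 0)
  + P * 'X^n * Dp a ^+ n + Vpol v * ('X^(2 * m) * Ep a ^+ n.+1).
  by rewrite NE scale0r.
apply: Npol_eq0.
apply: (relation_trivial a_gt0 hin (size_Npol v) NE' (erefl _)).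
move=> i iN.
have := @kast_inj (fun s i => white_value a Gin m 0 0 0 P s i.+1).
apply; rewrite ?leqnn//; last 2 first.
- exact: ltnW.
- by rewrite /white_at iN.
move=> s j sT jn b.
by rewrite (kast_amplitude a_gt0 hin _ _ sP (size_Npol v) NE')// mulr0.
Qed.

Lemma Lkernel_kastR s' j' : (s' <= 2 * m + n)%N -> (j' <= n)%N ->
  exists2 x : nat -> nat -> C,
    (forall s j, (s <= 2 * m + n)%N -> (j <= n)%N -> black_at m s j ->
       kast a n x s j = ((s == s') && (j == j'))%:R) &
    (forall s j, (s <= 2 * m + n)%N -> (j <= n)%N -> black_at m s j ->
       (1 + a ^+ 2)%:C * L0 a n Gin Gout (2 * s%:Z) (2 * j%:Z - 1) (2 * s'%:Z)
           (2 * j'%:Z - 1) -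
       (1 + a ^+ 2)%:C * pairing (2 * m + 1)
         (I_minus_K_inv a n Gin Gout (2 * m + 1)
            (restr_ge (2 * m + 1) (Afun a n Gin Gout (2 * s%:Z) (2 * j%:Z - 1))))
         (Bfun a n Gin Gout (2 * s'%:Z) (2 * j'%:Z - 1))
       = kastR a n x s j).
Proof.
move=> s'T j'n.
pose Nb : {poly C} := 'X^(2 * m + n - s') * Dp a ^+ (n - j') * Ep a ^+ j'.
have [[Ub Vb] /= [sUb NbE]] := pole_split a_gt0 (2 * m) n Nb.
pose B := Bfun a n Gin Gout (2 * s'%:Z) (2 * j'%:Z - 1).
have BB k : B k = (-1) ^+ k * residue Gin (fun z =>
    qfun a n k z * minus_part a n m Ub z).
  exact: (Bfun_residue a_gt0 hin hout henc k s'T j'n sUb NbE).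
pose v := (entries n m B)^T *m invmx (1%:M - K).
have uK := unit_1K.
have vKE : v *m (1%:M - K) = (entries n m B)^T by rewrite /v mulmxKV.
have [//|//|i|P [sP UE NE]] := @relation_of_row v 1 Nb Ub Vb.
  rewrite vKE !mxE BB mulrA -expr2 sqrr_sign !mul1r.
  by rewrite (residue_qfun_minus_part a_gt0 m hin).
exists (fun s i => white_value a Gin m s' j' 1 P s i.+1) => s j sT jn b.
  by rewrite (kast_amplitude a_gt0 hin s'T j'n sP (size_Npol v) NE)// mulr1.
rewrite (kastR_amplitude a_gt0 hin s'T j'n (size_Npol v) NE)//.
set A := Afun _ _ _ _ _ _.
have [_ _ surj] := I_minus_K_bij a_gt0 hin hout henc uK.
have FA : funs_ge R (2 * m + 1) (restr_ge (2 * m + 1) A).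
  by move=> k kl; rewrite /restr_ge leqNgt kl.
pose f := I_minus_K_inv a n Gin Gout (2 * m + 1) (restr_ge (2 * m + 1) A).
have fE : I_minus_K a n Gin Gout (2 * m + 1) f = restr_ge (2 * m + 1) A.
  by rewrite /f /I_minus_K_inv; apply: pinvK; apply/mem_set; exact: surj.
rewrite -/f (pairing_finite (N := n)); last first.
  move=> k nk; rewrite -/B BB (residue_qfun_minus_part_large a_gt0 hin)
      ?mulr0//; lia.
have -> : \sum_(i < n) f (idx i) * Bfun a n Gin Gout (2 * s'%:Z) (2 * j'%:Z - 1)
    (idx i)
    = - residue Gin (fun z => alpha_b a n s j z * minus_part a n m (Upol v) z).
  have -> : \sum_(i < n) f (idx i) * B (idx i)
      = ((entries n m B)^T *m entries n m f) 0 0.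
    by rewrite mxE; apply: eq_bigr => i _; rewrite !mxE mulrC.
  rewrite -vKE -mulmxA -(@entries_I_minus_K R a a_gt0 n m Gin Gout hin hout
      henc) fE mxE.
  rewrite (eq_bigr (fun i =>
      - (sgn_row v i * residue Gin (fun z => alpha_b a n s j z *
     minus_part a n m (U (idx i)) z)))); last first.
    move=> i _; rewrite [X in _ * X]mxE /restr_ge leq_addr.
    rewrite /A (Afun_residue a_gt0 hin hout henc s j _ (sU _) (UV _)); last first.
      by have := ltn_ord i; lia.
    by rewrite /sgn_row; ring.
  rewrite sumrN; congr (- _).
  have hol_term W : hol_on Gin (fun z => alpha_b a n s j z * minus_part a n m W z).
    by apply: hol_onM; [exact: hol_alpha_b|exact: hol_minus_part].
  have lin c W1 W2 : residue Gin (fun z =>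
      alpha_b a n s j z * minus_part a n m (c *: W1 + W2) z) =
      c * residue Gin (fun z => alpha_b a n s j z * minus_part a n m W1 z) +
      residue Gin (fun z => alpha_b a n s j z * minus_part a n m W2 z).
    rewrite -(residueZ hin _ (hol_term W1)) -(residueD hin); last 2 first.
    - by apply: hol_onM => //; exact: hol_on_cst.
    - exact: hol_term.
    by apply: eq_residue => z _; rewrite /minus_part hornerD hornerZ; ring.
  rewrite /Upol; elim/big_ind2: _ => //.
  - rewrite -(residue0 hin); apply: eq_residue => z _.
    by rewrite /minus_part horner0 mul0r mulr0.
  - by move=> W1 y1 W2 y2 -> ->; rewrite -[in RHS](scale1r W1) lin mul1r.
  - move=> i _; rewrite -[in RHS](addr0 (_ *: _)) lin.
    rewrite [X in _ = _ + X](_ : _ = 0) ?addr0// -(residue0 hin).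
    by apply: eq_residue => z _; rewrite /minus_part horner0 mul0r mulr0.
rewrite -mulrBr opprK (L0_residue a_gt0 hin hout henc s j s'T j'n sUb NbE).
have hal := hol_alpha_b a_gt0 n hin s j.
have hmn W := hol_minus_part a_gt0 n m hin W.
rewrite -(residueD hin); last 2 first.
- apply: hol_onM => //; apply: hol_onD; last first.
    have := hol_onM (hol_on_cst (G := Gin) (-1)) (hmn Ub).
    by congr hol_on; apply/funext => z; rewrite mulN1r.
  by apply: hol_onM; [exact: hol_on_cst|exact: hol_beta_b].
- by apply: hol_onM.
rewrite /black_value rmorphD rmorph1 rmorphXn; congr (_ * _);
    apply: eq_residue => z Gz.
have z0 := trace_neq0 hin Gz; have zE := trace_E hin Gz.
have zD := trace_D a_gt0 hin Gz.
rewrite UE scale1r /minus_part !hornerE /= /alpha_b /beta_b /amplitude /source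
    !(exprS (z - ac)) !(exprS (1 + ac * z)).
case: leqP => ss /=; last by fieldnz.
have -> : z ^+ s = z ^+ s' * z ^+ (s - s') by rewrite -exprD subnKC.
fieldnz.
Qed.

End KernelIsInverse.

(** * The sign of a permutation by inversions *)

Section SignOfPermutation.
Variable N : nat.
Implicit Types (x y z : 'I_N -> nat) (s : 'S_N).

(** Permuting the nodes permutes the columns of the Vandermonde matrix; the signs
    of the two products then count inversions. *)
Lemma perm_sign_Vandermonde y s :
  ((-1) ^+ s : int) *
    (\prod_(i < N) \prod_(j < N | (i < j)%N) ((y j)%:Z - (y i)%:Z)) =
  \prod_(i < N) \prod_(j < N | (i < j)%N) ((y (s j))%:Z - (y (s i))%:Z).
Proof.
pose v : 'rV[int]_N := \row_i (y i)%:Z.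
pose vs : 'rV[int]_N := \row_i (y (s i))%:Z.
have vE i : v 0 i = (y i)%:Z by rewrite mxE.
have vsE i : vs 0 i = (y (s i))%:Z by rewrite mxE.
have e : Vandermonde N vs = col_perm s (Vandermonde N v).
  by apply/matrixP => i j; rewrite !mxE.
have := congr1 determinant e; rewrite col_permE det_mulmx det_perm odd_permV.
rewrite !det_Vandermonde.
under eq_bigr do under eq_bigr do rewrite !vsE.
under [in X in _ = X -> _]eq_bigr do under eq_bigr do rewrite !vE.
by move=> ->; rewrite mulrC.
Qed.

Lemma sgz_sub_nat (p q : nat) : p != q -> sgz (p%:Z - q%:Z) = (-1) ^+ (p < q)%N.
Proof.
move=> pq; case: ltngtP pq => // pq _ /=.
  by rewrite ltr0_sgz// subr_lt0 ltz_nat.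
by rewrite gtr0_sgz// subr_gt0 ltz_nat.
Qed.

Lemma sgz_prod (I : finType) (P : pred I) (F : I -> int) :
  sgz (\prod_(i | P i) F i) = \prod_(i | P i) sgz (F i).
Proof. by elim/big_rec2: _ => [|i u v _ <-]; rewrite ?sgz1 ?sgzM. Qed.

Lemma perm_sign_pairs y s : injective y ->
  ((-1) ^+ s : int) *
    (\prod_(i < N) \prod_(j < N | (i < j)%N) (-1) ^+ (y j < y i)%N) =
  \prod_(i < N) \prod_(j < N | (i < j)%N) (-1) ^+ (y (s j) < y (s i))%N.
Proof.
move=> yI; have := congr1 (@sgz _) (perm_sign_Vandermonde y s).
rewrite sgzM !sgz_prod.
have -> : sgz ((-1) ^+ s : int) = (-1) ^+ s by case: (odd_perm s).
move=> e; transitivity ((-1) ^+ s * \prod_(i < N) sgz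
    (\prod_(j < N | (i < j)%N) ((y j)%:Z - (y i)%:Z))).
  congr (_ * _); apply: eq_bigr => i _; rewrite sgz_prod.
  apply: eq_bigr => j ij; rewrite sgz_sub_nat//.
  by apply/eqP => /yI ji; rewrite ji ltnn in ij.
rewrite e; apply: eq_bigr => i _; rewrite sgz_prod; apply: eq_bigr => j ij.
rewrite sgz_sub_nat//.
by apply/eqP => /yI/perm_inj ji; rewrite ji ltnn in ij.
Qed.

Definition inversions x z : nat :=
  \sum_(i < N) \sum_(k < N) ((x i < x k) && (z k < z i))%N.

Lemma sign_inversions_pairs x z : injective x -> injective z ->
  ((-1) ^+ inversions x z : int) =
  (\prod_(i < N) \prod_(j < N | (i < j)%N) (-1) ^+ (x j < x i)%N) *
  (\prod_(i < N) \prod_(j < N | (i < j)%N) (-1) ^+ (z j < z i)%N).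
Proof.
move=> xI zI.
pose f i k : nat := ((x i < x k) && (z k < z i))%N.
have -> : inversions x z =
    (\sum_(i < N) \sum_(j < N | (i < j)%N) (f i j + f j i))%N.
  have split i : (\sum_(k < N) f i k = \sum_(k < N | (i < k)%N) f i k +
                   \sum_(k < N | (k < i)%N) f i k)%N.
    rewrite (bigID (fun k : 'I_N => (i < k)%N)) /=; congr (_ + _)%N.
    rewrite big_mkcond [RHS]big_mkcond /=; apply: eq_bigr => k _.
    case: ltngtP => // /val_inj ->; by rewrite /f ltnn.
  rewrite /inversions (eq_bigr _ (fun i _ => split i)) big_split /=.
  rewrite [X in (_ + X)%N](exchange_big_dep predT) //= -big_split /=.
  by apply: eq_bigr => i _; rewrite -big_split.
rewrite -big_split /= expr_sum; apply: eq_bigr => i _.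
rewrite -big_split /= expr_sum; apply: eq_bigr => j ij.
have xij : x i != x j by apply/eqP => /xI ji; rewrite ji ltnn in ij.
have zij : z i != z j by apply/eqP => /zI ji; rewrite ji ltnn in ij.
rewrite /f; case: ltngtP xij => // _ _; case: ltngtP zij => // _ _.
Qed.

(** Two linear orders of the index set suffice to count inversions: changing
    the orders changes all signs by the same factor. *)
Lemma odd_perm_inversions x y : injective x -> injective y ->
  exists c : bool, forall s,
    odd_perm s = c (+) odd (inversions x (y \o s)).
Proof.
move=> xI yI.
have pm (F : 'I_N -> 'I_N -> bool) : exists b : bool,
    \prod_(i < N) \prod_(j < N | (i < j)%N) (-1 : int) ^+ F i j = (-1) ^+ b.
  exists (odd (\sum_(i < N) \sum_(j < N | (i < j)%N) F i j)%N).
  rewrite signr_odd expr_sum; apply: eq_bigr => i _.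
  by rewrite expr_sum; apply: eq_bigr.
have [bx ex] := pm (fun i j => x j < x i)%N.
have [by_ ey] := pm (fun i j => y j < y i)%N.
exists (bx (+) by_) => s.
have ysI : injective (y \o s) by move=> i j /yI/perm_inj.
have := sign_inversions_pairs xI ysI.
rewrite /= -perm_sign_pairs// ex ey -!signr_addb -signr_odd => /eqP.
rewrite -[_ == _]/((_ : int) == _).
move: (odd _) => o; case: (odd_perm s) bx by_ o {ex ey} => [] [] [] [] //.
Qed.

End SignOfPermutation.

(** * All coverings have the same sign *)

Section GridParity.
Variables n m : nat.
Notation T := (2 * m + n)%N.

Definition grid : finType := ('I_T.+1 * 'I_n.+1)%type.
Definition grid_size : nat := #|{: grid}|.
Definition gx (i : 'I_grid_size) : nat := (enum_val i).1.
Definition gy (i : 'I_grid_size) : nat := (enum_val i).2.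
Definition grid_index (s j : nat) : 'I_grid_size :=
    enum_rank ((inord s, inord j) : grid).

Lemma gx_le i : (gx i <= T)%N. Proof. by rewrite -ltnS; exact: ltn_ord. Qed.
Lemma gy_le i : (gy i <= n)%N. Proof. by rewrite -ltnS; exact: ltn_ord. Qed.

Lemma gx_index s j : (s <= T)%N -> gx (grid_index s j) = s.
Proof. by move=> sT; rewrite /gx enum_rankK /= inordK. Qed.

Lemma gy_index s j : (j <= n)%N -> gy (grid_index s j) = j.
Proof. by move=> sT; rewrite /gy enum_rankK /= inordK. Qed.

Lemma grid_inj i k : gx i = gx k -> gy i = gy k -> i = k.
Proof.
move=> sik jik; apply: enum_val_inj.
have := sik; have := jik; rewrite /gx /gy.
by case: (enum_val i) (enum_val k) => [a b] [c d] /= /val_inj -> /val_inj ->.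
Qed.

Lemma sum_grid (F : nat -> nat -> nat) :
  (\sum_(k < grid_size) F (gx k) (gy k) = \sum_(s < T.+1) \sum_(j < n.+1) F s j)%N.
Proof.
rewrite pair_big /= (reindex (fun k : 'I_grid_size => enum_val k : grid)) //=.
by exists enum_rank => k _; rewrite ?enum_valK ?enum_rankK.
Qed.

Lemma count_above s j : (s <= T)%N -> (j <= n)%N ->
  (\sum_(k < grid_size) ((gx k == s) && (j < gy k)))%N = (n - j)%N.
Proof.
move=> sT jn; rewrite (sum_grid (fun s' j' => ((s' == s) && (j < j')%N : nat))).
have hs : (s < T.+1)%N by [].
rewrite (bigD1 (Ordinal hs)) //= [X in (_ + X)%N]big1 ?addn0; last first.
  move=> i /negPf; rewrite -val_eqE /= => ->; exact: big1.
rewrite eqxx /=.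
have -> : (\sum_(j0 < n.+1) (j < j0) = \sum_(0 <= j0 < n.+1) (j < j0))%N.
  by rewrite big_mkord.
rewrite (big_cat_nat _ (n := j.+1))//=.
rewrite big_nat_cond big1 ?add0n; last first.
  by move=> i /andP[/andP[_]]; rewrite ltnS leqNgt => /negPf ->.
rewrite big_nat_cond (eq_bigr (fun=> 1%N)); last by move=> i /andP[/andP[-> _]].
by rewrite -big_nat_cond sum_nat_const_nat muln1 subSS.
Qed.

Lemma count_below s j : (s <= T)%N -> (j <= n)%N ->
  (\sum_(k < grid_size) ((gx k == s) && (gy k < j)))%N = j.
Proof.
move=> sT jn; rewrite (sum_grid (fun s' j' => ((s' == s) && (j' < j)%N : nat))).
have hs : (s < T.+1)%N by [].
rewrite (bigD1 (Ordinal hs)) //= [X in (_ + X)%N]big1 ?addn0; last first.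
  move=> i /negPf; rewrite -val_eqE /= => ->; exact: big1.
rewrite eqxx /=.
have -> : (\sum_(j0 < n.+1) (j0 < j) = \sum_(0 <= j0 < n.+1) (j0 < j))%N.
  by rewrite big_mkord.
rewrite (big_cat_nat _ (n := j))//=; last exact: leqW.
rewrite [X in (_ + X)%N]big_nat_cond [X in (_ + X)%N]big1 ?addn0; last first.
  by move=> i /andP[/andP[ji _] _]; rewrite ltnNge ji.
rewrite big_nat_cond (eq_bigr (fun=> 1%N)); last by move=> i /andP[/andP[_ ->]].
by rewrite -big_nat_cond sum_nat_const_nat muln1 subn0.
Qed.

Definition is_black i := black_at m (gx i) (gy i).
Definition is_white i := white_at n (gx i) (gy i).

Definition edge_at (s j s' j' : nat) : bool :=
  ((s' == s) && ((j' == j) || (j'.+1 == j))) ||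
  ((s'.+1 == s) && ((j'.+1 == j) || (j' == j))).

(** Non-black grid points [(s, 0)] are matched to the non-white ones
    [(n + s, n)], so that coverings become permutations of the grid. *)
Definition good_entry i k : bool :=
  if is_black i then is_white k && edge_at (gx i) (gy i) (gx k) (gy k)
  else (gx k == n + gx i)%N && (gy k == n).

Definition good (sg : 'S_grid_size) : bool := [forall i, good_entry i (sg i)].

(** Rows and columns are ordered lexicographically inside the domain; the points
    outside come last, in the same order for both, and create no inversion. *)
Definition rowkey i : nat :=
  if is_black i then (gx i * n.+1 + gy i)%N else (T.+1 * n.+1 + gx i)%N.
Definition colkey i : nat :=
  if is_white i then (gx i * n.+1 + gy i)%N else (T.+1 * n.+1 + gx i)%N.

Lemma lex_lt (s j s' j' : nat) : (j <= n)%N -> (j' <= n)%N ->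
  (s * n.+1 + j < s' * n.+1 + j')%N = (s < s')%N || ((s == s') && (j < j')%N).
Proof.
move=> jn j'n; case: (ltngtP s s') => [ss|ss|->] /=.
- have : (s.+1 * n.+1 <= s' * n.+1)%N by rewrite leq_mul2r ss orbT.
  by rewrite mulSn; lia.
- have : (s'.+1 * n.+1 <= s * n.+1)%N by rewrite leq_mul2r ss orbT.
  by rewrite mulSn; lia.
- by rewrite ltn_add2l.
Qed.

Lemma lex_big (s j t : nat) : (s <= T)%N -> (j <= n)%N ->
  (s * n.+1 + j < T.+1 * n.+1 + t)%N.
Proof.
move=> sT jn.
have : (s.+1 * n.+1 <= T.+1 * n.+1)%N by rewrite leq_mul2r ltnS sT orbT.
by rewrite mulSn; lia.
Qed.

Lemma rowkey_inj : injective rowkey.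
Proof.
move=> i k; rewrite /rowkey.
have [si sk ji jk] := And4 (gx_le i) (gx_le k) (gy_le i) (gy_le k).
case: ifP => bi; case: ifP => bk.
- move=> e; have := lex_lt (gx i) (gx k) ji jk; have := lex_lt (gx k) (gx i) jk ji.
  by rewrite e !ltnn => e1 e2; apply: grid_inj; lia.
- by move=> e; have := lex_big (gx k) si ji; rewrite e ltnn.
- by move=> e; have := lex_big (gx i) sk jk; rewrite e ltnn.
- move=> /addnI e; apply: grid_inj => //.
  by move: bi bk; rewrite /is_black /black_at; lia.
Qed.

Lemma colkey_inj : injective colkey.
Proof.
move=> i k; rewrite /colkey.
have [si sk ji jk] := And4 (gx_le i) (gx_le k) (gy_le i) (gy_le k).
case: ifP => bi; case: ifP => bk.
- move=> e; have := lex_lt (gx i) (gx k) ji jk; have := lex_lt (gx k) (gx i) jk ji.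
  by rewrite e !ltnn => e1 e2; apply: grid_inj; lia.
- by move=> e; have := lex_big (gx k) si ji; rewrite e ltnn.
- by move=> e; have := lex_big (gx i) sk jk; rewrite e ltnn.
- move=> /addnI e; apply: grid_inj => //.
  by move: bi bk; rewrite /is_white /white_at; lia.
Qed.

Section GoodPermutation.
Variable sg : 'S_grid_size.
Hypothesis sg_good : good sg.

Definition goes_right i : bool := is_black i && (gx (sg i) == gx i).

Let A i k : bool := (gx k == gx i) && (gy i < gy k)%N.
Let B i k : bool := (gx (sg k) == gx (sg i)) && (gy (sg k) < gy (sg i))%N.

Lemma good_black i : is_black i ->
  is_white (sg i) /\ edge_at (gx i) (gy i) (gx (sg i)) (gy (sg i)).
Proof. by move=> bi; have := forallP sg_good i; rewrite /good_entry bi =>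
    /andP. Qed.

Lemma good_aux i : ~~ is_black i -> gx (sg i) = (n + gx i)%N /\ gy (sg i) = n.
Proof.
by move=> /negPf bi; have := forallP sg_good i; rewrite /good_entry bi =>
    /andP[/eqP ? /eqP].
Qed.

Lemma is_white_good i : is_white (sg i) = is_black i.
Proof.
have [bi|bi] := boolP (is_black i); first by case: (good_black bi).
by have [e1 e2] := good_aux bi; rewrite /is_white /white_at e1 e2; lia.
Qed.

(** An edge moves the column by at most one to the left and the height by at most
    one.  Hence [(i, k)] is inverted exactly when [i] goes right, [k] goes left,
    and either [k] starts above [i] in the same column, or it ends below the
    image of [i] in the same column.  The product with
    [goes_right sg i && is_black k] minus the one with
    [goes_right sg i && goes_right sg k] expresses that [k] goes left. *)
Lemma inversion_pair i k :
  (((rowkey i < rowkey k) && (colkey (sg k) < colkey (sg i)) : nat) +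
    (goes_right i && goes_right k) * (A i k + B i k) =
   (goes_right i && is_black k) * (A i k + B i k))%N.
Proof.
have [si sk ji jk] := And4 (gx_le i) (gx_le k) (gy_le i) (gy_le k).
have [si' sk' ji' jk'] := And4 (gx_le (sg i)) (gx_le (sg k)) (gy_le (sg i))
    (gy_le (sg k)).
have wi := is_white_good i; have wk := is_white_good k.
rewrite /rowkey /colkey /goes_right wi wk.
have [bi|bi] := boolP (is_black i); have [bk|bk] := boolP (is_black k) =>
    /=; last 3 first.
- rewrite [X in _ && X](_ : _ = false) ?andbF//.
  by apply/negbTE; rewrite -leqNgt ltnW// lex_big.
- rewrite [X in X && _](_ : _ = false)//.
  by apply/negbTE; rewrite -leqNgt ltnW// lex_big.
- have [e1 _] := good_aux bi; have [e3 _] := good_aux bk.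
  by rewrite e1 e3; lia.
rewrite !lex_lt// /A /B.
have [->|ik] := eqVneq i k; first by rewrite !ltnn !eqxx /= ?ltnn; lia.
have ne1 : ~ (gx i = gx k /\ gy i = gy k) by move=> [e1 e2]; case/eqP: ik;
    exact: grid_inj.
have ne2 : ~ (gx (sg i) = gx (sg k) /\ gy (sg i) = gy (sg k)).
  by move=> [e1 e2]; case/eqP: ik; apply: (@perm_inj _ sg); exact: grid_inj.
have [_ ei] := good_black bi; have [_ ek] := good_black bk.
move: (gx i) (gx k) (gy i) (gy k) (gx (sg i)) (gx (sg k)) (gy (sg i)) (gy (sg k))
  ei ek ne1 ne2 => s1 s2 j1 j2 t1 t2 h1 h2.
rewrite /edge_at => /orP[/andP[/eqP e1 h1E]|/andP[/eqP e1 h1E]]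
  /orP[/andP[/eqP e2 h2E]|/andP[/eqP e2 h2E]] ne1 ne2.
- by rewrite e1 e2 !eqxx /= addnC; congr addn; lia.
- rewrite e1 -e2 !eqxx (_ : (t2 == t2.+1) = false) /= ?mul0n ?addn0 ?mul1n; lia.
- by rewrite -e1 e2 (_ : (t1 == t1.+1) = false) /= ?mul0n ?addn0; lia.
- by rewrite -e1 -e2 (_ : (t1 == t1.+1) = false) /= ?mul0n ?addn0; lia.
Qed.

End GoodPermutation.

End GridParity.

Section GoodParity.
Variables n m : nat.
Notation T := (2 * m + n)%N.
Variable sg : 'S_(grid_size n m).
Hypothesis sg_good : good sg.

Definition goes_down (i : 'I_(grid_size n m)) : bool :=
    goes_right sg i && (gy (sg i) != gy i).
Definition goes_left (i : 'I_(grid_size n m)) : bool :=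
    is_black i && ~~ goes_right sg i.

Let A (i k : 'I_(grid_size n m)) : bool := (gx k == gx i) && (gy i < gy k)%N.
Let B (i k : 'I_(grid_size n m)) : bool :=
    (gx (sg k) == gx (sg i)) && (gy (sg k) < gy (sg i))%N.

Lemma goes_right_edge i : goes_right sg i ->
  gx (sg i) = gx i /\ (gy (sg i) = gy i \/ (gy (sg i)).+1 = gy i).
Proof.
move=> /andP[bi /eqP e]; split=> //.
have [_] := good_black sg_good bi; rewrite /edge_at e.
by move=> /orP[/andP[_ /orP[/eqP|/eqP]]|/andP[/eqP]]; [left|right|lia].
Qed.

(** Two vertices going right in the same column keep their order.  So the pairs
    of such vertices, which cause no inversion, are counted an even number of
    times. *)
Lemma goes_right_pair_sym i k :
  ((goes_right sg i && goes_right sg k) * B i k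
      = (goes_right sg k && goes_right sg i) * A k i)%N.
Proof.
rewrite [goes_right sg k && _]andbC;
    case: (boolP (goes_right sg i && goes_right sg k)) => // /andP[ri rk].
have [ei hi] := goes_right_edge ri; have [ek hk] := goes_right_edge rk.
rewrite !mul1n /A /B ei ek eq_sym; case: eqP => //= e.
have [->|ik] := eqVneq i k; first by rewrite !ltnn.
have ne1 : ~ (gy i = gy k) by move=> e1; case/eqP: ik; exact: grid_inj.
have ne2 : ~ (gy (sg i) = gy (sg k)).
  by move=> e1; case/eqP: ik; apply: (@perm_inj _ sg); apply: grid_inj;
      rewrite // ei ek.
congr (nat_of_bool _); apply/idP/idP; lia.
Qed.

Lemma inversions_good :
  (inversions (@rowkey n m) (@colkey n m \o sg) + 2 *
    \sum_i \sum_k ((goes_right sg i && goes_right sg k) * A i k) =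
   \sum_i (goes_right sg i * ((n - gy i) + gy (sg i))))%N.
Proof.
have -> : (2 * \sum_i \sum_k ((goes_right sg i && goes_right sg k) * A i k) =
   \sum_i \sum_k ((goes_right sg i && goes_right sg k) * (A i k + B i k)))%N.
  rewrite mul2n -addnn {2}exchange_big -big_split /=; apply: eq_bigr => i _.
  rewrite -big_split /=; apply: eq_bigr => k _.
  by rewrite mulnDr goes_right_pair_sym.
rewrite /inversions -big_split /=; apply: eq_bigr => i _.
rewrite -big_split /= (eq_bigr _ (fun k _ => inversion_pair sg_good i k)).
have eA : (\sum_k A i k = n - gy i)%N by exact: count_above (gx_le i) (gy_le i).
have eB : (\sum_k B i k = gy (sg i))%N.
  rewrite -[RHS](count_below (gx_le (sg i)) (gy_le (sg i))).
  by rewrite [RHS](reindex_inj (@perm_inj _ sg)).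
transitivity (goes_right sg i * (\sum_k A i k + \sum_k B i k))%N;
    last by rewrite eA eB.
rewrite -big_split big_distrr /=.
apply: eq_bigr => k _; case: (goes_right sg i) => //=.
have hA : A i k -> is_black k by move=> /andP[_ ik];
    rewrite /is_black /black_at (leq_ltn_trans _ ik).
have hB : B i k -> is_black k.
  move=> /andP[_ ik]; rewrite -(is_white_good sg_good k) /is_white /white_at.
  by rewrite (leq_trans ik (gy_le _)).
rewrite -/(A i k) -/(B i k) [RHS]mul1n.
have [bk|bk] := boolP (is_black k); first by rewrite mul1n.
by rewrite (negPf (contra hA bk)) (negPf (contra hB bk)).
Qed.

(** The sum of the columns of all images is fixed, and each vertex going left
    lowers it by one; so the number of vertices going right is the same for all
    coverings. *)
Lemma right_count :
  (\sum_i goes_right sg i + \sum_(i < grid_size n m) is_black i * gx i =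
   \sum_(i < grid_size n m) is_white i * gx i + \sum_(i < grid_size n m)
       is_black i)%N.
Proof.
rewrite [X in _ = (X + _)%N](reindex_inj (@perm_inj _ sg)) /= -!big_split /=.
apply: eq_bigr => i _; rewrite (is_white_good sg_good) /goes_right.
have [bi|//] := boolP (is_black i).
rewrite !mul1n /=; have [_] := good_black sg_good bi; rewrite /edge_at.
by case: eqP => [->|_] /=; [rewrite addnC|move=> /andP[/eqP <- _]; rewrite addn1].
Qed.

(** A vertex [i] going right contributes [n - gy i] vertices above it and
    [gy (sg i)] below its image; together these are [n], or [n - 1] if [i] goes
    down. *)
Lemma inversions_down :
  (inversions (@rowkey n m) (@colkey n m \o sg) +
     2 * \sum_i \sum_k ((goes_right sg i && goes_right sg k) * A i k)
         + \sum_i goes_down i =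
   n * \sum_i goes_right sg i)%N.
Proof.
rewrite inversions_good -big_split big_distrr /=; apply: eq_bigr => i _.
rewrite /goes_down; have [ri|] := boolP (goes_right sg i); last by rewrite muln0.
have [_ h] := goes_right_edge ri; rewrite mul1n muln1 /=.
by have := gy_le i; case: eqP => /=; lia.
Qed.

Lemma left_count : (\sum_i goes_left i + \sum_i goes_right sg i
    = \sum_(i < grid_size n m) is_black i)%N.
Proof.
rewrite -big_split /=; apply: eq_bigr => i _; rewrite /goes_left.
by case: (boolP (is_black i)); rewrite /goes_right; case: (is_black i) =>
    //=; case: (_ == _).
Qed.

End GoodParity.

(** The sign of the permutation is, up to a constant, that of the down edges to
    the right; since the number of vertices going left is constant, it may be
    completed to the product of the signs of the Kasteleyn entries. *)
Lemma good_sign (n m : nat) : exists c : bool, forall sg : 'S_(grid_size n m),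
    good sg ->
  odd_perm sg = c (+) odd (\sum_i goes_down sg i + \sum_i goes_left sg i)%N.
Proof.
have [c cE] := odd_perm_inversions (@rowkey_inj n m) (@colkey_inj n m).
pose Bs := (\sum_(i < grid_size n m) is_black i * gx i)%N.
pose Ws := (\sum_(i < grid_size n m) is_white i * gx i)%N.
pose Bc := (\sum_(i < grid_size n m) is_black i)%N.
(* [r0] is the number of vertices going right, the same for all coverings. *)
pose r0 := (Ws + Bc - Bs)%N.
exists (c (+) odd (n * r0 + (Bc - r0))) => sg gsg; rewrite cE.
have rc := right_count gsg; have lc := left_count sg; have ic :=
    inversions_down gsg.
have rE : (\sum_i goes_right sg i)%N = r0 by rewrite /r0 -rc addnK.
rewrite rE in lc ic.
have lE : (\sum_i goes_left sg i)%N = (Bc - r0)%N by rewrite /Bc -lc addnK.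
rewrite lE -ic mul2n !oddD odd_double /=.
by case: (odd _); case: (odd _); case: (odd _); case: c {cE}.
Qed.

(** * Coverings as permutations *)

Section CoveringsAsPermutations.
Local Close Scope classical_set_scope.
Variables n m : nat.
Notation T := (2 * m + n)%N.
Notation I := 'I_(grid_size n m).
Implicit Types (i k : I).

Definition bvertex i : vertex n m := (inord (2 * gx i), inord (2 * gy i)).
Definition wvertex i : vertex n m := (inord (2 * gx i).+1, inord (2 * gy i).+1).

Lemma pos_bvertex i : pos (bvertex i) = (2 * (gx i)%:Z, 2 * (gy i)%:Z - 1).
Proof.
rewrite /pos /bvertex /= !inordK; have := gx_le i; have := gy_le i; [|lia..].
by move=> _ _; rewrite !PoszM.
Qed.

Lemma pos_wvertex i : pos (wvertex i) = (2 * (gx i)%:Z + 1, 2 * (gy i)%:Z).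
Proof.
rewrite /pos /wvertex /= !inordK; have := gx_le i; have := gy_le i; [|lia..].
by move=> _ _; congr (_, _); lia.
Qed.

Lemma pos_inj (u v : vertex n m) : pos u = pos v -> u = v.
Proof.
move: u v => [u1 u2] [v1 v2] [/= e1 e2]; congr (_, _); apply: val_inj => //=.
by move: e2; lia.
Qed.

Lemma bvertex_inj : injective bvertex.
Proof.
by move=> i k /(congr1 (@pos n m)); rewrite !pos_bvertex => -[e1 e2];
    apply: grid_inj; lia.
Qed.

Lemma wvertex_inj : injective wvertex.
Proof.
by move=> i k /(congr1 (@pos n m)); rewrite !pos_wvertex => -[e1 e2];
    apply: grid_inj; lia.
Qed.

Lemma black_bvertex i : black (bvertex i) = is_black i.
Proof.
have := gx_le i; have := gy_le i; rewrite /black /is_black /black_at /xi /eta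
    pos_bvertex /=.
by move: (gx i) (gy i) => s j; lia.
Qed.

Lemma white_wvertex i : (0 < n)%N -> white (wvertex i) = is_white i.
Proof.
have := gx_le i; have := gy_le i; rewrite /white /is_white /white_at /xi /eta
    pos_wvertex /=.
by move: (gx i) (gy i) => s j; lia.
Qed.

Lemma blackP (v : vertex n m) : black v -> exists2 i, is_black i & v = bvertex i.
Proof.
move=> bv; have := bv; rewrite /black /xi /eta => h.
pose s := `|(pos v).1 %/ 2|%Z%N; pose j := `|((pos v).2 + 1) %/ 2|%Z%N.
have sT : (s <= T)%N by rewrite /s; move: h; move: (pos v) => [p q] /=; lia.
have jn : (j <= n)%N by rewrite /j; move: h; move: (pos v) => [p q] /=; lia.
have e : v = bvertex (grid_index n m s j).
  apply: pos_inj; rewrite pos_bvertex gx_index// gy_index// /s /j.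
  by move: h; move: (pos v) => [p q] /= h; congr (_, _); lia.
by exists (grid_index n m s j) => //; rewrite -black_bvertex -e.
Qed.

Lemma whiteP (v : vertex n m) : (0 < n)%N -> white v -> exists2 i,
    is_white i & v = wvertex i.
Proof.
move=> n0 wv; have := wv; rewrite /white /xi /eta => h.
pose s := `|((pos v).1 - 1) %/ 2|%Z%N; pose j := `|(pos v).2 %/ 2|%Z%N.
have sT : (s <= T)%N by rewrite /s; move: h; move: (pos v) => [p q] /=; lia.
have jn : (j <= n)%N by rewrite /j; move: h; move: (pos v) => [p q] /=; lia.
have e : v = wvertex (grid_index n m s j).
  apply: pos_inj; rewrite pos_wvertex gx_index// gy_index// /s /j.
  by move: h; move: (pos v) => [p q] /= h; congr (_, _); lia.
by exists (grid_index n m s j) => //; rewrite -white_wvertex// -e.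
Qed.

Definition grid_edge i k : bool := edge_at (gx i) (gy i) (gx k) (gy k).
Definition is_vertical i k : bool :=
  if gx k == gx i then gy k != gy i else gy k == gy i.

Lemma is_edgeE i k : (0 < n)%N ->
  is_edge (bvertex i, wvertex k) = [&& is_black i, is_white k & grid_edge i k].
Proof.
move=> n0; rewrite /is_edge /= black_bvertex white_wvertex//; congr [&& _, _ & _].
rewrite /horizontal /vertical /= pos_bvertex pos_wvertex /grid_edge /edge_at.
move: (gx i) (gy i) (gx k) (gy k) => s j s' j'.
apply/idP/idP.
  by move=> /orP[/orP[]|/orP[]] /eqP[]; lia.
by move=> /orP[/andP[/eqP e /orP[]/eqP e']|/andP[/eqP e /orP[]/eqP e']];
  rewrite -!pair_eqE /=; lia.
Qed.

Lemma verticalE i k : grid_edge i k -> vertical (bvertex i, wvertex k)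
    = is_vertical i k.
Proof.
rewrite /vertical /= pos_bvertex pos_wvertex /grid_edge /edge_at /is_vertical.
move: (gx i) (gy i) (gx k) (gy k) => s j s' j'.
move=> /orP[/andP[/eqP -> h]|/andP[/eqP <- h]].
  by rewrite eqxx; move: h => /orP[]/eqP e'; rewrite -!pair_eqE /=; lia.
rewrite (_ : (s' == s'.+1) = false); last by lia.
by move: h => /orP[]/eqP e'; rewrite -!pair_eqE /=; lia.
Qed.

Lemma right_edgeE i k : grid_edge i k ->
  (pos (wvertex k) == pos (bvertex i) + e1)
      || (pos (wvertex k) == pos (bvertex i) - e2) = (gx k == gx i).
Proof.
rewrite pos_bvertex pos_wvertex /grid_edge /edge_at.
move: (gx i) (gy i) (gx k) (gy k) => s j s' j'.
by move=> /orP[/andP[/eqP e /orP[]/eqP e']|/andP[/eqP e /orP[]/eqP e']];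
  rewrite -!pair_eqE /=; lia.
Qed.

Definition covering (sg : 'S_(grid_size n m)) : {set edge n m} :=
  [set (bvertex i, wvertex (sg i)) | i in [set i | is_black i]].

Lemma coveringP sg e : e \in covering sg -> exists2 i,
    is_black i & e = (bvertex i, wvertex (sg i)).
Proof. by move=> h; case: (elimT imsetP h) => i; rewrite inE =>
    bi ->; exists i. Qed.

Lemma mem_covering sg i k : ((bvertex i, wvertex k) \in covering sg)
    = is_black i && (sg i == k).
Proof.
apply/imsetP/andP => [[i']|[bi /eqP <-]].
  rewrite inE => bi' /eqP; rewrite xpair_eqE (inj_eq bvertex_inj)
      (inj_eq wvertex_inj).
  by move=> /andP[/eqP -> /eqP ->].
by exists i; rewrite ?inE.
Qed.

Lemma covering_inj : {in [set sg | good sg] &, injective covering}.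
Proof.
move=> s1 s2; rewrite !inE => g1 g2 e; apply/permP => i.
have [bi|bi] := boolP (is_black i).
  have : (bvertex i, wvertex (s1 i)) \in covering s2 by rewrite -e mem_covering
      bi eqxx.
  by rewrite mem_covering bi => /eqP.
have [e1 e3] := good_aux g1 bi; have [e2' e4] := good_aux g2 bi.
by apply: grid_inj; rewrite ?e1 ?e3.
Qed.

Hypothesis n_gt0 : (0 < n)%N.

Lemma dimer_covering_covering sg : good sg -> dimer_covering (covering sg).
Proof.
move=> gsg; apply/and3P; split.
- apply/forall_inP => e /coveringP[i bi ->].
  by rewrite is_edgeE// bi /grid_edge; have [-> ->] := good_black gsg bi.
- apply/forallP => b; apply/implyP => /blackP[i bi ->].
  apply/cards1P; exists (bvertex i, wvertex (sg i)); apply/setP => e; rewrite !inE.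
  apply/andP/eqP => [[/coveringP[i' _ ->] /= /eqP/bvertex_inj ->]|->] //=.
  by rewrite mem_covering bi !eqxx.
- apply/forallP => w; apply/implyP => /whiteP[//|k wk ->].
  have bi : is_black (sg^-1 k)%g by rewrite -(is_white_good gsg) permKV.
  apply/cards1P; exists (bvertex (sg^-1 k)%g, wvertex k); apply/setP =>
      e; rewrite !inE.
  apply/andP/eqP => [[/coveringP[i' _ ->] /= /eqP/wvertex_inj <-]|->] /=.
    by rewrite permK.
  by rewrite mem_covering bi permKV !eqxx.
Qed.

(** The permutation sends a black vertex to its partner, and a point of the grid
    that is not a black vertex to the corresponding point that is not a white
    one. *)
Lemma covering_surj (S : {set edge n m}) : (2 * m < n)%N -> dimer_covering S ->
  exists2 sg, good sg & S = covering sg.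
Proof.
move=> mn /and3P[/forall_inP Sedge /forallP Sb /forallP Sw].
have uniqb i k k' : (bvertex i, wvertex k) \in S -> (bvertex i, wvertex k') \in
    S -> k = k'.
  move=> h h'; have := Sedge _ h; rewrite is_edgeE// => /and3P[bi _ _].
  have := Sb (bvertex i); rewrite black_bvertex bi => /cards1P[e Se].
  have : (bvertex i, wvertex k) \in [set e0 in S | e0.1 == bvertex i] by rewrite
      inE h /= eqxx.
  have : (bvertex i, wvertex k') \in [set e0 in S | e0.1 == bvertex i] by
      rewrite inE h' /= eqxx.
  by rewrite Se !inE => /eqP <-; rewrite xpair_eqE (inj_eq wvertex_inj) =>
      /andP[_ /eqP].
have uniqw i i' k : (bvertex i, wvertex k) \in S -> (bvertex i', wvertex k) \in
    S -> i = i'.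
  move=> h h'; have := Sedge _ h; rewrite is_edgeE// => /and3P[_ wk _].
  have := Sw (wvertex k); rewrite white_wvertex// wk => /cards1P[e Se].
  have : (bvertex i, wvertex k) \in [set e0 in S | e0.2 == wvertex k] by rewrite
      inE h /= eqxx.
  have : (bvertex i', wvertex k) \in [set e0 in S | e0.2 == wvertex k] by
      rewrite inE h' /= eqxx.
  by rewrite Se !inE => /eqP <-; rewrite xpair_eqE (inj_eq bvertex_inj) =>
      /andP[/eqP].
pose f i := if is_black i then odflt i [pick k | (bvertex i, wvertex k) \in S]
            else grid_index n m (n + gx i) n.
have fb i : is_black i -> (bvertex i, wvertex (f i)) \in S.
  move=> bi; rewrite /f bi; case: pickP => [//|none].
  have := Sb (bvertex i); rewrite black_bvertex bi => /cards1P[[b w] Se].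
  have : (b, w) \in [set e0 in S | e0.1 == bvertex i] by rewrite Se inE.
  rewrite inE => /andP[eS /= /eqP beta_b]; move: (eS); rewrite beta_b => eS'.
  have /and3P[_ /= ww _] := Sedge _ eS'.
  have [k _ wE] := whiteP n_gt0 ww.
  by have := none k; rewrite -wE eS'.
have fa i : ~~ is_black i -> gx (f i) = (n + gx i)%N /\ gy (f i) = n.
  move=> bi; rewrite /f (negPf bi); split; last by rewrite gy_index.
  by rewrite gx_index//; have := gx_le i; move: bi; rewrite /is_black /black_at;
      lia.
have fw i : is_white (f i) = is_black i.
  have [bi|bi] := boolP (is_black i).
    by have /and3P[_ + _] := Sedge _ (fb i bi); rewrite /= white_wvertex.
  by have [e1 e2'] := fa i bi; rewrite /is_white /white_at e1 e2'; lia.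
have fI : injective f.
  move=> i i' e; have := fw i; rewrite e fw => bb.
  have [bi|bi] := boolP (is_black i).
    have h := fb i bi; rewrite e in h.
    by apply: (uniqw _ _ _ h); apply: fb; rewrite bb.
  have bi' : ~~ is_black i' by rewrite bb.
  have [e1 _] := fa i bi; have [e3 _] := fa i' bi'; rewrite e e3 in e1.
  apply: grid_inj; first by lia.
  by move: bi bi'; rewrite /is_black /black_at; lia.
exists (perm fI).
  apply/forallP => i; rewrite /good_entry permE fw.
  have [bi|bi] := boolP (is_black i); last by have [-> ->] := fa i bi;
      rewrite !eqxx.
  by have := Sedge _ (fb i bi); rewrite is_edgeE// => /and3P[].
apply/setP => -[b w]; apply/idP/idP => [h|].
  have /and3P[/= bb ww _] := Sedge _ h.
  have [i bi bE] := blackP bb; have [k wk wE] := whiteP n_gt0 ww.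
  rewrite bE wE mem_covering bi permE; apply/eqP.
  by apply: (uniqb i); [exact: fb|rewrite -bE -wE].
by move=> /coveringP[i bi ->]; rewrite permE; exact: fb.
Qed.

Lemma sum_coverings (V : nmodType) (F : {set edge n m} -> V)
    (P : pred {set edge n m}) :
  (2 * m < n)%N ->
  \sum_(S | dimer_covering S && P S) F S =
  \sum_(sg | good sg && P (covering sg)) F (covering sg).
Proof.
move=> mn; rewrite big_mkcondr [RHS]big_mkcondr /=.
transitivity (\sum_(S in covering @: [set sg | good sg]) (if P S then F S else 0)).
  apply: eq_bigl => S; apply/idP/idP => [/(covering_surj mn)[sg gsg ->]|].
    by apply: imset_f; rewrite inE.
  by move=> h; case: (elimT imsetP h) => sg; rewrite inE => gsg ->;
      exact: dimer_covering_covering.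
rewrite big_imset /=; last exact: covering_inj.
by apply: eq_bigl => sg; rewrite inE.
Qed.

Lemma Lparticle_covering sg i : good sg -> is_black i ->
  Lparticle (covering sg) (bvertex i) = goes_right sg i.
Proof.
move=> gsg bi; rewrite /goes_right bi; have [_ ei] := good_black gsg bi.
rewrite -(right_edgeE ei); apply/exists_inP/idP => [[e /coveringP[i' _ ->] /=]|h].
  by rewrite (inj_eq bvertex_inj) => /andP[/eqP -> ].
by exists (bvertex i, wvertex (sg i)); rewrite ?mem_covering ?bi ?eqxx.
Qed.

Lemma weight_covering (R : realType) (a : R) sg : good sg ->
  weight a (covering sg) = \prod_(i | is_black i)
      (if is_vertical i (sg i) then a else 1).
Proof.
move=> gsg; rewrite /weight.
have -> : a ^+ #|[set e in covering sg | vertical e]| =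
    \prod_(e in covering sg) (if vertical e then a else 1).
  rewrite -big_mkcondr /= -prodr_const; apply: eq_bigl => e; by rewrite inE.
rewrite big_imset /=; last first.
  move=> i i' _ _ /eqP; rewrite xpair_eqE (inj_eq bvertex_inj).
  by move=> /andP[/eqP].
rewrite (eq_bigl (fun i => is_black i)); last by move=> i; rewrite inE.
apply: eq_bigr => i bi; rewrite verticalE//.
by have [] := good_black gsg bi.
Qed.

End CoveringsAsPermutations.

(** * The Kasteleyn determinant *)

Section KasteleynDeterminant.
Local Close Scope classical_set_scope.
Variables (R : realType) (a : R) (n m : nat).
Notation C := R[i].
Notation ac := (a%:C).
Notation T := (2 * m + n)%N.
Notation I := 'I_(grid_size n m).
Implicit Types (i k : I) (mark : I -> bool -> C).

Definition kast_coef (s j s' j' : nat) : C :=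
  if s' == s then (if j' == j then 1 else if j'.+1 == j then - ac else 0)
  else if s'.+1 == s then (if j'.+1 == j then -1 else if j' == j then - ac else 0)
  else 0.

Definition kast_entry i k : C :=
  if is_black i then (if is_white k then kast_coef (gx i) (gy i) (gx k) (gy k)
      else 0)
  else ((gx k == n + gx i)%N && (gy k == n))%:R.

(** [mark] weighs the right and left edges at each black vertex; the constant
    [1] gives the Kasteleyn matrix itself. *)
Definition kast_mx mark : 'M[C]_(grid_size n m) :=
  \matrix_(i, k) (kast_entry i k
      * (if is_black i then mark i (gx k == gx i) else 1)).

Lemma kast_entry_bad i k : ~~ good_entry i k -> kast_entry i k = 0.
Proof.
rewrite /good_entry /kast_entry; case: (is_black i); last by move=> /negPf ->.
case: (is_white k) => //=; rewrite /edge_at /kast_coef.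
move: (gx i) (gy i) (gx k) (gy k) => s j s' j'.
have [->|_] := eqVneq s' s.
  by rewrite /= negb_or negb_or -andbA => /andP[/negPf -> /andP[/negPf -> _]].
by case: (s'.+1 == s) => //=; rewrite negb_or => /andP[/negPf -> /negPf ->].
Qed.

Lemma kast_entry_good (sg : 'S_(grid_size n m)) i : good sg ->
  kast_entry i (sg i) = (-1) ^+ (goes_down sg i + goes_left sg i) *
    (if is_black i then if is_vertical i (sg i) then ac else 1 else 1).
Proof.
move=> gsg; rewrite /kast_entry /goes_down /goes_left /goes_right.
have [bi|bi] := boolP (is_black i); last first.
  by have [-> ->] := good_aux gsg bi; rewrite !eqxx mulr1.
have [-> ei] := good_black gsg bi; move: ei;
    rewrite /edge_at /is_vertical /kast_coef /=.
move: (gx i) (gy i) (gx (sg i)) (gy (sg i)) => s j s' j'.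
have [->|ss] := eqVneq s' s => /=.
  move=> /orP[/orP[|]|]; last by lia.
    by move=> ->; rewrite mulr1.
  by move=> e; rewrite e (_ : (j' == j) = false) /= ?mulN1r//; lia.
move=> /andP[-> /orP[] e]; rewrite e /=.
  by rewrite (_ : (j' == j) = false) ?mulr1//; lia.
by rewrite (_ : (j'.+1 == j) = false) ?mulN1r//; lia.
Qed.

Definition marked_weight mark (sg : 'S_(grid_size n m)) : C :=
  \prod_(i | is_black i) ((if is_vertical i (sg i) then ac else 1)
      * mark i (goes_right sg i)).

Lemma det_kast_mx : exists c : bool, forall mark,
  \det (kast_mx mark) = (-1) ^+ c * \sum_(sg | good sg) marked_weight mark sg.
Proof.
have [c cE] := good_sign n m; exists c => mark.
rewrite /determinant mulr_sumr [RHS]big_mkcond /=; apply: eq_bigr => sg _.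
case: ifP => [gsg|/negbT]; last first.
  rewrite negb_forall => /existsP[i bad].
  by rewrite (bigD1 i) //= mxE kast_entry_bad// !mul0r mulr0.
rewrite (eq_bigr (fun i => (-1) ^+ (goes_down sg i + goes_left sg i) *
    (if is_black i then (if is_vertical i (sg i) then ac else 1)
        * mark i (goes_right sg i) else 1))); last first.
  move=> i _; rewrite mxE kast_entry_good// -mulrA; congr (_ * _).
  by rewrite /goes_right; case: (is_black i); rewrite ?mulr1.
rewrite big_split /= -big_mkcond /= -/(marked_weight mark sg) mulrA; congr (_ * _).
rewrite cE// -expr_sum big_split /= -[X in _ * X]signr_odd -signr_addb.
by rewrite -addbA addbb addbF.
Qed.

Hypothesis m_lt : (2 * m < n)%N.

(** A covering: in every column the black vertices from the threshold on go
    right, the others go left.  The threshold is chosen so that the vertices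
    going right and those coming from the next column fill each white column. *)
Definition threshold (s : nat) : nat :=
  if (s <= 2 * m)%N then s.+1 else if (s <= n)%N then (2 * m).+1
  else (T.+1 - s)%N.

Definition frozen (s j : nat) : nat * nat :=
  if black_at m s j then
    if (threshold s <= j)%N then
      if (s < n)%N then (s, j) else (s, j.-1)
    else if (s <= 2 * m)%N then (s.-1, j.-1) else (s.-1, j)
  else ((n + s)%N, n).

Lemma frozen_le s j : (s <= T)%N -> (j <= n)%N ->
  ((frozen s j).1 <= T)%N /\ ((frozen s j).2 <= n)%N.
Proof.
rewrite /frozen /threshold /black_at => sT jn.
by repeat case: ifP => /=; move=> *; split; lia.
Qed.

Lemma frozen_inj s j t h : (s <= T)%N -> (j <= n)%N -> (t <= T)%N -> (h <= n)%N ->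
  frozen s j = frozen t h -> s = t /\ j = h.
Proof.
rewrite /frozen /threshold /black_at => sT jn tT hn.
repeat (case: ifP => /=); intros;
  match goal with H : (_, _) = (_, _) |- _ => injection H; clear H; intros end;
  split; lia.
Qed.

Lemma frozen_edge s j : (s <= T)%N -> (j <= n)%N -> black_at m s j ->
  white_at n (frozen s j).1 (frozen s j).2 && edge_at s j (frozen s j).1
      (frozen s j).2.
Proof.
move=> sT jn b; rewrite /frozen b; move: b.
rewrite /threshold /black_at /white_at /edge_at => b.
by repeat case: ifP => /=; move=> *; lia.
Qed.

Definition frozen_idx i : I :=
  grid_index n m (frozen (gx i) (gy i)).1 (frozen (gx i) (gy i)).2.

Lemma frozen_idx_inj : injective frozen_idx.
Proof.
move=> i k e.
have [si sk ji jk] := And4 (gx_le i) (gx_le k) (gy_le i) (gy_le k).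
have [a1 a2] := frozen_le si ji; have [a3 a4] := frozen_le sk jk.
have e1 := congr1 (@gx n m) e; have e2 := congr1 (@gy n m) e.
rewrite /frozen_idx !gx_index// in e1; rewrite /frozen_idx !gy_index// in e2.
have [] := frozen_inj si ji sk jk; last exact: grid_inj.
by rewrite [LHS]surjective_pairing [RHS]surjective_pairing e1 e2.
Qed.

Lemma good_frozen : good (perm frozen_idx_inj).
Proof.
apply/forallP => i; rewrite permE /good_entry /frozen_idx /is_white.
have [si ji] := (gx_le i, gy_le i).
have [a1 a2] := frozen_le si ji.
rewrite gx_index// gy_index//.
case: ifP => bi; first exact: frozen_edge.
by rewrite /frozen; move: bi; rewrite /is_black => -> /=; rewrite !eqxx.
Qed.

Hypothesis a_gt0 : 0 < a.

Lemma det_kast_mx_neq0 : \det (kast_mx (fun _ _ => 1)) != 0.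
Proof.
have [c ->] := det_kast_mx; rewrite mulf_eq0 signr_eq0 /=.
have pos sg : 0 < marked_weight (fun _ _ => 1) sg.
  apply: prodr_gt0 => i _; rewrite mulr1.
  by case: ifP => _; rewrite ?ltr01// ltcR.
rewrite gt_eqF//.
rewrite (bigD1 (perm frozen_idx_inj)) ?good_frozen//=.
by rewrite ltr_pwDl// ?sumr_ge0// => sg _; exact: ltW.
Qed.

Notation K1 := (kast_mx (fun _ _ => 1)).

Lemma kast_mx_act mark (x : nat -> nat -> C) i : is_black i ->
  (kast_mx mark *m \col_k (if is_white k then x (gx k) (gy k) else 0)) i 0 =
  mark i true * kastR a n x (gx i) (gy i) - mark i false * kastL a n x (gx i)
      (gy i).
Proof.
move=> bi; rewrite mxE.
pose xx s j : C := if white_at n s j then x s j else 0.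
have E k : kast_mx mark i k
    * (\col_k0 (if is_white k0 then x (gx k0) (gy k0) else 0)) k 0 =
  (if k == grid_index n m (gx i) (gy i) then mark i true * xx (gx i) (gy i) else
      0) +
  (if (0 < gy i)%N && (k == grid_index n m (gx i) (gy i).-1) then
      - ac * (mark i true * xx (gx i) (gy i).-1) else 0) +
  ((if (0 < gx i)%N && (0 < gy i)%N && (k == grid_index n m (gx i).-1 (gy i).-1)
      then
      - (mark i false * xx (gx i).-1 (gy i).-1) else 0) +
  (if (0 < gx i)%N && (k == grid_index n m (gx i).-1 (gy i)) then
      - ac * (mark i false * xx (gx i).-1 (gy i)) else 0)).
  have [si ji sk jk] := And4 (gx_le i) (gy_le i) (gx_le k) (gy_le k).
  have idxE s j : (s <= T)%N -> (j <= n)%N -> (k == grid_index n m s j)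
      = (gx k == s) && (gy k == j).
    move=> sT jn; apply/eqP/andP => [->|[/eqP e1 /eqP e2]].
      by rewrite gx_index// gy_index.
    by apply: grid_inj; rewrite ?gx_index ?gy_index.
  rewrite !mxE /kast_entry bi !idxE//; try lia.
  rewrite /xx /is_white /kast_coef /=; move: sk jk si ji.
  move: (mark i) => r.
  move: (gx i) (gy i) (gx k) (gy k) => s j s' j' sk jk si ji.
  rewrite (_ : (0 < j)%N && _ = (s' == s) && (j'.+1 == j)); last by lia.
  rewrite (_ : (0 < s)%N && (0 < j)%N && _ = (s'.+1 == s) && (j'.+1 == j));
      last by lia.
  rewrite (_ : (0 < s)%N && _ = (s'.+1 == s) && (j' == j)); last by lia.
  have [->|ss] := eqVneq s' s => /=.
    rewrite (_ : (s.+1 == s) = false) /= ?addr0; last by lia.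
    have [->|jj] := eqVneq j' j => /=.
      rewrite (_ : (j.+1 == j) = false) /= ?addr0; last by lia.
      by case: white_at; rewrite ?mulr0// !mul1r.
    rewrite add0r; have [<-|jj'] := eqVneq j'.+1 j => /=.
      by case: white_at; rewrite ?mulr0// mulrA.
    by case: white_at; rewrite !mul0r.
  rewrite !add0r; have [<-|ss'] := eqVneq s'.+1 s => /=; last first.
    by case: white_at; rewrite !mul0r addr0.
  have [<-|jj] := eqVneq j'.+1 j => /=.
    rewrite (_ : (j' == j'.+1) = false) /= ?addr0; last by lia.
    by case: white_at; rewrite ?mulr0 ?oppr0// mulN1r mulNr.
  rewrite add0r; have [->|jj'] := eqVneq j' j => /=.
    by case: white_at; rewrite ?mulr0// mulrA.
  by case: white_at; rewrite !mul0r.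
have S1 (b : bool) g (c : C) : \sum_(k < grid_size n m)
    (if b && (k == g) then c else 0) = if b then c else 0.
  case: b => /=; last by rewrite big1.
  by rewrite -big_mkcond big_pred1_eq.
rewrite (eq_bigr _ (fun k _ => E k)) !big_split /= !S1.
have := S1 true; rewrite /= => ->.
have [si ji] := (gx_le i, gy_le i).
rewrite /kastR /kastL /xx.
move: (mark i) => r; move: (gx i) (gy i) si ji => s j si ji.
have w1 s0 : (0 < j)%N -> white_at n s0 j.-1 by rewrite /white_at; lia.
case: (posnP j) => [->|j0] /=.
  by case: (0 < s)%N; ring.
rewrite !w1//=; case: (0 < s)%N => /=; ring.
Qed.

End KasteleynDeterminant.

(** * Probabilities as determinants of the inverse *)

Section PrincipalMinor.
Variable F : comUnitRingType.

(** Both sides are the determinant of the same pair of block triangular factors,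
    multiplied in the two orders. *)
Lemma det_Sylvester p q (P : 'M[F]_(p, q)) (Q : 'M[F]_(q, p)) :
  \det (1%:M + P *m Q) = \det (1%:M + Q *m P).
Proof.
have e1 : block_mx (1%:M + P *m Q) P 0 1%:M =
    block_mx 1%:M P (- Q) 1%:M *m block_mx 1%:M 0 Q 1%:M.
  by rewrite mulmx_block !mul1mx !mulmx1 !mulmx0 !add0r addNr.
have e2 : block_mx 1%:M P 0 (1%:M + Q *m P) =
    block_mx 1%:M 0 Q 1%:M *m block_mx 1%:M P (- Q) 1%:M.
  by rewrite mulmx_block !mul1mx !mulmx1 !mul0mx !addr0 subrr addrC.
have := congr1 determinant e1; rewrite det_ublock det1 mulr1 => ->.
have := congr1 determinant e2; rewrite det_ublock det1 mul1r => ->.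
by rewrite !det_mulmx mulrC.
Qed.

(** [A] is the identity plus a matrix supported on the rows in the image of [f],
    so it is [1 + S^T M] with the selection matrix [S]. *)
Lemma det_principal N l (f : 'I_l -> 'I_N) (A : 'M[F]_N) : injective f ->
  (forall i, i \notin codom f -> forall k, A i k = (i == k)%:R) ->
  \det A = \det (\matrix_(i < l, j < l) A (f i) (f j)).
Proof.
move=> fI Aid.
pose S : 'M[F]_(l, N) := \matrix_(i, k) (k == f i)%:R.
have SM p (M : 'M[F]_(N, p)) i k : (S *m M) i k = M (f i) k.
  rewrite mxE (bigD1 (f i)) //= mxE eqxx mul1r big1 ?addr0// => j /negPf ji.
  by rewrite mxE ji mul0r.
have STE k i : S^T k i = (k == f i)%:R by rewrite !mxE.
have AE : A = 1%:M + S^T *m (S *m (A - 1%:M)).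
  apply/matrixP => i k; rewrite mxE [X in _ + X]mxE.
  have [fi|fi] := boolP (i \in codom f); last first.
    rewrite Aid// mxE big1 ?addr0// => j _; rewrite !mxE.
    by case: eqP => [e|_]; [rewrite e codom_f in fi|rewrite mul0r].
  have [j ->] := codomP fi.
  rewrite (bigD1 j) //= [X in _ + (_ + X)]big1 ?addr0.
    by rewrite SM STE eqxx mul1r !mxE addrC subrK.
  by move=> j' /negPf jj; rewrite STE (inj_eq fI) eq_sym jj mul0r.
rewrite {1}AE det_Sylvester; congr (\det _); apply/matrixP => i j.
rewrite mxE -mulmxA SM [X in _ + X]mxE [X in _ + X](bigD1 (f j)) //= STE eqxx mulr1.
rewrite big1 ?addr0 => [|k /negPf kj]; last by rewrite STE kj mulr0.
rewrite !mxE.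
by rewrite (inj_eq fI) addrC subrK.
Qed.

End PrincipalMinor.

Section TilingProbability.
Local Close Scope classical_set_scope.
Variables (R : realType) (a : R) (n m : nat).
Hypothesis a_gt0 : 0 < a.
Hypothesis m_lt : (2 * m < n)%N.
Notation C := R[i].
Notation ac := (a%:C).
Notation T := (2 * m + n)%N.
Notation I := 'I_(grid_size n m).
Notation K1 := (kast_mx a (n := n) (m := m) (fun _ _ => 1)).

Let n_gt0 : (0 < n)%N. Proof. by apply: leq_ltn_trans m_lt. Qed.

Definition grid_vec (x : nat -> nat -> C) : 'cV[C]_(grid_size n m) :=
  \col_k (if is_white k then x (gx k) (gy k) else 0).

Lemma grid_vec_aux mark (x : nat -> nat -> C) (i : I) : ~~ is_black i ->
  (kast_mx a mark *m grid_vec x) i 0 = 0.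
Proof.
move=> bi; rewrite mxE big1// => k _; rewrite !mxE /kast_entry (negPf bi).
case: (boolP ((gx k == n + gx i)%N && (gy k == n))) => [/andP[/eqP e1 /eqP e2]|_];
  last by rewrite !mul0r.
by rewrite /is_white /white_at e1 e2 ltnn ltnNge leq_addr mulr0.
Qed.

Lemma kast_mx_unit : K1 \in unitmx.
Proof. by rewrite unitmxE unitfE det_kast_mx_neq0. Qed.

Lemma kast_injective (x : nat -> nat -> C) :
  (forall s j, (s <= T)%N -> (j <= n)%N -> black_at m s j -> kast a n x s j = 0) ->
  forall s i, (s <= T)%N -> (i <= n)%N -> white_at n s i -> x s i = 0.
Proof.
move=> x0 s i sT jn w.
have K0 : K1 *m grid_vec x = 0.
  apply/colP => k; rewrite [RHS]mxE.
  have [bk|bk] := boolP (is_black k); last exact: grid_vec_aux.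
  by rewrite kast_mx_act// !mul1r -/(kast a n x _ _) x0 ?gx_le ?gy_le.
have : grid_vec x = 0 by rewrite -[LHS](mulKmx kast_mx_unit) K0 mulmx0.
move/colP/(_ (grid_index n m s i)); rewrite !mxE /is_white gx_index// gy_index//.
by rewrite w.
Qed.

Variable L : nat -> nat -> nat -> nat -> C.
Hypothesis L_kast : forall s' j', (s' <= T)%N -> (j' <= n)%N ->
  exists2 x : nat -> nat -> C,
    (forall s j, (s <= T)%N -> (j <= n)%N -> black_at m s j ->
       kast a n x s j = ((s == s') && (j == j'))%:R) &
    (forall s j, (s <= T)%N -> (j <= n)%N -> black_at m s j ->
       L s j s' j' = kastR a n x s j).

(** Row [i] of the marked matrix is [mark i false] times that of the Kasteleyn
    matrix, plus [mark i true - mark i false] times its part on right edges. *)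
Lemma generating_matrix mark (i i' : I) : is_black i -> is_black i' ->
  (kast_mx a mark *m invmx K1) i i' =
  mark i false * (i == i')%:R +
  (mark i true - mark i false) * L (gx i) (gy i) (gx i') (gy i').
Proof.
move=> bi bi'.
have [x x1 x2] := L_kast (gx_le i') (gy_le i').
have Kx : K1 *m grid_vec x = delta_mx i' 0.
  apply/colP => k; rewrite [RHS]mxE eqxx andbT.
  have [bk|bk] := boolP (is_black k); last first.
    by rewrite grid_vec_aux//; case: eqP => // e; rewrite e bi' in bk.
  rewrite kast_mx_act// !mul1r -/(kast a n x _ _) x1 ?gx_le ?gy_le//; congr (_%:R).
  congr (nat_of_bool _).
  by apply/andP/eqP => [[/eqP e1 /eqP e2]|-> //]; exact: grid_inj.
have cx : col i' (invmx K1) = grid_vec x.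
  by rewrite colE -Kx mulKmx// kast_mx_unit.
transitivity ((kast_mx a mark *m col i' (invmx K1)) i 0).
  by rewrite !mxE; apply: eq_bigr => k _; rewrite !mxE.
have x1i := x1 _ _ (gx_le i) (gy_le i) bi.
rewrite cx kast_mx_act// (x2 _ _ (gx_le i) (gy_le i) bi).
have -> : (i == i') = (gx i == gx i') && (gy i == gy i').
  by apply/eqP/andP => [-> //|[/eqP e1 /eqP e2]]; exact: grid_inj.
by rewrite -x1i /kast; ring.
Qed.

Section Family.
Variables (l : nat) (b : 'I_l -> I) (x y : C).
Hypothesis b_inj : injective b.
Hypothesis b_black : forall j, is_black (b j).

Let mark (i : I) (r : bool) : C :=
  if i \in codom b then (if r then x else y) else 1.

Lemma det_family : \det (kast_mx a mark) / \det K1 =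
  \det (\matrix_(i < l, j < l) (y * (i == j)%:R +
    (x - y) * L (gx (b i)) (gy (b i)) (gx (b j)) (gy (b j)))).
Proof.
have uK := kast_mx_unit.
have -> : \det (kast_mx a mark) / \det K1 = \det (kast_mx a mark *m invmx K1).
  by rewrite det_mulmx det_inv.
rewrite (det_principal b_inj).
  congr (\det _); apply/matrixP => i j; rewrite [LHS]mxE [RHS]mxE.
  by rewrite generating_matrix// /mark codom_f (inj_eq b_inj).
move=> i ib k.
have -> : (kast_mx a mark *m invmx K1) i k = (K1 *m invmx K1) i k.
  by rewrite !mxE; apply: eq_bigr => k' _; rewrite !mxE /mark (negPf ib) if_same.
by rewrite mulmxV// mxE.
Qed.

Lemma marked_weightE (sg : 'S_(grid_size n m)) : good sg ->
    marked_weight a mark sg =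
  (weight a (covering sg))%:C *
  \prod_(j < l) (if Lparticle (covering sg) (bvertex (b j)) then x else y).
Proof.
move=> gsg; rewrite /marked_weight big_split /= weight_covering//; congr (_ * _).
  by rewrite rmorph_prod; apply: eq_bigr => i _; case: ifP; rewrite ?rmorph1.
rewrite (eq_bigr (fun j => mark (b j) (goes_right sg (b j)))); last first.
  by move=> j _; rewrite Lparticle_covering// /mark codom_f.
rewrite (bigID (fun i => i \in codom b)) /= [X in _ * X]big1 ?mulr1; last first.
  by move=> i /andP[_ ib]; rewrite /mark (negPf ib).
rewrite (eq_bigl (fun i => i \in b @: [set: 'I_l])); last first.
  move=> i; apply/andP/imsetP => [[_ /codomP[j ->]]|[j _ ->]]; first by exists j.
  by rewrite b_black codom_f.
rewrite big_imset /=; last by move=> ? ? _ _; exact: b_inj.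
by apply: eq_bigl => j; rewrite inE.
Qed.

(** The sign common to all coverings cancels in the quotient of the marked and
    the unmarked determinant. *)
Lemma prob_family (E : pred {set edge n m}) :
  (forall S, dimer_covering S ->
    (E S)%:R = \prod_(j < l) (if Lparticle S (bvertex (b j)) then x else y)) ->
  (prob a E)%:C =
  \det (\matrix_(i < l, j < l) (y * (i == j)%:R +
    (x - y) * L (gx (b i)) (gy (b i)) (gx (b j)) (gy (b j)))).
Proof.
move=> EE; rewrite -det_family.
have [c cE] := det_kast_mx a n m; rewrite !cE.
rewrite -mulf_div divff ?signr_eq0// mul1r.
rewrite /prob rmorphM fmorphV /= !rmorph_sum /=; congr (_ / _).
  rewrite (sum_coverings n_gt0 (fun S => (weight a S)%:C) E)//.
  rewrite big_mkcondr /=; apply: eq_bigr => sg gsg.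
  rewrite marked_weightE// -EE; last exact: dimer_covering_covering.
  by case: (E _); rewrite ?mulr1 ?mulr0.
transitivity (\sum_(S : {set edge n m} | dimer_covering S && xpredT S)
    (weight a S)%:C).
  by apply: eq_bigl => S; rewrite andbT.
rewrite (sum_coverings n_gt0 (fun S => (weight a S)%:C))//.
rewrite (eq_bigl (fun sg => good sg)); last by move=> sg; rewrite andbT.
apply: eq_bigr => sg gsg; rewrite weight_covering// /marked_weight rmorph_prod.
by apply: eq_bigr => i _; rewrite mulr1; case: ifP; rewrite ?rmorph1.
Qed.

End Family.

End TilingProbability.

Section ProductOfIndicators.

Lemma prod_indicators (F : comPzSemiRingType) (I : finType) (P : pred I) :
  ([forall i, P i])%:R = \prod_i (if P i then 1 else 0) :> F.
Proof.
have [h|] := boolP [forall i, P i]; first by rewrite big1// =>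
    i _; rewrite (forallP h).
by rewrite negb_forall => /existsP[i /negPf Pi]; rewrite (bigD1 i)//= Pi mul0r.
Qed.

Lemma mem_gap_index n q (k l : 'I_q -> nat) (p : 'I_q * 'I_n.+1) :
  (p \in gap_index n k l) = odd p.2 && (k p.1 <= p.2 <= l p.1)%N.
Proof. by rewrite /gap_index finset.in_set. Qed.

End ProductOfIndicators.

Theorem theorem1p1 (R : realType) (a : R) (n rho m : nat)
    (Gin Gout : R -> R[i]) :
  0 < a -> (1 <= n)%N -> (1 <= rho <= n)%N -> (n - rho = 2 * m)%N ->
  contour0a a set0 Gin -> contour0a a (trace Gin) Gout ->
  let alpha := (n - rho + 1)%N in
  let L := Lkernel a n rho Gin Gout in
  [/\ set_bij (funs_ge R alpha) (funs_ge R alpha)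
        (I_minus_K a n Gin Gout alpha),
      forall (l : nat) (b : 'I_l -> vertex n m),
        injective b ->
        (forall j, black (b j)) ->
        (forall j, exists2 s : nat, (1 <= s <= 2 * n - rho)%N &
                     xi (b j) = 2 * s%:Z) ->
        (prob a (fun T => [forall j, Lparticle T (b j)]))%:C =
        \det (\matrix_(i < l, j < l)
                L (xi (b i)) (eta (b i)) (xi (b j)) (eta (b j)))
    & forall (q : nat) (s k l : 'I_q -> nat),
        injective s ->
        (forall i, (1 <= s i <= 2 * n - rho)%N) ->
        (forall i, (k i < l i <= n)%N) ->
        (prob a (fun T => [forall i, forall b : vertex n m,
           [&& black b, xi b == 2 * (s i)%:Z & (k i)%:Z <= eta b <= (l i)%:Z]
           ==> ~~ Lparticle T b]))%:C =
        \det (1%:M - \matrix_(u < #|gap_index n k l|, v < #|gap_index n k l|)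
                let: (i, eta1) := enum_val u in
                let: (j, eta2) := enum_val v in
                L (2 * (s i)%:Z) (eta1 : nat)%:Z
                  (2 * (s j)%:Z) (eta2 : nat)%:Z)].
Proof.
move=> a_gt0 n_gt0 /andP[rho_gt0 rho_le] nm cin cout alpha L.
have m_lt : (2 * m < n)%N by lia.
have alphaE : alpha = (2 * m + 1)%N by rewrite /alpha nm.
have hin := contour0a_good cin; have hout := contour0a_good cout.
have henc z : trace Gin z -> encloses Gout z by case: cout => _ _ _ + _; apply.
have [UV hUV] := choice (fun k => pole_split a_gt0 (2 * m) n 'X^(2 * m + n - k)).
have kinj := @kast_injective R a n m a_gt0 m_lt.
have Lkast s' j' (s'T : (s' <= 2 * m + n)%N) (j'n : (j' <= n)%N) :
    exists2 x : nat -> nat -> R[i],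
    (forall s j, (s <= 2 * m + n)%N -> (j <= n)%N -> black_at m s j ->
       kast a n x s j = ((s == s') && (j == j'))%:R) &
    (forall s j, (s <= 2 * m + n)%N -> (j <= n)%N -> black_at m s j ->
       L (2 * s%:Z) (2 * j%:Z - 1) (2 * s'%:Z) (2 * j'%:Z - 1) = kastR a n x s j).
  have [x x1 x2] := @Lkernel_kastR R a a_gt0 n m Gin Gout hin hout henc kinj
    (fun k => (UV k).1) (fun k => (UV k).2) (fun k => (hUV k).1) (fun k =>
        (hUV k).2)
    s' j' s'T j'n.
  by exists x => // s j sT jn bsj; rewrite -x2// /L /Lkernel -/alpha alphaE.
split.
- rewrite alphaE; apply: (I_minus_K_bij a_gt0 hin hout henc).
  exact: (@unit_1K R a a_gt0 n m Gin Gout hin hout henc kinj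
    (fun k => (UV k).1) (fun k => (UV k).2) (fun k => (hUV k).1) (fun k =>
        (hUV k).2)).
- move=> l b b_inj b_black _.
  have [g gE] := choice (fun j => let: ex_intro2 i Bi bi := blackP (b_black j) in
    ex_intro (fun i => is_black i /\ b j = bvertex i) i (conj Bi bi)).
  have g_inj : injective g.
    by move=> i j e; apply: b_inj; rewrite (gE i).2 (gE j).2 e.
  rewrite (prob_family a_gt0 m_lt Lkast (x := 1) (y := 0) g_inj (fun j =>
      (gE j).1)).
    congr (\det _); apply/matrixP => i j; rewrite !mxE mul0r add0r subr0 mul1r.
    by rewrite (gE i).2 (gE j).2 /xi /eta !pos_bvertex.
  move=> S _; rewrite prod_indicators; apply: eq_bigr => j _.
  by rewrite (gE j).2.
- move=> q s k l s_inj s_range kl.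
  (* The odd number [eta = 2 j - 1] belongs to the row [j = uphalf eta]. *)
  pose g (u : 'I_#|gap_index n k l|) : 'I_(grid_size n m) :=
    grid_index n m (s (enum_val u).1) (uphalf (enum_val u).2).
  have gap (u : 'I_#|gap_index n k l|) : odd (enum_val u : 'I_q * 'I_n.+1).2 /\
      (k (enum_val u).1 <= (enum_val u).2 <= l (enum_val u).1)%N.
    by have := enum_valP u; rewrite mem_gap_index => /andP[].
  have sT i : (s i <= 2 * m + n)%N by have := s_range i; lia.
  have jT (e : 'I_n.+1) : (uphalf e <= n)%N by have := ltn_ord e;
      rewrite uphalf_half; lia.
  have oddE (e : 'I_n.+1) : odd e -> 2 * (uphalf e)%:Z - 1 = (e : nat)%:Z :> int.
    by move=> oe; have := odd_double_half e; rewrite oe uphalf_half oe; lia.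
  have gposE u : pos (bvertex (g u)) = (2 * (s (enum_val u).1)%:Z,
      ((enum_val u).2 : nat)%:Z).
    by rewrite pos_bvertex gx_index// gy_index// oddE//; have [] := gap u.
  have g_inj : injective g.
    move=> u v /(congr1 (fun i => pos (bvertex i))); rewrite !gposE => /eqP.
    rewrite xpair_eqE => /andP[/eqP e1 /eqP e2].
    apply: enum_val_inj; apply/eqP; rewrite -pair_eqE; apply/andP; split; apply/eqP.
      by apply: s_inj; move: e1; case: (enum_val u) (enum_val v) =>
          [? ?] [? ?] /=; lia.
    by apply: val_inj; case: e2.
  have g_black u : is_black (g u).
    rewrite /is_black gx_index// gy_index// /black_at uphalf_half.
    by have [-> _] := gap u.
  rewrite (prob_family a_gt0 m_lt Lkast (x := 0) (y := 1) g_inj g_black).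
    congr (\det _); apply/matrixP => u v; rewrite !mxE mul1r sub0r mulN1r.
    congr (_ - _); rewrite !gx_index// !gy_index// !oddE ?(gap _).1//.
    by case: (enum_val u) => i1 h1; case: (enum_val v) => i2 h2.
  move=> S _; set lhs := [forall i, _].
  have -> : lhs = [forall u, ~~ Lparticle S (bvertex (g u))].
    apply/forallP/forallP => [h u|h i].
      have /forallP/(_ (bvertex (g u))) := h (enum_val u).1.
      rewrite black_bvertex g_black /xi /eta gposE eqxx /=.
      by have [_ /andP[h1 h2]] := gap u; rewrite !lez_nat h1 h2.
    apply/forallP => v; apply/implyP => /and3P[bv /eqP xv /andP[kv vl]].
    have [i0 Bi0 vE] := blackP bv.
    have ei : eta v = 2 * (gy i0)%:Z - 1 by rewrite vE /eta pos_bvertex.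
    have xi0 : gx i0 = s i by move: xv; rewrite vE /xi pos_bvertex /=; lia.
    have hj : (2 * gy i0 - 1 < n.+1)%N by move: kv vl; rewrite ei; have := kl i;
        lia.
    have j0 : (0 < gy i0)%N by move: kv; rewrite ei; lia.
    pose p : 'I_q * 'I_n.+1 := (i, Ordinal hj).
    have pg : p \in gap_index n k l.
      rewrite mem_gap_index /=; move: kv vl; rewrite ei => kv vl.
      by apply/andP; split; lia.
    have := h (enum_rank_in pg p); suff -> : bvertex (g (enum_rank_in pg p))
        = v by [].
    apply: pos_inj; rewrite gposE enum_rankK_in//= vE pos_bvertex xi0.
    by congr (_, _); lia.
  rewrite prod_indicators; apply: eq_bigr => u _.
  by case: (Lparticle _ _).
Qed.
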